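(* Let $f:\mathbb{R}^l\times\mathbb{R}^n\to\mathbb{R}^n$ be continuously differentiable, $g:\mathbb{R}^l\times\mathbb{R}^n\times\mathbb{R}^n\to\mathbb{R}^s$ twice continuously differentiable, $D\subset\mathbb{R}^s$ convex polyhedral, $\Gamma(p,x):=\{z\in\mathbb{R}^n\mid g(p,x,z)\in D\}$, and let $S(p):=\{x\in\mathbb{R}^n\mid 0\in f(p,x)+\widehat N_{\Gamma(p,x)}(x)\}$. Let $\bar x\in S(\bar p)$ and assume that there is $\kappa>0$ such that $\mathrm{dist}(z,\Gamma(p,x))\le\kappa\,\mathrm{dist}(g(p,x,z),D)$ for all $(p,x,z)$ in a neighborhood of $(\bar p,\bar x,\bar x)$. Let $P\subset\mathbb{R}^l$ be a closed set containing $\bar p$ such that the following assumptions are fulfilled (with $b,\tilde g,\Psi,\Xi,\mathcal{L}_\lambda,\mathcal{K}_D$ as defined in the context). (i) For every $q\in T_P(\bar p)$ there is some $u\in\mathbb{R}^n$ such that $$0\in\nabla f(\bar p,\bar x)(q,u)+D\Psi\big((\bar p,\bar x,\bar x),-f(\bar p,\bar x)\big)(q,u,u).\qquad( * )$$ (ii) For every $(0,0)\neq(q,u)\in\mathbb{R}^l\times\mathbb{R}^n$ satisfying $( * )$, the condition $$\nabla_2\tilde g(\bar p,\bar x)^T\mu=0,\ \mu\in\mathrm{sp}\,N_{T_D(\tilde g(\bar p,\bar x))}\big(\nabla\tilde g(\bar p,\bar x)(q,u)\big)\ \Rightarrow\ \mu=0$$ is fulfilled, and for every $\hat\lambda\in\Xi((\bar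 p,\bar x),-f(\bar p,\bar x);(q,u))$, every $\eta\in N_{\mathcal{K}_D(\tilde g(\bar p,\bar x),\hat\lambda)}(\nabla\tilde g(\bar p,\bar x)(q,u))$ satisfying $0=\nabla\mathcal{L}_{\hat\lambda}(\bar p,\bar x)(q,u)+b(\bar p,\bar x)^T\eta$, every pair of faces $\mathcal{F}_1,\mathcal{F}_2$ of the critical cone $\mathcal{K}_D(\tilde g(\bar p,\bar x),\hat\lambda)$ with $\nabla\tilde g(\bar p,\bar x)(q,u)\in\mathcal{F}_2\subset\mathcal{F}_1\subset[\eta]^\perp$, and every $w\neq0$ in $\mathbb{R}^n$ with $b(\bar p,\bar x)w\in\mathcal{F}_1-\mathcal{F}_2$, there is some $\tilde w\in\mathbb{R}^n$ with $\nabla_2\tilde g(\bar p,\bar x)\tilde w\in\mathcal{F}_1-\mathcal{F}_2$ such that $$w^T\nabla_2\mathcal{L}_{\hat\lambda}(\bar p,\bar x)\tilde w>0.$$ Then $S$ has the Aubin property relative to $P$ around $(\bar p,\bar x)$, and for every $q\in T_P(\bar p)$ $$DS(\bar p,\bar x)(q)=\{u\in\mathbb{R}^n\mid 0\in\nabla f(\bar p,\bar x)(q,u)+D\Psi\big((\bar p,\bar x,\bar x),-f(\bar p,\bar x)\big)(q,u,u)\}.$$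
   Context: Cones. For a closed set $\Omega\subset\mathbb{R}^d$ and $\bar z\in\Omega$: $T_\Omega(\bar z):=\{u\mid\exists u_k\to u,\ t_k\downarrow0:\ \bar z+t_ku_k\in\Omega\ \forall k\}$ (tangent cone); the same definition is used for graphs of set-valued maps. $A^\circ$ is the (negative) polar of $A$; $\widehat N_\Omega(\bar z):=T_\Omega(\bar z)^\circ$ is the regular (Fréchet) normal cone, written $N_\Omega(\bar z)$ when $\Omega$ is convex. All these cones are $\emptyset$ if $\bar z\notin\Omega$. $\mathrm{sp}\,A$ is the linear hull of $A$, $[a]$ the linear span of the vector $a$, $[a]^\perp$ its orthogonal complement. The critical cone is $\mathcal{K}_D(z,z^* ):=T_D(z)\cap[z^*]^\perp$ for $z^*\in N_D(z)$. A face of a convex polyhedral cone $K$ is a set of the form $K\cap[z^*]^\perp$ with $z^*\in K^\circ$. $\mathrm{dist}(x,A)=\inf_{y\in A}\|x-y\|$, $\mathrm{dist}(x,\emptyset)=\infty$. Graphical derivative of a set-valued map $F$ at $(\bar x,\bar y)\in\mathrm{gph}\,F$: $DF(\bar x,\bar y)(u):=\{v\mid(u,v)\in T_{\mathrm{gph}\,F}(\bar x,\bar y)\}$. Aubin property of $S$ relative to $P$ around $(\bar p,\bar x)$: there are neighborhoods $V$ of $\bar p$, $U$ of $\bar x$ and $L\ge0$ with $S(p)\cap U\subset S(p')+L\|p-p'\|\mathcal{B}$ for all $p,p'\in P\cap V$, where $\mathcal{B}$ is the closed unit ball. Notation. $\nabla$ is the Jacobian and $\nabla_i$ the partial Jacobian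 with respect to the $i$-th (vector) argument. $\tilde g(p,x):=g(p,x,x)$, $b(p,x):=\nabla_3g(p,x,x)$, $\Psi(p,x,z):=\widehat N_{\Gamma(p,x)}(z)$, $\mathcal{L}_\lambda(p,x):=f(p,x)+b(p,x)^T\lambda$ for $\lambda\in\mathbb{R}^s$, and $\Xi((p,x),x^*;(q,u)):=\{\mu\in N_D(\tilde g(p,x))\mid b(p,x)^T\mu=x^*,\ \nabla\tilde g(p,x)(q,u)\in\mathcal{K}_D(\tilde g(p,x),\mu)\}$. *)

(* Defs.v *)
From HB Require Import structures.
From mathcomp Require Import all_boot all_order all_algebra.
From mathcomp Require Import all_classical all_reals all_analysis.
Import Order.TTheory GRing.Theory Num.Theory.
Import numFieldNormedType.Exports.

Set Implicit Arguments.
Unset Strict Implicit.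
Unset Printing Implicit Defensive.

Local Open Scope classical_set_scope.
Local Open Scope ring_scope.

Definition dot (R : realType) (n : nat) (x y : 'cV[R]_n) : R :=
  (x^T *m y) 0 0.

(* The library norm `|x| on matrices is the max norm (with the same topology);
   norms of vectors in the statement are Euclidean. *)
Definition enorm (R : realType) (n : nat) (x : 'cV[R]_n) : R :=
  Num.sqrt (dot x x).

(* +oo when A is empty. *)
Definition edist_set (R : realType) (n : nat) (x : 'cV[R]_n)
    (A : set 'cV[R]_n) : \bar R :=
  ereal_inf [set (enorm (x - y))%:E | y in A].

(* In finite dimension, continuity of every directional map x |-> F'(x) v is
   continuity of the Jacobian. *)
Definition C1 (R : realType) (V W : normedModType R) (F : V -> W) : Prop :=
  (forall x, differentiable F x) /\
  (forall v, continuous (fun x => 'd F x v)).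

Definition C2 (R : realType) (V W : normedModType R) (F : V -> W) : Prop :=
  C1 F /\ forall v, C1 (fun x => 'd F x v).

(* Jacobian acting on column vectors by left multiplication: the transpose of
   the row-vector convention of [jacobian] in derive.v. *)
Definition Jac (R : realType) (n m : nat) (F : 'cV[R]_n -> 'cV[R]_m)
    (x : 'cV[R]_n) : 'M[R]_(m, n) :=
  \matrix_(i, j) ('d F x (delta_mx j 0)) i 0.

Definition Jac2 (R : realType) (l n m : nat)
    (F : 'cV[R]_l * 'cV[R]_n -> 'cV[R]_m) (px : 'cV[R]_l * 'cV[R]_n) :
    'M[R]_(m, n) :=
  Jac (fun x => F (px.1, x)) px.2.

Definition convex_polyhedral (R : realType) (s : nat)
    (D : set 'cV[R]_s) : Prop :=
  exists (m : nat) (A : 'M[R]_(m, s)) (c : 'cV[R]_m),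
    D = [set x | forall i, (A *m x) i 0 <= c i 0].

Definition linear_hull (R : realType) (n : nat) (A : set 'cV[R]_n) :
    set 'cV[R]_n :=
  [set v | exists (k : nat) (c : 'I_k -> R) (a : 'I_k -> 'cV[R]_n),
     (forall i, A (a i)) /\ v = \sum_(i < k) c i *: a i].

Definition orth (R : realType) (n : nat) (A : set 'cV[R]_n) : set 'cV[R]_n :=
  [set v | forall a, A a -> dot a v = 0].

Definition perp (R : realType) (n : nat) (a : 'cV[R]_n) : set 'cV[R]_n :=
  orth (linear_hull [set a]).

Definition polar (R : realType) (n : nat) (A : set 'cV[R]_n) : set 'cV[R]_n :=
  [set v | forall a, A a -> dot v a <= 0].

Definition minkowski_diff (R : realType) (n : nat) (A B : set 'cV[R]_n) :
    set 'cV[R]_n :=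
  [set a - b | a in A & b in B].

(* t_k decreases to 0 in the sense t_k > 0 and t_k --> 0. *)
Definition tangent_cone (R : realType) (V : normedModType R) (Omega : set V)
    (z : V) : set V :=
  [set u | Omega z /\ exists (u_ : nat -> V) (t_ : nat -> R),
     [/\ u_ @ \oo --> u, t_ @ \oo --> (0 : R), (forall k, 0 < t_ k)
       & forall k, Omega (z + t_ k *: u_ k)]].

(* Membership of z is explicit because the polar of the empty set is the whole
   space, whereas the normal cone at z outside Omega is empty. *)
Definition normal_cone (R : realType) (n : nat) (Omega : set 'cV[R]_n)
    (z : 'cV[R]_n) : set 'cV[R]_n :=
  [set v | Omega z /\ polar (tangent_cone Omega z) v].

Definition critical_cone (R : realType) (s : nat) (D : set 'cV[R]_s)
    (z zs : 'cV[R]_s) : set 'cV[R]_s :=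
  tangent_cone D z `&` perp zs.

Definition is_face (R : realType) (s : nat) (K F : set 'cV[R]_s) : Prop :=
  exists2 zs, polar K zs & F = K `&` perp zs.

Definition graph (U W : Type) (F : U -> set W) : set (U * W) :=
  [set xy | F xy.1 xy.2].

Definition graphical_derivative (R : realType) (U W : normedModType R)
    (F : U -> set W) (x : U) (y : W) (u : U) : set W :=
  [set v | tangent_cone (graph F) (x, y) (u, v)].

Definition aubin_property_rel (R : realType) (l n : nat)
    (S : 'cV[R]_l -> set 'cV[R]_n) (P : set 'cV[R]_l)
    (pbar : 'cV[R]_l) (xbar : 'cV[R]_n) : Prop :=
  exists (V : set 'cV[R]_l) (U : set 'cV[R]_n) (L : R),
    [/\ nbhs pbar V, nbhs xbar U, 0 <= L &
      forall p p', (P `&` V) p -> (P `&` V) p' ->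
        S p `&` U `<=`
          [set y + (L * enorm (p - p')) *: e
             | y in S p' & e in [set e : 'cV[R]_n | enorm e <= 1]]].

(* A triple (p, x, z) is ((p, x), z), so that g is applied to (px, z) with
   px = (p, x). *)

Definition Gamma (R : realType) (l n s : nat)
    (g : 'cV[R]_l * 'cV[R]_n * 'cV[R]_n -> 'cV[R]_s) (D : set 'cV[R]_s)
    (px : 'cV[R]_l * 'cV[R]_n) : set 'cV[R]_n :=
  [set z | D (g (px, z))].

Definition Psi (R : realType) (l n s : nat)
    (g : 'cV[R]_l * 'cV[R]_n * 'cV[R]_n -> 'cV[R]_s) (D : set 'cV[R]_s)
    (pxz : 'cV[R]_l * 'cV[R]_n * 'cV[R]_n) : set 'cV[R]_n :=
  normal_cone (Gamma g D pxz.1) pxz.2.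

Definition sol_map (R : realType) (l n s : nat)
    (f : 'cV[R]_l * 'cV[R]_n -> 'cV[R]_n)
    (g : 'cV[R]_l * 'cV[R]_n * 'cV[R]_n -> 'cV[R]_s) (D : set 'cV[R]_s)
    (p : 'cV[R]_l) : set 'cV[R]_n :=
  [set x | [set f (p, x) + v | v in normal_cone (Gamma g D (p, x)) x] 0].

Definition gtilde (R : realType) (l n s : nat)
    (g : 'cV[R]_l * 'cV[R]_n * 'cV[R]_n -> 'cV[R]_s)
    (px : 'cV[R]_l * 'cV[R]_n) : 'cV[R]_s :=
  g (px, px.2).

Definition bmap (R : realType) (l n s : nat)
    (g : 'cV[R]_l * 'cV[R]_n * 'cV[R]_n -> 'cV[R]_s)
    (px : 'cV[R]_l * 'cV[R]_n) : 'M[R]_(s, n) :=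
  Jac (fun z => g (px, z)) px.2.

Definition Lag (R : realType) (l n s : nat)
    (f : 'cV[R]_l * 'cV[R]_n -> 'cV[R]_n)
    (g : 'cV[R]_l * 'cV[R]_n * 'cV[R]_n -> 'cV[R]_s)
    (lambda : 'cV[R]_s) (px : 'cV[R]_l * 'cV[R]_n) : 'cV[R]_n :=
  f px + (bmap g px)^T *m lambda.

Definition Xi (R : realType) (l n s : nat)
    (g : 'cV[R]_l * 'cV[R]_n * 'cV[R]_n -> 'cV[R]_s) (D : set 'cV[R]_s)
    (px : 'cV[R]_l * 'cV[R]_n) (xs : 'cV[R]_n)
    (qu : 'cV[R]_l * 'cV[R]_n) : set 'cV[R]_s :=
  [set mu | [/\ normal_cone D (gtilde g px) mu,
                (bmap g px)^T *m mu = xs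
              & critical_cone D (gtilde g px) mu ('d (gtilde g) px qu)]].

(* 0 \in f'(px)(q, u) + D Psi((px, x), - f(px))(q, u, u), with px = (p, x). *)
Definition linearized_ge (R : realType) (l n s : nat)
    (f : 'cV[R]_l * 'cV[R]_n -> 'cV[R]_n)
    (g : 'cV[R]_l * 'cV[R]_n * 'cV[R]_n -> 'cV[R]_s) (D : set 'cV[R]_s)
    (px : 'cV[R]_l * 'cV[R]_n) (q : 'cV[R]_l) (u : 'cV[R]_n) : Prop :=
  [set 'd f px (q, u) + v
     | v in graphical_derivative (Psi g D) (px, px.2) (- f px) (q, u, u)] 0.

(* Main.v *)
Require Import Defs.
From HB Require Import structures.
From mathcomp Require Import all_boot all_order all_algebra.
From mathcomp Require Import all_classical all_reals all_analysis.
From mathcomp Require Import ring lra.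
Import Order.TTheory GRing.Theory Num.Theory.
Import numFieldNormedType.Exports.

(** A solution x of the generalized equation at p is, near the reference point, a
    point for which there is a multiplier lam with

      f (p, x) + b (p, x)^T lam = 0,   lam in N_D (g (p, x, x)),

    and metric subregularity bounds lam by a fixed multiple of the norm of
    f (p, x) (multiplier_near). Replacing g (p, x, x) by a free variable y, the
    problem becomes: find a zero of the residual
    (f + b^T lam, g (p, x, x) - y) on the graph of N_D, which is a finite union
    of polyhedra and does not depend on p.

    The heart of the proof is kkt_correction. Take approximate solutions with
    residual o(t_k) whose scaled difference from the reference point tends to a
    nonzero direction d = (q, u) solving the linearized equation. Then there are
    true solutions at distance o(t_k), with explicit control of the step. For if
    not, minimise the norm of the residual plus a small multiple of the
    distance to the given point, as in the variational principle of Ekeland. A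
    minimiser with nonzero residual gives a unit vector (w, mu) that almost
    solves the adjoint system, and it still approaches the reference point
    along d, because the distance travelled is o(t_k). In the limit
    (kkt_seq_limit) the multipliers converge to some lam in Xi, their
    increments produce an eta, and the active constraints and the support of the
    multipliers, which are constant along the sequence, produce two faces
    F2, F1 of the critical cone; (w, mu) solves the exact adjoint system for
    these data. The assumption on directions says that the adjoint system
    has only the zero solution (dir_regular_trivial), a contradiction.

    The Aubin property follows by comparing delta = |p - p'| with the distance
    tau of (p, x) to the reference point. If delta = o(tau), the point x with
    its multiplier is an approximate solution at p' with residual O(delta), and
    it can be corrected (solution_stability). If delta is at least a fixed
    multiple of tau, it is enough to find some solution at p' whose distance to
    the reference solution is O(|p' - pbar|) (solution_near_base). The linearized
    equation provides lam and eta for the direction of p' - pbar, and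
    lam + t eta is a multiplier of an approximate solution for every sequence
    of step lengths t (kkt_limit_seq). The formula for the graphical derivative
    is another instance of the correction step.

    Compactness is used through ultrafilters: along an ultrafilter, bounded
    families converge and families with finitely many values are eventually
    constant, which replaces the extraction of subsequences. *)

Set Implicit Arguments.
Unset Strict Implicit.
Unset Printing Implicit Defensive.

Local Open Scope classical_set_scope.
Local Open Scope ring_scope.

(** * Inner product, Euclidean norm and maximum norm *)

Lemma dotE (R : realType) (n : nat) (x y : 'cV[R]_n) :
  dot x y = \sum_i x i 0 * y i 0.
Proof. by rewrite /dot mxE; apply: eq_bigr => i _; rewrite mxE. Qed.

Lemma dotC (R : realType) (n : nat) (x y : 'cV[R]_n) : dot x y = dot y x.
Proof. by rewrite !dotE; apply: eq_bigr => i _; rewrite mulrC. Qed.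

Lemma dotDr (R : realType) (n : nat) (x y z : 'cV[R]_n) :
  dot x (y + z) = dot x y + dot x z.
Proof. by rewrite /dot mulmxDr mxE. Qed.

Lemma dotZr (R : realType) (n : nat) (a : R) (x y : 'cV[R]_n) :
  dot x (a *: y) = a * dot x y.
Proof. by rewrite /dot -scalemxAr mxE. Qed.

Lemma dotNr (R : realType) (n : nat) (x y : 'cV[R]_n) :
  dot x (- y) = - dot x y.
Proof. by rewrite /dot mulmxN mxE. Qed.

Lemma dotBr (R : realType) (n : nat) (x y z : 'cV[R]_n) :
  dot x (y - z) = dot x y - dot x z.
Proof. by rewrite dotDr dotNr. Qed.

Lemma dot0r (R : realType) (n : nat) (x : 'cV[R]_n) : dot x 0 = 0.
Proof. by rewrite /dot mulmx0 mxE. Qed.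

Lemma dotDl (R : realType) (n : nat) (x y z : 'cV[R]_n) :
  dot (x + y) z = dot x z + dot y z.
Proof. by rewrite dotC dotDr !(dotC z). Qed.

Lemma dotZl (R : realType) (n : nat) (a : R) (x y : 'cV[R]_n) :
  dot (a *: x) y = a * dot x y.
Proof. by rewrite dotC dotZr dotC. Qed.

Lemma dotNl (R : realType) (n : nat) (x y : 'cV[R]_n) :
  dot (- x) y = - dot x y.
Proof. by rewrite dotC dotNr dotC. Qed.

Lemma dotBl (R : realType) (n : nat) (x y z : 'cV[R]_n) :
  dot (x - y) z = dot x z - dot y z.
Proof. by rewrite dotDl dotNl. Qed.

Lemma dot0l (R : realType) (n : nat) (x : 'cV[R]_n) : dot 0 x = 0.
Proof. by rewrite dotC dot0r. Qed.

Lemma dot_suml (R : realType) (n : nat) (I : Type) (r : seq I) (P : pred I)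
    (F : I -> 'cV[R]_n) (y : 'cV[R]_n) :
  dot (\sum_(i <- r | P i) F i) y = \sum_(i <- r | P i) dot (F i) y.
Proof.
elim/big_rec2: _ => [|i u v _ <-]; first exact: dot0l.
exact: dotDl.
Qed.

Lemma dot_mulmx (R : realType) (m n : nat) (M : 'M[R]_(m, n)) (x : 'cV[R]_m)
    (y : 'cV[R]_n) : dot x (M *m y) = dot (M^T *m x) y.
Proof. by rewrite /dot trmx_mul trmxK mulmxA. Qed.

Lemma dot_ge0 (R : realType) (n : nat) (x : 'cV[R]_n) : 0 <= dot x x.
Proof. by rewrite dotE sumr_ge0 // => i _; rewrite -expr2 sqr_ge0. Qed.

Lemma dot_eq0 (R : realType) (n : nat) (x : 'cV[R]_n) : dot x x = 0 -> x = 0.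
Proof.
rewrite dotE => /eqP; rewrite psumr_eq0; last first.
  by move=> i _; rewrite -expr2 sqr_ge0.
move=> /allP x0; apply/colP => i; rewrite mxE.
have /implyP/(_ isT) := x0 i (mem_index_enum i).
by rewrite mulf_eq0 orbb => /eqP.
Qed.

Lemma enorm_ge0 (R : realType) (n : nat) (x : 'cV[R]_n) : 0 <= enorm x.
Proof. exact: sqrtr_ge0. Qed.

Lemma sqr_enorm (R : realType) (n : nat) (x : 'cV[R]_n) :
  enorm x ^+ 2 = dot x x.
Proof. by rewrite sqr_sqrtr // dot_ge0. Qed.

Lemma enorm_eq0 (R : realType) (n : nat) (x : 'cV[R]_n) :
  enorm x = 0 -> x = 0.
Proof. by move=> x0; apply: dot_eq0; rewrite -sqr_enorm x0 expr0n. Qed.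

Lemma enorm0 (R : realType) (n : nat) : enorm (0 : 'cV[R]_n) = 0.
Proof. by rewrite /enorm dot0l sqrtr0. Qed.

Lemma enorm_gt0 (R : realType) (n : nat) (x : 'cV[R]_n) :
  x <> 0 -> 0 < enorm x.
Proof.
by move=> x0; rewrite lt_def enorm_ge0 andbT; apply/eqP => /enorm_eq0.
Qed.

Lemma enormZ (R : realType) (n : nat) (a : R) (x : 'cV[R]_n) :
  enorm (a *: x) = `|a| * enorm x.
Proof.
by rewrite /enorm dotZl dotZr mulrA -expr2 sqrtrM ?sqr_ge0// sqrtr_sqr.
Qed.

Lemma enormN (R : realType) (n : nat) (x : 'cV[R]_n) : enorm (- x) = enorm x.
Proof. by rewrite /enorm dotNl dotNr opprK. Qed.

(** Cauchy-Schwarz, from the nonnegativity of the square of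
    |y| x - |x| y. *)
Lemma dot_le_enorm (R : realType) (n : nat) (x y : 'cV[R]_n) :
  dot x y <= enorm x * enorm y.
Proof.
have [/eqP/enorm_eq0 ->|x0] := boolP (enorm x == 0).
  by rewrite dot0l enorm0 mul0r.
have [/eqP/enorm_eq0 ->|y0] := boolP (enorm y == 0).
  by rewrite dot0r enorm0 mulr0.
have p : 0 < enorm x * enorm y.
  by rewrite mulr_gt0 // lt_def enorm_ge0 ?x0 ?y0.
have := dot_ge0 (enorm y *: x - enorm x *: y).
rewrite dotBl !dotBr !dotZl !dotZr (dotC y x) -!sqr_enorm => H.
rewrite -(ler_pM2l p); nra.
Qed.

Lemma ler_enormD (R : realType) (n : nat) (x y : 'cV[R]_n) :
  enorm (x + y) <= enorm x + enorm y.
Proof.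
rewrite -(@ler_pXn2r _ 2) ?nnegrE ?addr_ge0 ?enorm_ge0 //.
rewrite sqr_enorm dotDl !dotDr (dotC y x) -!sqr_enorm.
by have := dot_le_enorm x y; nra.
Qed.

Lemma coord_le_norm (R : realType) (m n : nat) (M : 'M[R]_(m, n)) i j :
  `|M i j| <= `|M|.
Proof.
rewrite /Num.norm /= mx_normrE.
exact: (le_bigmax_cond _ (j := (i, j)) (fun ij : 'I_m * 'I_n => `|M ij.1 ij.2|)).
Qed.

Lemma norm_le_coord (R : realType) (m n : nat) (M : 'M[R]_(m, n)) (e : R) :
  0 <= e -> (forall i j, `|M i j| <= e) -> `|M| <= e.
Proof.
move=> e0 He; rewrite /Num.norm /= mx_normrE.
by apply: bigmax_le => // ij _; exact: He.
Qed.

Lemma norm_le_enorm (R : realType) (n : nat) (x : 'cV[R]_n) : `|x| <= enorm x.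
Proof.
apply: norm_le_coord => [|i j]; first exact: enorm_ge0.
rewrite (ord1 j) -(@ler_pXn2r _ 2) ?nnegrE ?enorm_ge0 // sqr_enorm dotE.
rewrite (bigD1 i) //= real_normK ?num_real // expr2 lerDl.
by apply: sumr_ge0 => k _; rewrite -expr2 sqr_ge0.
Qed.

Lemma enorm_le_norm (R : realType) (n : nat) (x : 'cV[R]_n) :
  enorm x <= n%:R * `|x|.
Proof.
rewrite -(@ler_pXn2r _ 2) ?nnegrE ?enorm_ge0 ?mulr_ge0 // sqr_enorm dotE.
apply: (@le_trans _ _ (\sum_(i < n) `|x| ^+ 2)).
  apply: ler_sum => i _; rewrite -expr2 -real_normK ?num_real //.
  by rewrite ler_pXn2r ?nnegrE // coord_le_norm.
rewrite sumr_const card_ord exprMn -[_ *+ n]mulr_natl.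
apply: ler_wpM2r; first exact: sqr_ge0.
by rewrite -natrX ler_nat; case: n {x} => // n; rewrite expnS expn1 leq_pmulr.
Qed.

Lemma norm_mulmx_le (R : realType) (m n p : nat) (M : 'M[R]_(m, n)) (N : 'M[R]_(n, p)) :
  `|M *m N| <= n%:R * (`|M| * `|N|).
Proof.
apply: norm_le_coord => [|i j]; first by rewrite mulr_ge0 // mulr_ge0.
rewrite mxE (le_trans (ler_norm_sum _ _ _)) //.
apply: (@le_trans _ _ (\sum_(k < n) `|M| * `|N|)).
  by apply: ler_sum => k _; rewrite normrM ler_pM // coord_le_norm.
by rewrite sumr_const card_ord mulr_natl.
Qed.

Lemma norm_trmx (R : realType) (m n : nat) (M : 'M[R]_(m, n)) : `|M^T| <= `|M|.
Proof.
by apply: norm_le_coord => // i j; rewrite mxE; exact: coord_le_norm.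
Qed.

(** * Limits along filters and ultrafilters *)

Lemma cvg_mxP (T : Type) (F : set_system T) {FF : Filter F} (R : realType)
    (m n : nat) (u : T -> 'M[R]_(m, n)) (L : 'M[R]_(m, n)) :
  (forall i j, u k i j @[k --> F] --> L i j) <-> u @ F --> L.
Proof.
split=> [H|H i j]; last first.
  by apply: (@cvg_comp _ _ _ u (fun M => M i j) _ _ _ H); exact: coord_continuous.
apply/cvgrPdist_le => e e0.
have : \forall k \near F, forall ij : 'I_m * 'I_n, `|L ij.1 ij.2 - u k ij.1 ij.2| <= e.
  apply: filter_forall => -[i j] /=.
  by have /cvgrPdist_le := H i j; apply.
apply: filterS => k Hk; apply: norm_le_coord => [|i j]; first exact: ltW.
by have := Hk (i, j); rewrite /= !mxE.
Qed.

Lemma cvg_mulmx (T : Type) (F : set_system T) {FF : Filter F} (R : realType)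
    (m n p : nat) (u : T -> 'M[R]_(m, n)) (v : T -> 'M[R]_(n, p))
    (M : 'M[R]_(m, n)) (N : 'M[R]_(n, p)) :
  u @ F --> M -> v @ F --> N -> u k *m v k @[k --> F] --> M *m N.
Proof.
move=> /cvg_mxP uM /cvg_mxP vN; apply/cvg_mxP => i j; rewrite mxE.
under eq_cvg do rewrite mxE.
apply: cvg_big => [|k _]; [exact: add_continuous | exact: cvgM].
Qed.

Lemma cvg_trmx (T : Type) (F : set_system T) {FF : Filter F} (R : realType)
    (m n : nat) (u : T -> 'M[R]_(m, n)) (M : 'M[R]_(m, n)) :
  u @ F --> M -> (u k)^T @[k --> F] --> M^T.
Proof.
move=> /cvg_mxP uM; apply/cvg_mxP => i j; rewrite mxE.
under eq_cvg do rewrite mxE.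
exact: uM.
Qed.

Lemma cvg_dot (T : Type) (F : set_system T) {FF : Filter F} (R : realType)
    (n : nat) (u v : T -> 'cV[R]_n) (x y : 'cV[R]_n) :
  u @ F --> x -> v @ F --> y -> dot (u k) (v k) @[k --> F] --> dot x y.
Proof.
move=> ux vy; rewrite /dot.
exact: ((cvg_mxP _ _).2 (cvg_mulmx (cvg_trmx ux) vy)).
Qed.

Lemma cvg_enorm (T : Type) (F : set_system T) {FF : Filter F} (R : realType)
    (n : nat) (u : T -> 'cV[R]_n) (x : 'cV[R]_n) :
  u @ F --> x -> enorm (u k) @[k --> F] --> enorm x.
Proof.
move=> ux; apply: (@cvg_comp _ _ _ (fun k => dot (u k) (u k)) Num.sqrt).
  by apply: cvg_dot; exact: ux.
exact: sqrt_continuous.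
Qed.

Lemma cvg_npair (T : Type) (F : set_system T) {FF : Filter F} (R : realType)
    (V W : normedModType R) (f : T -> V) (g : T -> W) (x : V) (y : W) :
  f @ F --> x -> g @ F --> y -> (f k, g k) @[k --> F] --> (x, y).
Proof. by move=> fx gy; apply: (@cvg_pair _ _ _ F (nbhs x) (nbhs y) _ _ _ f g). Qed.

Lemma cvg_fst_comp (T : Type) (F : set_system T) {FF : Filter F} (R : realType)
    (V W : normedModType R) (u : T -> V * W) (x : V * W) :
  u @ F --> x -> (u k).1 @[k --> F] --> x.1.
Proof.
move=> ux; apply: (@cvg_comp _ _ _ u fst _ _ _ ux).
exact: (@cvg_fst _ _ (nbhs x.1) (nbhs x.2)).
Qed.

Lemma cvg_snd_comp (T : Type) (F : set_system T) {FF : Filter F} (R : realType)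
    (V W : normedModType R) (u : T -> V * W) (x : V * W) :
  u @ F --> x -> (u k).2 @[k --> F] --> x.2.
Proof.
move=> ux; apply: (@cvg_comp _ _ _ u snd _ _ _ ux).
exact: (@cvg_snd _ _ (nbhs x.1) (nbhs x.2)).
Qed.

Lemma norm_squeeze0 (T : Type) (F : set_system T) {FF : Filter F}
    (R : realType) (V : normedModType R) (u : T -> V) (h : T -> R) :
  (\forall k \near F, `|u k| <= h k) -> h @ F --> (0 : R) -> u @ F --> (0 : V).
Proof.
move=> uh h0; apply: norm_cvg0.
apply: (squeeze_cvgr (f := fun=> 0) (h := h)) => //; last exact: cvg_cst.
by apply: filterS uh => k ->; rewrite normr_ge0.
Qed.

Lemma scaled_cvg0 (T : Type) (F : set_system T) {FF : Filter F} (R : realType)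
    (V : normedModType R) (t_ : T -> R) (x_ : T -> V) (x d : V) :
  (\forall k \near F, 0 < t_ k) -> t_ @ F --> (0 : R) ->
  (t_ k)^-1 *: (x_ k - x) @[k --> F] --> d -> x_ @ F --> x.
Proof.
move=> t0 tt xd.
have H : t_ k *: ((t_ k)^-1 *: (x_ k - x)) + x @[k --> F] --> 0 *: d + x.
  by apply: cvgD; [exact: cvgZ | exact: cvg_cst].
rewrite -[X in _ --> X]add0r -(scale0r d); apply: cvg_trans H.
apply: near_eq_cvg; near=> k.
rewrite scalerA divff ?scale1r ?subrK // gt_eqF //.
by near: k.
Unshelve. all: by end_near. Qed.

Lemma ler_lim_near (T : Type) (F : set_system T) {FF : ProperFilter F}
    (R : realType) (f g : T -> R) (x y : R) :
  f @ F --> x -> g @ F --> y -> (\forall k \near F, f k <= g k) -> x <= y.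
Proof.
move=> fx gy H; rewrite -subr_ge0.
have D : g k - f k @[k --> F] --> y - x by exact: cvgB.
by apply: (cvgr_to_ge D); apply: filterS H => k; rewrite subr_ge0.
Qed.

Lemma near_choice (T S : Type) (F : set_system T) {FF : Filter F} (s0 : S)
    (Q : T -> S -> Prop) : (\forall k \near F, exists u, Q k u) ->
  exists u_ : T -> S, \forall k \near F, Q k (u_ k).
Proof.
move=> H.
have : forall k, exists u, (exists v, Q k v) -> Q k u.
  move=> k; have [[u Hu]|nP] := pselect (exists v, Q k v); first by exists u.
  by exists s0 => /nP.
by move=> /choice[u_ Hu]; exists u_; apply: filterS H => k /Hu.
Qed.

Lemma ultra_contra (T : Type) (U : set_system T) {UU : UltraFilter U}
    (P : T -> Prop) : ~ (\forall k \near U, P k) -> \forall k \near U, ~ P k.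
Proof. by move=> nP; have [] := in_ultra_setVsetC [set k | P k] UU. Qed.

(** Otherwise every value would be avoided on a large set, and a finite
    intersection of large sets would be empty. *)
Lemma ultra_fin (T : Type) (U : set_system T) {UU : UltraFilter U}
    (I : finType) (h : T -> I) : exists i, \forall k \near U, h k = i.
Proof.
apply: contrapT => H.
have : \forall k \near U, forall i, h k <> i.
  by apply: filter_forall => i; apply: ultra_contra => Hi; apply: H; exists i.
by move=> /filter_ex[k /(_ (h k))]; apply.
Qed.

Lemma ultra_fmap (T S : Type) (u : T -> S) (U : set_system T)
    {UU : UltraFilter U} : UltraFilter (u @ U).
Proof.
split=> [|G GF UG]; first exact: fmap_proper_filter.
apply/seteqP; split=> // A GA.
have [//|nA] := in_ultra_setVsetC (u @^-1` A) UU.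
have /(filterI GA) : G (~` A) by apply: UG.
by rewrite setICr => /filter_not_empty.
Qed.

Lemma ultra_bounded_cvg (T : Type) (U : set_system T) {UU : UltraFilter U}
    (R : realType) (u : T -> R) (M : R) :
  (\forall k \near U, `|u k| <= M) -> exists x : R, u @ U --> x.
Proof.
move=> H; have FU := @ultra_fmap _ _ u U UU.
have : compact `[- M, M]%classic by exact: segment_compact.
rewrite compact_ultra => /(_ (u @ U) FU).
case; last by move=> x [_ ux]; exists x.
by apply: filterS H => k; rewrite /= in_itv /= ler_norml.
Qed.

Lemma ultra_bounded_mx_cvg (T : Type) (U : set_system T) {UU : UltraFilter U}
    (R : realType) (m n : nat) (u : T -> 'M[R]_(m, n)) (M : R) :
  (\forall k \near U, `|u k| <= M) -> exists x : 'M[R]_(m, n), u @ U --> x.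
Proof.
move=> H.
have : forall ij : 'I_m * 'I_n, exists x : R, u k ij.1 ij.2 @[k --> U] --> x.
  move=> ij; apply: (@ultra_bounded_cvg _ _ _ _ _ M).
  by apply: filterS H => k; apply: le_trans; exact: coord_le_norm.
move=> /choice[f Hf]; exists (\matrix_(i, j) f (i, j)).
by apply/cvg_mxP => i j; rewrite mxE; exact: (Hf (i, j)).
Qed.

Lemma ultra_bounded_pair_cvg (T : Type) (U : set_system T) {UU : UltraFilter U}
    (R : realType) (l n : nat) (u : T -> 'cV[R]_l * 'cV[R]_n) (M : R) :
  (\forall k \near U, `|u k| <= M) -> exists x : 'cV[R]_l * 'cV[R]_n, u @ U --> x.
Proof.
move=> H.
have [x ux] : exists x : 'cV[R]_l, (u k).1 @[k --> U] --> x.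
  apply: (@ultra_bounded_mx_cvg _ U _ _ _ _ _ M); apply: filterS H => k.
  by apply: le_trans; rewrite [leRHS]prod_normE le_max lexx.
have [y uy] : exists y : 'cV[R]_n, (u k).2 @[k --> U] --> y.
  apply: (@ultra_bounded_mx_cvg _ U _ _ _ _ _ M); apply: filterS H => k.
  by apply: le_trans; rewrite [leRHS]prod_normE le_max lexx orbT.
exists (x, y); pose proof (cvg_npair ux uy) as H2.
by apply: cvg_trans H2; rewrite (_ : (fun k => _) = u) //; apply/funext => k; case: (u k).
Qed.

(** * Nearest points and finitely generated cones *)

Lemma ultra_closed_mx (R : realType) (m n : nat) (A : set 'M[R]_(m, n)) :
  (forall U : set_system 'M[R]_(m, n), UltraFilter U ->
     (\forall x \near U, A x) -> forall l, U --> l -> A l) -> closed A.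
Proof.
move=> H.
rewrite /closed closureEcvg => l [G GP [Gl AG]].
have [U [UU GU]] := ultraFilterLemma GP.
apply: (H U UU); last by apply: cvg_trans Gl.
by apply: GU; apply: AG.
Qed.

Lemma mx_compact (R : realType) (m n : nat) (A : set 'M[R]_(m, n)) (M : R) :
  closed A -> (forall x, A x -> `|x| <= M) -> compact A.
Proof.
move=> cA bA; rewrite compact_ultra => U UU UA.
have [x Ux] : exists x : 'M[R]_(m, n), id @ U --> x.
  by apply: (@ultra_bounded_mx_cvg _ _ _ _ _ _ _ M); apply: filterS UA.
exists x; split=> //.
exact: (@closed_cvg _ _ U _ id A cA UA x Ux).
Qed.

Lemma enorm_continuous (R : realType) (n : nat) :
  continuous (@enorm R n).
Proof. by move=> x; exact: (@cvg_enorm _ (nbhs x) _ R n id x cvg_id). Qed.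

Lemma closed_sublevel (R : realType) (X : topologicalType) (f : X -> R) (r : R) :
  continuous f -> closed [set x | f x <= r].
Proof.
by move=> /continuous_closedP/(_ [set y | y <= r]); apply; exact: closed_le.
Qed.

Lemma nearest_point (R : realType) (n : nat) (A : set 'cV[R]_n) (z : 'cV[R]_n) :
  closed A -> A !=set0 ->
  exists2 c, A c & forall c', A c' -> enorm (z - c) <= enorm (z - c').
Proof.
move=> cA [c0 Ac0].
pose r := enorm (z - c0).
have cc : continuous (fun y : 'cV[R]_n => enorm (z - y)).
  by move=> x; apply: (@cvg_enorm _ (nbhs x) _ R n (fun y => z - y)); apply: cvgB; [exact: cvg_cst | exact: cvg_id].
pose A' := A `&` [set x | enorm (z - x) <= r].
have cA' : closed A'.
  apply: closedI => //.
  exact: closed_sublevel.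
have bA' x : A' x -> `|x| <= r + `|z|.
  move=> [_ /= Hx]; rewrite -[x](addrNK z) (le_trans (ler_normD _ _)) //.
  by rewrite lerD2r distrC (le_trans (norm_le_enorm _)).
have A'0 : A' !=set0 by exists c0; split=> /=.
have cw : {within A', continuous (fun x : 'cV[R]_n => enorm (z - x))}.
  exact: continuous_subspaceT.
have [c + Hc] := compact_EVT_min A'0 (mx_compact cA' bA') cw.
rewrite inE => -[Ac Hcr]; exists c => // c' Ac'.
have [le_r|lt_r] := leP (enorm (z - c')) r; first by apply: Hc; rewrite inE; split.
by rewrite (le_trans Hcr) // ltW.
Qed.

(** The variational inequality at a nearest point c, for one feasible
    direction d. *)
Lemma nearest_point_dot_le0 (R : realType) (n : nat) (A : set 'cV[R]_n)
    (z c d : 'cV[R]_n) :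
  (forall t, 0 < t -> t <= 1 -> enorm (z - c) <= enorm (z - (c + t *: d))) ->
  dot (z - c) d <= 0.
Proof.
move=> H; rewrite leNgt; apply/negP => d0.
have dd : 0 < dot d d.
  rewrite lt_def dot_ge0 andbT; apply: contraTneq d0 => /dot_eq0 ->.
  by rewrite dot0r ltxx.
(* Minimiser over [0, 1] of t |-> |z - c - t d|^2. *)
pose t := Num.min 1 (dot (z - c) d / dot d d).
have t0 : 0 < t by rewrite lt_min ltr01 divr_gt0.
have t1 : t <= 1 by rewrite ge_min lexx.
have := H t t0 t1.
rewrite -(@ler_pXn2r _ 2) ?nnegrE ?enorm_ge0 // !sqr_enorm opprD addrA.
rewrite (dotBl (z - c)) !(dotBr _ (z - c)) !dotZl !dotZr (dotC d).
have : t * dot d d <= dot (z - c) d by rewrite -ler_pdivlMr // ge_min lexx orbT.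
set x := dot (z - c) d in d0 *; set y := dot d d in dd *; set w := dot _ _.
by move=> H1 H2; nra.
Qed.

Definition fgcone (R : realType) (n : nat) (T : finType) (I : {set T})
    (a : T -> 'cV[R]_n) : set 'cV[R]_n :=
  [set v | exists al : T -> R,
     (forall i, 0 <= al i) /\ v = \sum_(i in I) al i *: a i].

Lemma fgcone_sub (R : realType) (n : nat) (T : finType) (I J : {set T})
    (a : T -> 'cV[R]_n) : I \subset J -> fgcone I a `<=` fgcone J a.
Proof.
move=> IJ _ [al [al0 ->]]; exists (fun i => if i \in I then al i else 0).
split=> [i|]; first by case: ifP.
rewrite [RHS](big_setID I) /= (finset.setIidPr IJ) [X in _ = _ + X]big1 ?addr0.
  by apply: eq_bigr => i ->.
by move=> i; rewrite inE => /andP[/negPf -> _]; rewrite scale0r.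
Qed.

Lemma fgcone_conv (R : realType) (n : nat) (T : finType) (I : {set T})
    (a : T -> 'cV[R]_n) (v w : 'cV[R]_n) (s t : R) :
  0 <= s -> 0 <= t -> fgcone I a v -> fgcone I a w -> fgcone I a (s *: v + t *: w).
Proof.
move=> s0 t0 [al [al0 ->]] [be [be0 ->]].
exists (fun i => s * al i + t * be i); split=> [i|].
  by rewrite addr_ge0 ?mulr_ge0.
rewrite !scaler_sumr -big_split /=; apply: eq_bigr => i _.
by rewrite scalerDl !scalerA.
Qed.

Lemma fgcone0 (R : realType) (n : nat) (T : finType) (I : {set T})
    (a : T -> 'cV[R]_n) : fgcone I a 0.
Proof.
by exists (fun=> 0); split=> //; rewrite big1 // => i _; rewrite scale0r.
Qed.

Lemma fgcone_gen (R : realType) (n : nat) (T : finType) (I : {set T})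
    (a : T -> 'cV[R]_n) (i : T) : i \in I -> fgcone I a (a i).
Proof.
move=> iI; exists (fun j => (j == i)%:R); split=> [j|]; first by rewrite ler0n.
rewrite (bigD1 i) //= eqxx scale1r big1 ?addr0 // => j /andP[_ /negPf ->].
by rewrite scale0r.
Qed.

(** A limit of nonnegative combinations of fixed vectors is again such a
    combination, although the coefficients may be unbounded. If their sum s_k
    diverges, the normalised coefficients tend to a nonzero nonnegative linear
    relation be between the generators; subtracting from the k-th combination the
    largest admissible multiple of be removes one generator, and induction on the
    number of generators concludes. *)
Lemma fgcone_ultra (R : realType) (n : nat) (T : finType) (S : Type)
    (U : set_system S) {UU : UltraFilter U} (I : {set T}) (a : T -> 'cV[R]_n)
    (u : S -> 'cV[R]_n) (v : 'cV[R]_n) :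
  (\forall k \near U, fgcone I a (u k)) -> u @ U --> v -> fgcone I a v.
Proof.
have [N] := ubnP #|I|; elim: N I => // N IH I IN Hu uv.
have : forall k, exists al : T -> R, fgcone I a (u k) ->
    (forall i, 0 <= al i) /\ u k = \sum_(i in I) al i *: a i.
  move=> k; have [[al H]|nH] := pselect (fgcone I a (u k)).
    by exists al.
  by exists (fun=> 0).
move=> /choice[al Hal].
have al0 : \forall k \near U, forall i, 0 <= al k i.
  by apply: filterS Hu => k /Hal[].
have uE : \forall k \near U, u k = \sum_(i in I) al k i *: a i.
  by apply: filterS Hu => k /Hal[].
pose s k := \sum_(i in I) al k i.
have [[M HM]|nM] := pselect (exists M, \forall k \near U, s k <= M).
  have : forall i, exists x : R, i \in I -> al k i @[k --> U] --> x.
    move=> i; have [iI|iI] := boolP (i \in I); last by exists 0.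
    have [|x Hx] := @ultra_bounded_cvg _ U _ _ (fun k => al k i) M.
      near=> k.
      have ai : forall j, 0 <= al k j by near: k.
      rewrite ger0_norm //.
      apply: (@le_trans _ _ (s k)); last by near: k.
      by rewrite /s (bigD1 i) //= lerDl sumr_ge0.
    by exists x.
  move=> /choice[be Hbe].
  exists (fun i => if i \in I then be i else 0); split=> [i|].
    case: ifP => // iI; apply: (cvgr_to_ge (Hbe i iI)).
    by apply: filterS al0 => k; apply.
  apply: (cvg_unique _ uv); first exact: norm_hausdorff.
  apply: cvg_trans (_ : (\sum_(i in I) al k i *: a i) @[k --> U] --> _).
    by apply: near_eq_cvg; apply: filterS uE => k ->.
  apply: cvg_big => [|i iI]; first exact: add_continuous.
  by rewrite iI; apply: cvgZl; exact: Hbe.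
have big M : \forall k \near U, M < s k.
  have : \forall k \near U, ~ (s k <= M) by apply: ultra_contra => H; apply: nM; exists M.
  by apply: filterS => k /negP; rewrite -ltNge.
have : forall i, exists x : R, i \in I -> al k i / s k @[k --> U] --> x.
  move=> i; have [iI|iI] := boolP (i \in I); last by exists 0.
  have [|x Hx] := @ultra_bounded_cvg _ U _ _ (fun k => al k i / s k) 1.
    near=> k.
    have sk : 0 < s k by near: k; exact: big.
    have ai : forall j, 0 <= al k j by near: k.
    rewrite ger0_norm; last by rewrite divr_ge0 // ltW.
    rewrite ler_pdivrMr // mul1r.
    by rewrite /s (bigD1 i) //= lerDl sumr_ge0.
  by exists x.
move=> /choice[be Hbe].
have be0 i : i \in I -> 0 <= be i.
  move=> iI; apply: (cvgr_to_ge (Hbe i iI)); near=> k.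
  have sk : 0 < s k by near: k; exact: big.
  have ai : forall j, 0 <= al k j by near: k.
  by rewrite divr_ge0 // ltW.
have be1 : \sum_(i in I) be i = 1.
  apply: (@cvg_unique _ _ (\sum_(i in I) (al k i / s k) @[k --> U])).
  - exact: Rhausdorff.
  - by apply: cvg_big => [|i iI]; [exact: add_continuous | exact: Hbe].
  - apply: cvg_trans (_ : (fun=> 1 : R) @ U --> _); last exact: cvg_cst.
    apply: near_eq_cvg; near=> k; rewrite -mulr_suml divff //.
    by rewrite gt_eqF //; near: k; exact: big.
have bea : \sum_(i in I) be i *: a i = 0.
  apply: (@cvg_unique _ _ (\sum_(i in I) (al k i / s k) *: a i @[k --> U])).
  - exact: norm_hausdorff.
  - by apply: cvg_big => [|i iI]; [exact: add_continuous | apply: cvgZl; exact: Hbe].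
  - apply: cvg_trans (_ : (s k)^-1 *: u k @[k --> U] --> _).
      apply: near_eq_cvg; near=> k.
      have -> : u k = \sum_(i in I) al k i *: a i by near: k.
      rewrite scaler_sumr; apply: eq_bigr => i _.
      by rewrite scalerA mulrC.
    rewrite -(scale0r v); apply: cvgZ => //.
    apply/cvgr0Pnorm_lt => e e0; near=> k.
    have sk : e^-1 < s k by near: k; exact: big.
    have ei : 0 < e^-1 by rewrite invr_gt0.
    have sk0 : 0 < s k by exact: lt_trans sk.
    by rewrite gtr0_norm ?invr_gt0 // invf_plt ?posrE.
have [i0 /andP[i0I bi0]] : exists i, (i \in I) && (0 < be i).
  apply: contrapT => H; have : \sum_(i in I) be i <= 0.
    apply: sumr_le0 => i iI; rewrite leNgt; apply/negP => bi; apply: H.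
    by exists i; rewrite iI.
  by rewrite be1 ler10.
(* The ratio test: j k is the generator whose coefficient vanishes first
   when a multiple of be is subtracted. *)
pose j k := [arg min_(i < i0 | (i \in I) && (0 < be i)) (al k i / be i)]%O.
have [j0 Hj0] := @ultra_fin _ U _ _ j.
have j0P : (j0 \in I) && (0 < be j0).
  have [k <-] := filter_ex Hj0.
  by rewrite /j; case: arg_minP => //; rewrite i0I.
apply: (@fgcone_sub _ _ _ (I :\ j0)); first exact: finset.subD1set.
apply: IH uv.
  by move: IN; rewrite (cardsD1 j0); move/andP: j0P => [-> _]; rewrite add1n ltnS.
near=> k.
have jk : j k = j0 by near: k.
have ai : forall i, 0 <= al k i by near: k.
have Ek : u k = \sum_(i in I) al k i *: a i by near: k.
move: jk; rewrite /j; case: arg_minP; first by rewrite i0I.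
move=> j1 /andP[j1I bj1] jmin ej; subst j1.
pose c := al k j0 / be j0.
exists (fun i => if i \in I then al k i - c * be i else 0); split=> [i|].
  case: ifP => // iI; rewrite subr_ge0.
  have := be0 i iI; rewrite le_eqVlt => /orP[/eqP <-|bi]; first by rewrite mulr0.
  by rewrite -ler_pdivlMr // jmin // iI.
have -> : u k = \sum_(i in I) (al k i - c * be i) *: a i.
  under eq_bigr do rewrite scalerBl -scalerA.
  by rewrite big_split /= sumrN -scaler_sumr bea scaler0 subr0.
rewrite (big_setD1 j0) //= divfK ?gt_eqF // subrr scale0r add0r.
by apply: eq_bigr => i; rewrite !inE => /andP[_ ->].
Unshelve. all: by end_near. Qed.

Lemma fgcone_closed (R : realType) (n : nat) (T : finType) (I : {set T})
    (a : T -> 'cV[R]_n) : closed (fgcone I a).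
Proof.
apply: ultra_closed_mx => U UU HU l Ul.
exact: (@fgcone_ultra _ _ _ _ U _ _ _ id l HU Ul).
Qed.

(** Moreau decomposition: z - c lies in the polar of C and is orthogonal to c. *)
Lemma cone_projection (R : realType) (n : nat) (C : set 'cV[R]_n)
    (z : 'cV[R]_n) :
  closed C -> C 0 ->
  (forall (s t : R) v w, 0 <= s -> 0 <= t -> C v -> C w -> C (s *: v + t *: w)) ->
  exists c, [/\ C c, forall v, C v -> dot (z - c) v <= 0 & dot (z - c) c = 0].
Proof.
move=> cC C0 CC.
have [|c Cc Hc] := @nearest_point _ _ C z cC; first by exists 0.
have Cv v : C v -> dot (z - c) v <= 0.
  move=> Hv; apply: (@nearest_point_dot_le0 _ _ C) => t t0 _; apply: Hc.
  by rewrite -[c]scale1r; apply: CC => //; exact: ltW.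
exists c; split=> //.
apply/eqP; rewrite eq_le Cv //= -oppr_le0 -dotNr.
apply: (@nearest_point_dot_le0 _ _ C) => t t0 t1; apply: Hc.
have -> : c + t *: - c = (1 - t) *: c + 0 *: c.
  by rewrite scale0r addr0 scalerBl scale1r scalerN.
by apply: CC => //; rewrite subr_ge0.
Qed.

Lemma fgcone_dot_le0 (R : realType) (n : nat) (T : finType) (I : {set T})
    (a : T -> 'cV[R]_n) (mu v : 'cV[R]_n) :
  fgcone I a mu -> (forall i, i \in I -> dot (a i) v <= 0) -> dot mu v <= 0.
Proof.
move=> [al [al0 ->]] H; rewrite dot_suml; apply: sumr_le0 => i iI.
by rewrite dotZl mulr_ge0_le0 // H.
Qed.

(** The residual v of the projection of mu on the cone satisfies the hypothesis,
    and dot mu v is its squared norm. *)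
Lemma farkas (R : realType) (n : nat) (T : finType) (I : {set T})
    (a : T -> 'cV[R]_n) (mu : 'cV[R]_n) :
  (forall v, (forall i, i \in I -> dot (a i) v <= 0) -> dot mu v <= 0) ->
  fgcone I a mu.
Proof.
move=> H.
have [|||c [Cc Hc c0]] := @cone_projection _ _ (fgcone I a) mu.
- exact: fgcone_closed.
- exact: fgcone0.
- by move=> s t v w s0 t0; exact: fgcone_conv.
have : dot mu (mu - c) <= 0.
  by apply: H => i iI; rewrite dotC; apply: Hc; exact: fgcone_gen.
rewrite -{1}(subrK c mu) dotDl (dotC c) c0 addr0 => H1.
have /dot_eq0/eqP : dot (mu - c) (mu - c) = 0.
  by apply/eqP; rewrite eq_le H1 dot_ge0.
by rewrite subr_eq0 => /eqP ->.
Qed.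

(** A linear subspace is the cone generated by the vectors and their
    opposites. *)
Lemma farkas_span (R : realType) (n : nat) (T : finType) (I : {set T})
    (a : T -> 'cV[R]_n) (mu : 'cV[R]_n) :
  (forall v, (forall i, i \in I -> dot (a i) v = 0) -> dot mu v <= 0) ->
  exists c : T -> R, mu = \sum_(i in I) c i *: a i.
Proof.
move=> H.
pose b (ie : T * bool) := (-1) ^+ ie.2 *: a ie.1.
have [al [_ ->]] : fgcone (finset.setX I [set: bool]%SET) b mu.
  apply: farkas => v Hv; apply: H => i iI; apply/eqP; rewrite eq_le.
  have := Hv (i, false); rewrite /b /= scale1r !inE iI => -> //=.
  have := Hv (i, true); rewrite /b /= expr1 scaleN1r dotNl oppr_le0 !inE iI.
  exact.
exists (fun i => al (i, false) - al (i, true)).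
transitivity (\sum_(i in I) \sum_(e : bool) al (i, e) *: b (i, e)).
  by rewrite pair_big /=; apply: eq_big => [[i e]|[i e] _] //=; rewrite !inE.
apply: eq_bigr => i _; rewrite big_bool /= /b /= expr1 scale1r scaleN1r.
by rewrite scalerN scalerBl addrC.
Qed.

(** * Polyhedra, their tangent cones and their normal cones *)

Definition polyhedron (R : realType) (s m : nat) (a : 'I_m -> 'cV[R]_s)
    (c : 'I_m -> R) : set 'cV[R]_s := [set y | forall i, dot (a i) y <= c i].

Definition active (R : realType) (s m : nat) (a : 'I_m -> 'cV[R]_s)
    (c : 'I_m -> R) (y : 'cV[R]_s) : {set 'I_m} :=
  [set i | dot (a i) y == c i]%SET.

Lemma finite_pos_lb (R : realType) (I : finType) (h : I -> R) :
  (forall i, 0 < h i) -> exists2 e, 0 < e & forall i, e <= h i.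
Proof.
move=> h0; exists (\big[Num.min/1]_i h i).
  by rewrite lt_bigmin //.
by move=> i; exact: bigmin_le_cond.
Qed.

(** Inactive constraints have some slack, so a tangent direction can be followed
    for a positive time. This is what makes all tangent constructions below exact
    and not only asymptotic. *)
Lemma polyhedron_step (R : realType) (s m : nat) (a : 'I_m -> 'cV[R]_s)
    (c : 'I_m -> R) (y v : 'cV[R]_s) :
  polyhedron a c y -> (forall i, i \in active a c y -> dot (a i) v <= 0) ->
  exists2 t0, 0 < t0 & forall t, 0 <= t -> t <= t0 -> polyhedron a c (y + t *: v).
Proof.
move=> Dy Hv.
pose h i := if dot (a i) v <= 0 then 1 else (c i - dot (a i) y) / dot (a i) v.
have [i|e e0 He] := @finite_pos_lb _ _ h.
  rewrite /h; case: ifP => // /negbT; rewrite -ltNge => vi.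
  rewrite divr_gt0 // subr_gt0 lt_neqAle Dy andbT; apply/negP => Hi.
  by have := Hv i; rewrite inE Hi leNgt vi; move/(_ isT).
exists e => // t t0 te i; rewrite dotDr dotZr.
have := He i; rewrite /h; case: ifP => [vi _|/negbT].
  by have := Dy i; nra.
rewrite -ltNge => vi; rewrite ler_pdivlMr // => H.
by rewrite -lerBrDl (le_trans _ H) // ler_pM2r.
Qed.

Lemma polyhedron_closed (R : realType) (s m : nat) (a : 'I_m -> 'cV[R]_s)
    (c : 'I_m -> R) : closed (polyhedron a c).
Proof.
apply: ultra_closed_mx => U UU HU l Ul i.
have : dot (a i) x @[x --> U] --> dot (a i) l.
  by apply: cvg_dot; [exact: cvg_cst | exact: Ul].
by move=> /cvgr_to_le; apply; apply: filterS HU => x; exact.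
Qed.

Lemma harmonic_pos_cvg (R : realType) (t0 : R) :
  t0 / k.+1%:R @[k --> \oo] --> (0 : R).
Proof.
rewrite -(mulr0 t0); apply: cvgM; first exact: cvg_cst.
exact: cvg_harmonic.
Qed.

Lemma tangent_polyhedron (R : realType) (s m : nat) (a : 'I_m -> 'cV[R]_s)
    (c : 'I_m -> R) (y v : 'cV[R]_s) :
  polyhedron a c y ->
  tangent_cone (polyhedron a c) y v <->
  (forall i, i \in active a c y -> dot (a i) v <= 0).
Proof.
move=> Dy; split=> [[_ [u_ [t_ [uv _ t0 Hu]]]] i iI|Hv].
  have /cvgr_to_le : dot (a i) (u_ k) @[k --> \oo] --> dot (a i) v.
    by apply: cvg_dot; [exact: cvg_cst | exact: uv].
  apply; apply: nearW => k; have := Hu k i.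
  move: iI; rewrite inE => /eqP <-; rewrite dotDr dotZr gerDl.
  by rewrite pmulr_rle0.
have [t0 t00 Ht0] := polyhedron_step Dy Hv.
split=> //; exists (fun=> v), (fun k => t0 / k.+1%:R); split.
- exact: cvg_cst.
- exact: harmonic_pos_cvg.
- by move=> k; rewrite divr_gt0.
- move=> k; apply: Ht0; first by rewrite divr_ge0 // ltW.
  by rewrite ler_pdivrMr // ler_peMr ?ler1n // ltW.
Qed.

Lemma normal_polyhedronP (R : realType) (s m : nat) (a : 'I_m -> 'cV[R]_s)
    (c : 'I_m -> R) (y lam : 'cV[R]_s) :
  normal_cone (polyhedron a c) y lam <->
  polyhedron a c y /\ fgcone (active a c y) a lam.
Proof.
split=> -[Dy H]; split=> //.
  by apply: farkas => v Hv; apply: H; apply/tangent_polyhedron.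
by move=> v /(tangent_polyhedron _ Dy) Hv; exact: fgcone_dot_le0 H Hv.
Qed.

(** The description of the normal cone by the variational inequality shows that
    its graph is closed; this is not visible on the description by generators. *)
Lemma normal_polyhedron_varP (R : realType) (s m : nat) (a : 'I_m -> 'cV[R]_s)
    (c : 'I_m -> R) (y lam : 'cV[R]_s) :
  normal_cone (polyhedron a c) y lam <->
  polyhedron a c y /\ forall d, polyhedron a c d -> dot lam (d - y) <= 0.
Proof.
split=> -[Dy H]; split=> //.
  move=> d Dd; apply: H; apply/tangent_polyhedron => // i.
  by rewrite inE dotBr => /eqP ->; rewrite subr_le0.
move=> v /(tangent_polyhedron _ Dy) Hv.
have [t0 t00 Ht0] := polyhedron_step Dy Hv.
have := H _ (Ht0 t0 (ltW t00) (lexx _)).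
by rewrite addrC addKr dotZr pmulr_rle0.
Qed.

Lemma normal_polyhedron_cvg (T : Type) (F : set_system T) {FF : ProperFilter F}
    (R : realType) (s m : nat) (a : 'I_m -> 'cV[R]_s) (c : 'I_m -> R)
    (y_ lam_ : T -> 'cV[R]_s) (y lam : 'cV[R]_s) :
  (\forall k \near F, normal_cone (polyhedron a c) (y_ k) (lam_ k)) ->
  y_ @ F --> y -> lam_ @ F --> lam -> normal_cone (polyhedron a c) y lam.
Proof.
move=> H yy ll; apply/normal_polyhedron_varP; split.
  apply: (@closed_cvg _ _ F _ y_ (polyhedron a c) (@polyhedron_closed _ _ _ a c)) => //.
  by apply: filterS H => k [].
move=> d Dd; have /cvgr_to_le : dot (lam_ k) (d - y_ k) @[k --> F] --> dot lam (d - y).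
  by apply: cvg_dot => //; apply: cvgB => //; exact: cvg_cst.
by apply; apply: filterS H => k /normal_polyhedron_varP[_]; apply.
Qed.

(** Limits along an arbitrary proper filter also produce tangent vectors: the
    approximation at precision 1/(j+1) selects the j-th term of a sequence. *)
Lemma tangent_cone_filter (T : Type) (F : set_system T) {FF : ProperFilter F}
    (R : realType) (V : normedModType R) (Omega : set V) (z u : V)
    (x_ : T -> V) (t_ : T -> R) :
  Omega z -> (\forall k \near F, 0 < t_ k) -> t_ @ F --> (0 : R) ->
  (\forall k \near F, Omega (x_ k)) ->
  (t_ k)^-1 *: (x_ k - z) @[k --> F] --> u -> tangent_cone Omega z u.
Proof.
move=> Oz t0 tt Ox xu; split=> //.
have : forall j : nat, exists ut : V * R, [/\ 0 < ut.2, ut.2 < j.+1%:R^-1,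
    `|u - ut.1| < j.+1%:R^-1 & Omega (z + ut.2 *: ut.1)].
  move=> j; have j0 : 0 < j.+1%:R^-1 :> R by rewrite invr_gt0.
  have /filter_ex[k Hk] : \forall k \near F, [/\ 0 < t_ k, `|0 - t_ k| < j.+1%:R^-1,
      `|u - (t_ k)^-1 *: (x_ k - z)| < j.+1%:R^-1 & Omega (x_ k)].
    near=> k; split.
    - by near: k.
    - by near: k; move/cvgrPdist_lt : tt; apply.
    - by near: k; move/cvgrPdist_lt : xu; apply.
    - by near: k.
  case: Hk => tk0; rewrite sub0r normrN gtr0_norm // => tkj xk Oxk.
  exists ((t_ k)^-1 *: (x_ k - z), t_ k); split=> //=.
  by rewrite scalerA divff ?gt_eqF // scale1r addrC subrK.
move=> /choice[h Hh]; exists (fst \o h), (snd \o h); split.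
- apply/cvgrPdist_lt => e e0; near=> j; have [_ _ H _] := Hh j.
  apply: (lt_trans H); near: j; exact: (near_infty_natSinv_lt (PosNum e0)).
- apply/cvgrPdist_lt => e e0; near=> j; have [H0 H _ _] := Hh j.
  rewrite sub0r normrN gtr0_norm //.
  apply: (lt_trans H); near: j; exact: (near_infty_natSinv_lt (PosNum e0)).
- by move=> j; have [] := Hh j.
- by move=> j; have [] := Hh j.
Unshelve. all: by end_near. Qed.

(** * Differentials along sequences and continuously differentiable maps *)

Lemma differentiable_near (R : realType) (V W : normedModType R) (G : V -> W)
    (x : V) : differentiable G x -> forall e, 0 < e ->
  \forall h \near (0 : V), `|G (x + h) - G x - 'd G x h| <= e * `|h|.
Proof.
move=> dG e e0; have := diff_locallyxC dG.
set k := 'o _ => Hk.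
have := littleoP [littleo of k] e0; apply: filterS => h.
rewrite Hk (_ : G x + 'd G x h + k h - G x - 'd G x h = k h) //.
by rewrite -addrA -opprD addrC addKr.
Qed.

Lemma diff_seq (T : Type) (F : set_system T) {FF : ProperFilter F}
    (R : realType) (V W : normedModType R) (G : V -> W) (x d : V)
    (x_ : T -> V) (t_ : T -> R) :
  differentiable G x -> (\forall k \near F, 0 < t_ k) -> t_ @ F --> (0 : R) ->
  (t_ k)^-1 *: (x_ k - x) @[k --> F] --> d ->
  (t_ k)^-1 *: (G (x_ k) - G x) @[k --> F] --> 'd G x d.
Proof.
move=> dG t0 tt xd.
have dGd : 'd G x ((t_ k)^-1 *: (x_ k - x)) @[k --> F] --> 'd G x d.
  by apply: (@cvg_comp _ _ _ _ ('d G x) _ _ _ xd); exact: diff_continuous.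
have hx : x_ k - x @[k --> F] --> (0 : V).
  rewrite -(scale0r d); apply: cvg_trans (cvgZ tt xd).
  apply: near_eq_cvg; near=> k; rewrite scalerA divff ?scale1r // gt_eqF //.
  by near: k.
suff H : (t_ k)^-1 *: (G (x_ k) - G x) - 'd G x ((t_ k)^-1 *: (x_ k - x))
    @[k --> F] --> (0 : W).
  rewrite -[X in _ --> X]add0r; apply: cvg_trans (cvgD H dGd).
  by apply: near_eq_cvg; apply: nearW => k /=; rewrite subrK.
apply/cvgr0Pnorm_le => e e0.
have c0 : 0 < `|d| + 1 by rewrite ltr_wpDl.
have := differentiable_near dG (divr_gt0 e0 c0) => Hd.
have Hd' := hx _ Hd.
near=> k.
have tk0 : 0 < t_ k by near: k.
rewrite linearZ -scalerBr normrZ.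
have -> : `|(t_ k)^-1| = (t_ k)^-1 by rewrite gtr0_norm // invr_gt0.
rewrite ler_pdivrMl // mulrC.
have : `|G (x + (x_ k - x)) - G x - 'd G x (x_ k - x)| <= e / (`|d| + 1) * `|x_ k - x|.
  by near: k.
rewrite [x + _]addrC subrK => /le_trans; apply.
have : `|(t_ k)^-1 *: (x_ k - x)| <= `|d| + 1.
  near: k; have := cvgr_norm_le _ xd; apply; by rewrite ltrDl.
rewrite normrZ gtr0_norm ?invr_gt0 // ler_pdivrMl // => H.
rewrite -mulrA; apply: ler_wpM2l; first exact: ltW.
by rewrite ler_pdivrMl // mulrC.
Unshelve. all: by end_near. Qed.

Lemma directional_seq (T : Type) (F : set_system T) {FF : ProperFilter F}
    (R : realType) (V W : normedModType R) (G : V -> W) (x d : V) (t_ : T -> R) :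
  differentiable G x -> (\forall k \near F, 0 < t_ k) -> t_ @ F --> (0 : R) ->
  (t_ k)^-1 *: (G (x + t_ k *: d) - G x) @[k --> F] --> 'd G x d.
Proof.
move=> dG t0 tt; apply: diff_seq => //.
apply: cvg_trans (@cvg_cst _ d _ F _); apply: near_eq_cvg.
apply: filterS t0 => k tk.
by rewrite addrC addKr scalerA mulVf ?scale1r // gt_eqF.
Qed.

Lemma linear_diff (R : realType) (V W : normedModType R) (h : V -> W) :
  linear h -> continuous h ->
  forall x, differentiable h x /\ 'd h x = h :> (V -> W).
Proof.
move=> hl hc x.
pose hM := GRing.isLinear.Build _ _ _ _ _ hl.
pose hL : {linear V -> W} := HB.pack h hM.
rewrite -[h]/(hL : _ -> _); split; first exact: linear_differentiable.
exact: diff_lin.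
Qed.

Lemma C1_comp_linear (R : realType) (V W Z : normedModType R) (h : V -> W)
    (G : W -> Z) : linear h -> continuous h -> C1 G ->
  C1 (G \o h) /\ forall x v, 'd (G \o h) x v = 'd G (h x) (h v).
Proof.
move=> hl hc [Gd Gc].
have dE x v : 'd (G \o h) x v = 'd G (h x) (h v).
  have [dh hE] := linear_diff hl hc x.
  by rewrite diff_comp //= hE.
split=> //; split=> [x|v].
  by apply: differentiable_comp => //; exact: (linear_diff hl hc x).1.
rewrite (_ : (fun x => _) = (fun y => 'd G y (h v)) \o h).
  by move=> x; apply: continuous_comp; [exact: hc | exact: Gc].
by apply/funext => x /=.
Qed.

Lemma C1_linear_comp (R : realType) (V W Z : normedModType R) (h : W -> Z)
    (G : V -> W) : linear h -> continuous h -> C1 G ->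
  C1 (h \o G) /\ forall x v, 'd (h \o G) x v = h ('d G x v).
Proof.
move=> hl hc [Gd Gc].
have dE x v : 'd (h \o G) x v = h ('d G x v).
  have [dh hE] := linear_diff hl hc (G x).
  by rewrite diff_comp //= hE.
split=> //; split=> [x|v].
  by apply: differentiable_comp => //; exact: (linear_diff hl hc _).1.
rewrite (_ : (fun x => _) = h \o (fun y => 'd G y v)).
  by move=> x; apply: continuous_comp; [exact: Gc | exact: hc].
by apply/funext => x /=.
Qed.

Lemma C1D (R : realType) (V W : normedModType R) (G H : V -> W) :
  C1 G -> C1 H -> C1 (G \+ H) /\ forall x v, 'd (G \+ H) x v = 'd G x v + 'd H x v.
Proof.
move=> [Gd Gc] [Hd Hc].
have dE x v : 'd (G \+ H) x v = 'd G x v + 'd H x v.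
  by rewrite diffD.
split=> //; split=> [x|v]; first exact: differentiableD.
rewrite (_ : (fun x => _) = (fun x => 'd G x v) \+ (fun x => 'd H x v)).
  by move=> x; apply: cvgD; [exact: Gc | exact: Hc].
by apply/funext => x /=.
Qed.

Lemma C1_sum (R : realType) (V W : normedModType R) (n : nat)
    (G : 'I_n -> V -> W) : (forall j, C1 (G j)) ->
  C1 (fun x => \sum_j G j x).
Proof.
elim: n G => [|n IH] G HG.
  rewrite (_ : (fun x => _) = (fun=> 0)); last first.
    by apply/funext => x; rewrite big_ord0.
  split=> [x|v]; first exact: differentiable_cst.
  rewrite (_ : (fun x => _) = (fun=> 0)); first exact: cst_continuous.
  by apply/funext => x; rewrite diff_cst.
rewrite (_ : (fun x => _) = (fun x => \sum_(j < n) G (widen_ord (leqnSn n) j) x) \+ G ord_max).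
  by apply: (C1D _ _).1 => //; apply: IH.
by apply/funext => x; rewrite big_ord_recr.
Qed.

Lemma C1_continuous (R : realType) (V W : normedModType R) (G : V -> W) :
  C1 G -> continuous G.
Proof. by move=> [Gd _] x; apply: differentiable_continuous. Qed.

Lemma snd_section_diff (R : realType) (V W Z : normedModType R)
    (G : V * W -> Z) (x : V) (z : W) :
  differentiable G (x, z) ->
  differentiable (fun z' => G (x, z')) z /\
  forall v, 'd (fun z' => G (x, z')) z v = 'd G (x, z) (0, v).
Proof.
move=> dG.
have d1 : differentiable (fun z' : W => (x, z')) z.
  by apply: differentiable_pair.
split=> [|v].
  by apply: (@differentiable_comp _ _ _ _ (fun z' : W => (x, z')) G).
rewrite -[fun z' => _]/(G \o (fun z' : W => (x, z'))) diff_comp //=.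
rewrite (_ : 'd (fun z' : W => (x, z')) z v = (0, v)) //.
rewrite diff_pair //= diff_cst /=; congr pair.
by rewrite diff_val.
Qed.

Lemma Jac_mulmx (R : realType) (n m : nat) (F : 'cV[R]_n -> 'cV[R]_m)
    (x v : 'cV[R]_n) : differentiable F x -> Jac F x *m v = 'd F x v.
Proof.
move=> dF.
have {2}-> : v = \sum_j v j 0 *: delta_mx j 0.
  rewrite {1}(matrix_sum_delta v); apply: eq_bigr => j _.
  by rewrite big_ord1.
rewrite linear_sum; apply/colP => i; rewrite !mxE summxE; apply: eq_bigr => j _.
by rewrite linearZ !mxE mulrC.
Qed.

Lemma line_diff (R : realType) (V W : normedModType R) (F : V -> W) (e d : V)
    (t : R) : differentiable F (e + t *: d) ->
  is_derive t 1 (fun r : R => F (e + r *: d)) ('d F (e + t *: d) d).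
Proof.
move=> dF.
have dl : is_diff t (fun r : R => e + r *: d) (fun r => r *: d).
  have -> : (fun r : R => e + r *: d) = cst e + ( *:%R^~ d) by apply/funext.
  by apply: is_diff_eq; rewrite add0r.
have dFl : differentiable (fun r : R => F (e + r *: d)) t.
  apply: (@differentiable_comp _ _ _ _ (fun r : R => e + r *: d) F) => //.
apply: DeriveDef; first exact: diff_derivable.
rewrite deriveE // -[fun r => _]/(F \o (fun r : R => e + r *: d)) diff_comp //=.
by rewrite diff_val scale1r.
Qed.

Lemma coord_linear (R : realType) (m n : nat) (i : 'I_m) (j : 'I_n) :
  linear (fun M : 'M[R]_(m, n) => M i j : R^o).
Proof. by move=> c u v; rewrite !mxE. Qed.

Lemma diff_fst_bound (R : realType) (l n : nat) (W : normedModType R)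
    (F : 'cV[R]_l * 'cV[R]_n -> W) (e0 : 'cV[R]_l * 'cV[R]_n) :
  C1 F -> exists2 L, 0 <= L &
    \forall e \near e0, forall v, `|'d F e (v, 0)| <= L * `|v|.
Proof.
move=> [_ Fc].
(* Only directional derivatives are known to be continuous, whence the
   detour by the coordinate directions. *)
pose M j := `|'d F e0 (delta_mx j 0, 0)| + 1.
exists (\sum_j M j); first by apply: sumr_ge0 => j _; rewrite addr_ge0.
have : \forall e \near e0, forall j, `|'d F e (delta_mx j 0, 0)| <= M j.
  apply: (@filter_forall _ _ (fun j e => `|'d F e (delta_mx j 0, 0)| <= M j) (nbhs e0) (nbhs_filter e0)) => j.
  by apply: (cvgr_norm_le _ (Fc (delta_mx j 0, 0) e0)); rewrite ltrDl.
apply: filterS => e He v.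
have -> : (v, 0) = \sum_j v j 0 *: (delta_mx j 0, 0) :> 'cV[R]_l * 'cV[R]_n.
  rewrite {1}(matrix_sum_delta v).
  elim/big_rec2: _ => [//|j x y _ <-].
  by rewrite big_ord1; congr pair; rewrite /= scaler0 add0r.
rewrite linear_sum mulr_suml (le_trans (ler_norm_sum _ _ _)) //.
apply: ler_sum => j _; rewrite linearZ normrZ mulrC.
by apply: ler_pM => //; exact: coord_le_norm.
Qed.

(** The mean value theorem for each entry along the segment from p' to p. *)
Lemma C1_lipschitz_fst (R : realType) (l n m1 m2 : nat)
    (F : 'cV[R]_l * 'cV[R]_n -> 'M[R]_(m1, m2)) (e0 : 'cV[R]_l * 'cV[R]_n) :
  C1 F -> exists L r : R, [/\ 0 <= L, 0 < r & forall p p' x,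
    `|(p, x) - e0| < r -> `|(p', x) - e0| < r ->
    `|F (p, x) - F (p', x)| <= L * `|p - p'| ].
Proof.
move=> FC; have [L L0 /nbhs_ballP[r /= r0 Hr]] := diff_fst_bound e0 FC.
exists L, r; split=> // p p' x px p'x.
apply: norm_le_coord => [|i j]; first exact: mulr_ge0.
have ccont : continuous (fun M : 'M[R]_(m1, m2) => M i j : R^o).
  by move=> M; exact: coord_continuous.
have [[Gd _] Gdiff] := C1_linear_comp (@coord_linear R m1 m2 i j) ccont FC.
pose d : 'cV[R]_l * 'cV[R]_n := (p - p', 0).
pose phi (t : R) := F ((p', x) + t *: d) i j.
have dphi (t : R) : is_derive t 1 phi ('d F ((p', x) + t *: d) d i j).
  have H := @line_diff R _ _ _ (p', x) d t (Gd _).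
  by rewrite Gdiff in H.
have cphi : {within `[0, 1], continuous phi}.
  apply: derivable_within_continuous => t _.
  by have := dphi t; case.
have [c c01 Hc] := @MVT R phi _ 0 1 ltr01 (fun t _ => dphi t) cphi.
have p1 : phi 1 = F (p, x) i j.
  rewrite /phi scale1r; congr (F _ i j); congr pair => /=.
    by rewrite addrC subrK.
  by rewrite addr0.
have p0 : phi 0 = F (p', x) i j by rewrite /phi scale0r addr0.
rewrite !mxE -p1 -p0 Hc subr0 mulr1.
apply: (le_trans (coord_le_norm _ _ _)).
apply: Hr; rewrite -ball_normE /= distrC.
have -> : (p', x) + c *: d - e0 = c *: ((p, x) - e0) + (1 - c) *: ((p', x) - e0).
  rewrite [LHS]surjective_pairing [RHS]surjective_pairing; congr pair => /=.
    by apply/matrixP => a b; rewrite !mxE; ring.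
  by apply/matrixP => a b; rewrite !mxE; ring.
move: c01; rewrite in_itv /= => /andP[c0 c1].
apply: (le_lt_trans (ler_normD _ _)); rewrite !normrZ.
have -> : `|c| = c by rewrite gtr0_norm.
have -> : `|1 - c| = 1 - c by rewrite gtr0_norm // subr_gt0.
by nra.
Qed.

Lemma mulmx_continuousl (R : realType) (m n p : nat) (N : 'M[R]_(n, p)) :
  continuous (fun M : 'M[R]_(m, n) => M *m N).
Proof.
move=> M.
exact: (@cvg_mulmx _ (nbhs M) _ R m n p id (fun=> N) M N cvg_id (cvg_cst _)).
Qed.

Lemma mulmx_linearl (R : realType) (m n p : nat) (N : 'M[R]_(n, p)) :
  linear (fun M : 'M[R]_(m, n) => M *m N).
Proof. by move=> c u v; rewrite mulmxDl scalemxAl. Qed.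

Lemma trmx_mulmx_continuous (R : realType) (m n p : nat) (N : 'M[R]_(m, p)) :
  continuous (fun M : 'M[R]_(m, n) => M^T *m N).
Proof.
move=> M; apply: (@cvg_mulmx _ (nbhs M) _ R n m p _ (fun=> N)); last exact: cvg_cst.
exact: (@cvg_trmx _ (nbhs M) _ R m n id M cvg_id).
Qed.

Lemma trmx_mulmx_linear (R : realType) (m n p : nat) (N : 'M[R]_(m, p)) :
  linear (fun M : 'M[R]_(m, n) => M^T *m N).
Proof. by move=> c u v; rewrite linearD linearZ mulmxDl scalemxAl. Qed.

(** The map bmap g is the restriction of Jac3 g to the diagonal. The third
    argument is kept free since the tangent vectors of the graph of Psi come from
    points off the diagonal. *)
Definition Jac3 (R : realType) (l n s : nat)
    (g : 'cV[R]_l * 'cV[R]_n * 'cV[R]_n -> 'cV[R]_s)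
    (e : 'cV[R]_l * 'cV[R]_n * 'cV[R]_n) : 'M[R]_(s, n) :=
  Jac (fun z => g (e.1, z)) e.2.

Lemma Jac3_mulmx (R : realType) (l n s : nat)
    (g : 'cV[R]_l * 'cV[R]_n * 'cV[R]_n -> 'cV[R]_s) e v :
  C1 g -> Jac3 g e *m v = 'd g e (0, v).
Proof.
case: e => px z [gd _]; rewrite /Jac3 /=.
have [dgz dgzE] := @snd_section_diff _ _ _ _ g px z (gd _).
by rewrite Jac_mulmx.
Qed.

Lemma Jac3_C1 (R : realType) (l n s : nat)
    (g : 'cV[R]_l * 'cV[R]_n * 'cV[R]_n -> 'cV[R]_s) : C2 g -> C1 (Jac3 g).
Proof.
move=> [g1 g2].
have -> : Jac3 g = (fun e => \sum_j 'd g e (0, delta_mx j 0) *m (delta_mx 0 j : 'rV_n)).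
  apply/funext => e; apply/matrixP => i j.
  rewrite summxE (bigD1 j) //= big1 ?addr0.
    rewrite !mxE big_ord1 mxE !eqxx mulr1.
    case: e => px z /=.
    have [_ ->] := @snd_section_diff _ _ _ _ g px z (g1.1 _); first by [].
  move=> k kj; rewrite mxE big_ord1 mxE andbC eq_sym (negPf kj) mulr0 //.
apply: C1_sum => j.
have [H _] := C1_linear_comp (@mulmx_linearl R s 1 n (delta_mx 0 j))
  (@mulmx_continuousl R s 1 n (delta_mx 0 j)) (g2 (0, delta_mx j 0)).
exact: H.
Qed.

Lemma diag_linear (R : realType) (V W : normedModType R) :
  linear (fun px : V * W => (px, px.2)).
Proof. by []. Qed.

Lemma diag_continuous (R : realType) (V W : normedModType R) :
  continuous (fun px : V * W => (px, px.2)).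
Proof.
move=> [p x]; apply: (@cvg_pair _ _ _ (nbhs (p, x)) (nbhs (p, x)) (nbhs x) _ _ _ id snd).
  exact: cvg_id.
exact: cvg_snd.
Qed.

Lemma gtilde_C1 (R : realType) (l n s : nat)
    (g : 'cV[R]_l * 'cV[R]_n * 'cV[R]_n -> 'cV[R]_s) : C1 g ->
  C1 (gtilde g) /\ forall px d, 'd (gtilde g) px d = 'd g (px, px.2) (d, d.2).
Proof.
move=> g1; exact: (C1_comp_linear (@diag_linear _ _ _) (@diag_continuous _ _ _) g1).
Qed.

Lemma bmap_C1 (R : realType) (l n s : nat)
    (g : 'cV[R]_l * 'cV[R]_n * 'cV[R]_n -> 'cV[R]_s) : C2 g ->
  C1 (bmap g) /\ forall px d, 'd (bmap g) px d = 'd (Jac3 g) (px, px.2) (d, d.2).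
Proof.
move=> /Jac3_C1 b1; exact: (C1_comp_linear (@diag_linear _ _ _) (@diag_continuous _ _ _) b1).
Qed.

Lemma Lag_C1 (R : realType) (l n s : nat) (f : 'cV[R]_l * 'cV[R]_n -> 'cV[R]_n)
    (g : 'cV[R]_l * 'cV[R]_n * 'cV[R]_n -> 'cV[R]_s) (lam : 'cV[R]_s) :
  C1 f -> C2 g -> C1 (Lag f g lam) /\
  forall px d, 'd (Lag f g lam) px d = 'd f px d + ('d (bmap g) px d)^T *m lam.
Proof.
move=> f1 g2; have [b1 _] := bmap_C1 g2.
have [c1 cE] := C1_linear_comp (trmx_mulmx_linear lam) (@trmx_mulmx_continuous _ _ _ _ lam) b1.
have [L1 LE] := C1D f1 c1.
have -> : Lag f g lam = f \+ ((fun M => M^T *m lam) \o bmap g) by [].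
split; first exact: L1.
move=> px d; apply: (etrans (LE px d)); apply: f_equal; exact: (cE px d).
Qed.

Lemma Jac2_mulmx (R : realType) (l n m : nat)
    (F : 'cV[R]_l * 'cV[R]_n -> 'cV[R]_m) px (v : 'cV[R]_n) :
  C1 F -> Jac2 F px *m v = 'd F px (0, v).
Proof.
case: px => p x [Fd _]; rewrite /Jac2 /=.
have [dF dFE] := @snd_section_diff _ _ _ _ F p x (Fd _).
by rewrite Jac_mulmx.
Qed.

(** * Multipliers under metric subregularity *)

(** The partial Jacobian maps tangent vectors of the feasible set to tangent vectors
    of D. *)
Lemma Psi_of_multiplier (R : realType) (l n s : nat)
    (g : 'cV[R]_l * 'cV[R]_n * 'cV[R]_n -> 'cV[R]_s) (D : set 'cV[R]_s) e lam :
  C1 g -> normal_cone D (g e) lam -> Psi g D e ((Jac3 g e)^T *m lam).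
Proof.
case: e => px z g1 [Dg Nl]; split=> //= u [_ [u_ [t_ [uu tt t0 Hu]]]].
rewrite -dot_mulmx; apply: Nl.
have [dgz dgzE] := @snd_section_diff _ _ _ _ g px z (g1.1 _).
rewrite Jac3_mulmx // -dgzE.
apply: (@tangent_cone_filter _ \oo _ _ _ _ _ _ (fun k => g (px, z + t_ k *: u_ k)) t_) => //.
- exact: nearW.
- exact: nearW.
- apply: (@diff_seq _ \oo _ _ _ _ (fun z' => g (px, z')) z u (fun k => z + t_ k *: u_ k)) => //.
  + exact: nearW.
  + apply: cvg_trans uu; apply: near_eq_cvg; apply: nearW => k.
    by rewrite addrC addKr scalerA mulVf ?scale1r // gt_eqF.
Qed.

Lemma edist_set_le (R : realType) (n : nat) (x d : 'cV[R]_n) (A : set 'cV[R]_n) :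
  A d -> (edist_set x A <= (enorm (x - d))%:E)%E.
Proof. by move=> Ad; apply: ereal_inf_lbound; exists d. Qed.

Lemma edist_set_lt (R : realType) (n : nat) (x : 'cV[R]_n) (A : set 'cV[R]_n)
    (r : R) : (edist_set x A < r%:E)%E -> exists2 y, A y & enorm (x - y) < r.
Proof.
by move=> /ereal_inf_lt[_ [y Ay <-]]; rewrite lte_fin; exists y.
Qed.

(** For the points z + t v, subregularity gives feasible points whose distance is
    at most kappa times the distance of g to y + t h in D. Dividing by t and
    passing to the limit gives a tangent vector u, close to v if the linearised
    image of v is close to h. *)
Lemma tangent_approx (R : realType) (l n s m : nat)
    (g : 'cV[R]_l * 'cV[R]_n * 'cV[R]_n -> 'cV[R]_s) (a : 'I_m -> 'cV[R]_s)
    (c : 'I_m -> R) (kappa : R) (px : 'cV[R]_l * 'cV[R]_n) (z : 'cV[R]_n) (v : 'cV[R]_n) (h : 'cV[R]_s) :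
  C1 g -> 0 <= kappa ->
  (\forall e \near (px, z), (edist_set e.2 (Gamma g (polyhedron a c) e.1)
      <= kappa%:E * edist_set (g e) (polyhedron a c))%E) ->
  polyhedron a c (g (px, z)) ->
  (forall i, i \in active a c (g (px, z)) -> dot (a i) h <= 0) ->
  exists2 u, tangent_cone (Gamma g (polyhedron a c) px) z u &
    enorm (v - u) <= kappa * enorm (Jac3 g (px, z) *m v - h).
Proof.
move=> g1 k0 Hk Dg Hh.
have [U [UU oU]] := ultraFilterLemma (F := \oo) _.
pose t_ (k : nat) : R := k.+1%:R^-1.
have t0 k : 0 < t_ k by rewrite invr_gt0.
have tt : t_ @ U --> (0 : R).
  by apply: cvg_trans (@cvg_harmonic R); apply: cvg_fmap2.
pose y := g (px, z).
have [dgz dgzE] := @snd_section_diff _ _ _ _ g px z (g1.1 _).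
have gv : (t_ k)^-1 *: (g (px, z + t_ k *: v) - y) @[k --> U] --> Jac3 g (px, z) *m v.
  rewrite Jac3_mulmx // -dgzE.
  apply: (@diff_seq _ U _ _ _ _ (fun z' => g (px, z')) z v (fun k => z + t_ k *: v)) => //.
    exact: nearW.
  apply: cvg_trans (@cvg_cst _ v _ U _); apply: near_eq_cvg; apply: nearW => k.
  by rewrite addrC addKr scalerA mulVf ?scale1r // gt_eqF.
have zv0 : z + t_ k *: v @[k --> U] --> z.
  rewrite -[X in _ --> X](addr0 z) -(scale0r v); apply: cvgD; first exact: cvg_cst.
  by apply: cvgZl.
have zv : (px, z + t_ k *: v) @[k --> U] --> (px, z).
  by apply: cvg_npair => //; exact: cvg_cst.
have Hk' : \forall k \near U,
    (edist_set (z + t_ k *: v)%R (Gamma g (polyhedron a c) px)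
      <= kappa%:E * edist_set (g (px, z + t_ k *: v)%R) (polyhedron a c))%E.
  exact: (zv _ Hk).
have [t1 t10 Ht1] := polyhedron_step Dg Hh.
have Hz : \forall k \near U, exists u, Gamma g (polyhedron a c) px (z + t_ k *: u) /\
    enorm (v - u) <= kappa * enorm ((t_ k)^-1 *: (g (px, z + t_ k *: v) - y) - h) + t_ k.
  near=> k.
  have H1 : (edist_set (z + t_ k *: v)%R (Gamma g (polyhedron a c) px)
      <= kappa%:E * edist_set (g (px, z + t_ k *: v)%R) (polyhedron a c))%E.
    by near: k.
  have tk1 : t_ k <= t1.
    by near: k; exact: (cvgr_le 0 tt t1 t10).
  have Dh : polyhedron a c (y + t_ k *: h) by apply: Ht1 => //; exact: ltW.
  pose r := kappa * enorm (g (px, z + t_ k *: v) - (y + t_ k *: h)).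
  have H2 : (edist_set (z + t_ k *: v)%R (Gamma g (polyhedron a c) px) <= r%:E)%E.
    apply: (le_trans H1); rewrite EFinM; apply: lee_wpmul2l.
      by rewrite lee_fin.
    exact: edist_set_le.
  have [|zk Gzk Hzk] := @edist_set_lt _ _ (z + t_ k *: v) (Gamma g (polyhedron a c) px) (r + t_ k * t_ k).
    by apply: (le_lt_trans H2); rewrite lte_fin ltrDl mulr_gt0.
  exists ((t_ k)^-1 *: (zk - z)); rewrite scalerA divff ?gt_eqF // scale1r.
  rewrite [z + _]addrC subrK; split=> //.
  have -> : v - (t_ k)^-1 *: (zk - z) = (t_ k)^-1 *: (z + t_ k *: v - zk).
    by apply/matrixP => i j; rewrite !mxE; field; rewrite gt_eqF // t0.
  have -> : (t_ k)^-1 *: (g (px, z + t_ k *: v) - y) - h =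
      (t_ k)^-1 *: (g (px, z + t_ k *: v) - (y + t_ k *: h)).
    by apply/matrixP => i j; rewrite !mxE; field; rewrite gt_eqF // t0.
  rewrite !enormZ gtr0_norm ?invr_gt0 // ler_pdivrMl // mulrDr.
  by rewrite mulrCA mulVKf ?gt_eqF // ltW.
have [u_ Hu] := near_choice 0 Hz.
have Gu : \forall k \near U, Gamma g (polyhedron a c) px (z + t_ k *: u_ k).
  by apply: filterS Hu => k [].
have Eu : \forall k \near U, enorm (v - u_ k) <=
    kappa * enorm ((t_ k)^-1 *: (g (px, z + t_ k *: v) - y) - h) + t_ k.
  by apply: filterS Hu => k [].
pose L := kappa * enorm (Jac3 g (px, z) *m v - h).
have cL : kappa * enorm ((t_ k)^-1 *: (g (px, z + t_ k *: v) - y) - h) + t_ k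
    @[k --> U] --> L.
  rewrite -[L]addr0; apply: cvgD => //; apply: cvgM; first exact: cvg_cst.
  by apply: cvg_enorm; apply: cvgB => //; exact: cvg_cst.
have [|u uu] := @ultra_bounded_mx_cvg _ U _ _ _ _ u_ (L + 1 + `|v|).
  near=> k.
  rewrite -[u_ k](addrNK v) (le_trans (ler_normD _ _)) // lerD2r distrC.
  apply: (le_trans (norm_le_enorm _)).
  apply: (@le_trans _ _ (kappa * enorm ((t_ k)^-1 *: (g (px, z + t_ k *: v) - y) - h) + t_ k)).
    by near: k.
  by near: k; apply: (cvgr_le _ cL); rewrite ltrDl.
exists u.
  apply: (@tangent_cone_filter _ U _ _ _ _ z u (fun k => z + t_ k *: u_ k) t_) => //.
    exact: nearW.
  apply: cvg_trans uu; apply: near_eq_cvg; apply: nearW => k.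
  by rewrite addrC addKr scalerA mulVf ?scale1r // gt_eqF.
have cE : enorm (v - u_ k) @[k --> U] --> enorm (v - u).
  by apply: cvg_enorm; apply: cvgB => //; exact: cvg_cst.
by apply: (ler_cvg_to cE cL).
Unshelve. all: by end_near. Qed.

Lemma polar_halfspaces_projection (R : realType) (s m : nat) (I : {set 'I_m})
    (a : 'I_m -> 'cV[R]_s) (x : 'cV[R]_s) :
  exists h, [/\ forall i, i \in I -> dot (a i) h <= 0, fgcone I a (x - h) &
    dot (x - h) h = 0].
Proof.
pose C : set 'cV[R]_s := [set h | forall i, i \in I -> dot (a i) h <= 0].
have [|||h [Ch Hh h0]] := @cone_projection _ _ C x.
- apply: ultra_closed_mx => U UU HU l Ul i iI.
  have : dot (a i) y @[y --> U] --> dot (a i) l.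
    by apply: cvg_dot; [exact: cvg_cst | exact: Ul].
  by move=> /cvgr_to_le; apply; apply: filterS HU => y; exact.
- by move=> i _; rewrite dot0r.
- move=> p q v w p0 q0 Hv Hw i iI; rewrite dotDr !dotZr.
  by rewrite -oppr_ge0 opprD -!mulrN addr_ge0 // mulr_ge0 // oppr_ge0 ?Hv ?Hw.
exists h; split=> //.
by apply: farkas => v Hv; exact: Hh.
Qed.

(** Consider the point of the compact convex set of all b^T lam, with lam normal and of
    norm at most M = kappa |zs|, that is nearest to zs, and let v be the
    difference. The largest value of dot v (b^T lam) on that set is M
    times the distance of b v to the tangent cone of D, while tangent_approx bounds
    dot zs v by the same number. The variational inequality then forces v = 0. *)
Lemma multiplier_exists (R : realType) (l n s m : nat)
    (g : 'cV[R]_l * 'cV[R]_n * 'cV[R]_n -> 'cV[R]_s) (a : 'I_m -> 'cV[R]_s)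
    (c : 'I_m -> R) (kappa : R) (e : 'cV[R]_l * 'cV[R]_n * 'cV[R]_n)
    (zs : 'cV[R]_n) :
  C1 g -> 0 <= kappa ->
  (\forall e' \near e, (edist_set e'.2 (Gamma g (polyhedron a c) e'.1)
      <= kappa%:E * edist_set (g e') (polyhedron a c))%E) ->
  Psi g (polyhedron a c) e zs ->
  exists lam, [/\ normal_cone (polyhedron a c) (g e) lam,
    (Jac3 g e)^T *m lam = zs & enorm lam <= kappa * enorm zs].
Proof.
case: e => px z g1 k0 Hk [/= Dg Hzs].
pose I := active a c (g (px, z)).
pose M := kappa * enorm zs.
have M0 : 0 <= M by rewrite mulr_ge0 // enorm_ge0.
pose B := Jac3 g (px, z).
pose Lam := fgcone I a `&` [set lam | enorm lam <= M].
have cLam : compact Lam.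
  apply: (@mx_compact _ _ _ _ M) => [|lam [_ /= H]]; last first.
    exact: le_trans (norm_le_enorm _) H.
  apply: closedI; first exact: fgcone_closed.
  apply: closed_sublevel; exact: enorm_continuous.
have Lam0 : Lam !=set0 by exists 0; split; [exact: fgcone0 | rewrite /= enorm0].
have cF : {within Lam, continuous (fun lam : 'cV[R]_s => enorm (zs - B^T *m lam))}.
  apply: continuous_subspaceT => lam.
  apply: (@cvg_enorm _ (nbhs lam) _ R n (fun lam => zs - B^T *m lam)).
  apply: cvgB; first exact: cvg_cst.
  exact: (@cvg_mulmx _ (nbhs lam) _ R n s 1 (fun=> B^T) id B^T lam (cvg_cst _) cvg_id).
have [lam + Hmin] := compact_EVT_min Lam0 cLam cF.
rewrite inE => -[Nlam /= lamM].
pose v := zs - B^T *m lam.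
have VI lam' : Lam lam' -> dot v (B^T *m (lam' - lam)) <= 0.
  move=> [Nl' /= l'M]; apply: (@nearest_point_dot_le0 _ _ setT) => t t0 t1.
  rewrite scalemxAr -mulmxDr; apply: Hmin; rewrite inE.
  have -> : lam + t *: (lam' - lam) = (1 - t) *: lam + t *: lam'.
    by apply/matrixP => i j; rewrite !mxE; ring.
  have t1' : 0 <= 1 - t by rewrite subr_ge0.
  split; first by apply: fgcone_conv => //; exact: ltW.
  apply: (le_trans (ler_enormD _ _)); rewrite !enormZ ger0_norm // gtr0_norm //.
  by nra.
have [h [Hh Nr rh]] := polar_halfspaces_projection I a (B *m v).
have [u Tu Hu] := tangent_approx v g1 k0 Hk Dg Hh.
set r := B *m v - h in Nr rh Hu.
have zsv : dot zs v <= M * enorm r.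
  rewrite -[v](subrK u) dotDr.
  have := Hzs u Tu; have := dot_le_enorm zs (v - u).
  have := enorm_ge0 zs.
  by rewrite /M; nra.
(* The maximiser of dot (b v) over normal vectors of norm at most M: the
   multiple of r = b v - h of norm M. *)
have [lam' Ll' Hl'] : exists2 lam', Lam lam' & M * enorm r = dot (B *m v) lam'.
  have [r0|r0] := pselect (r = 0).
    exists 0; first by split; [exact: fgcone0 | rewrite /= enorm0].
    by rewrite r0 enorm0 dot0r mulr0.
  have er := enorm_gt0 r0.
  exists ((M / enorm r) *: r).
    split.
      rewrite -[_ *: r]addr0 -(scale0r 0); apply: fgcone_conv => //.
        by rewrite divr_ge0 // ltW.
      exact: fgcone0.
    by rewrite /= enormZ ger0_norm ?divr_ge0 ?(ltW er) // divfK // gt_eqF.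
  rewrite dotZr -[B *m v](subrK h) -/r dotDl [dot h r]dotC rh addr0 -sqr_enorm.
  by rewrite expr2 mulrA divfK // gt_eqF.
have := VI _ Ll'; rewrite mulmxBr dotBr subr_le0.
rewrite [dot v (B^T *m lam')]dot_mulmx trmxK -Hl' => H1.
have H2 : dot v (B^T *m lam) = dot zs v - dot v v.
  have -> : B^T *m lam = zs - v by rewrite /v opprB addrC subrK.
  by rewrite dotBr [dot v zs]dotC.
have v0 : v = 0.
  apply: dot_eq0; apply/eqP; rewrite eq_le dot_ge0 andbT.
  move: H1; rewrite H2 => H1; lra.
exists lam; split=> //; first by apply/normal_polyhedronP.
by move/eqP: v0; rewrite subr_eq0 => /eqP <-.
Qed.

Lemma multiplier_near (R : realType) (l n s m : nat)
    (g : 'cV[R]_l * 'cV[R]_n * 'cV[R]_n -> 'cV[R]_s) (a : 'I_m -> 'cV[R]_s)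
    (c : 'I_m -> R) (kappa : R) (e : 'cV[R]_l * 'cV[R]_n * 'cV[R]_n) :
  C1 g -> 0 <= kappa ->
  (\forall e' \near e, (edist_set e'.2 (Gamma g (polyhedron a c) e'.1)
      <= kappa%:E * edist_set (g e') (polyhedron a c))%E) ->
  \forall e' \near e, forall zs, Psi g (polyhedron a c) e' zs ->
  exists lam, [/\ normal_cone (polyhedron a c) (g e') lam,
    (Jac3 g e')^T *m lam = zs & enorm lam <= kappa * enorm zs].
Proof.
move=> g1 k0 Hk; have := nbhs_interior Hk; apply: filterS => e' He' zs.
exact: (multiplier_exists g1 k0).
Qed.

(** * Faces of the critical cone *)

Lemma perpP (R : realType) (n : nat) (z v : 'cV[R]_n) :
  perp z v <-> dot z v = 0.
Proof.
split=> [H|zv w [k [c [b [Hb ->]]]]].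
  apply: H; exists 1%N, (fun=> 1), (fun=> z).
  by rewrite big_ord1 scale1r.
rewrite dot_suml big1 // => i _.
by rewrite dotZl Hb zv mulr0.
Qed.

(** A is meant to be the active set of the reference point and J a set of
    constraints kept active. The faces F1 and F2 are cone_face a A J and
    cone_face a A I, and their difference is again of this form. *)
Definition cone_face (R : realType) (s m : nat) (a : 'I_m -> 'cV[R]_s)
    (A J : {set 'I_m}) : set 'cV[R]_s :=
  [set v | (forall i, i \in A -> dot (a i) v <= 0) /\
           (forall j, j \in J -> dot (a j) v = 0)].

Lemma fgcone_dot_eq0 (R : realType) (n : nat) (T : finType) (J : {set T})
    (a : T -> 'cV[R]_n) (mu v : 'cV[R]_n) :
  fgcone J a mu -> (forall j, j \in J -> dot (a j) v = 0) -> dot mu v = 0.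
Proof.
move=> [al [_ ->]] H; rewrite dot_suml big1 // => j jJ.
by rewrite dotZl H // mulr0.
Qed.

Lemma critical_polyhedronP (R : realType) (s m : nat) (a : 'I_m -> 'cV[R]_s)
    (c : 'I_m -> R) (y lam v : 'cV[R]_s) : polyhedron a c y ->
  critical_cone (polyhedron a c) y lam v <->
  (forall i, i \in active a c y -> dot (a i) v <= 0) /\ dot lam v = 0.
Proof.
by move=> Dy; split=> -[/(tangent_polyhedron _ Dy) H /perpP].
Qed.

(** The sum of the generators indexed by J is a normal vector exposing this face.
    Constraints supporting lam belong to J, so the face is automatically
    orthogonal to lam. *)
Lemma cone_face_is_face (R : realType) (s m : nat) (a : 'I_m -> 'cV[R]_s)
    (c : 'I_m -> R) (y lam : 'cV[R]_s) (J' J : {set 'I_m}) :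
  polyhedron a c y -> fgcone J' a lam -> J' \subset J ->
  J \subset active a c y ->
  is_face (critical_cone (polyhedron a c) y lam) (cone_face a (active a c y) J).
Proof.
move=> Dy Hlam J'J JA.
exists (\sum_(j in J) a j).
  move=> v /(critical_polyhedronP _ _ Dy)[Hv _]; rewrite dot_suml.
  by apply: sumr_le0 => j jJ; apply: Hv; exact: (fintype.subsetP JA).
apply/seteqP; split=> v.
  move=> [Hv vJ]; split; last by apply/perpP; rewrite dot_suml big1.
  apply/critical_polyhedronP => //; split=> //.
  by apply: (fgcone_dot_eq0 Hlam) => j jJ; apply: vJ; exact: (fintype.subsetP J'J).
move=> [/(critical_polyhedronP _ _ Dy)[Hv _] /perpP Hs]; split=> // j jJ.
have JA' i : i \in J -> i \in active a c y by exact: (fintype.subsetP JA).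
move: Hs; rewrite dot_suml => /eqP; rewrite -oppr_eq0 -sumrN psumr_eq0.
  by move=> /allP/(_ j (mem_index_enum j)); rewrite jJ oppr_eq0 => /eqP.
by move=> i iJ; rewrite oppr_ge0 Hv // JA'.
Qed.

(** A large multiple of d makes the constraints in A but outside I inactive
    without changing those in I. *)
Lemma cone_face_diff (R : realType) (s m : nat) (a : 'I_m -> 'cV[R]_s)
    (A I J : {set 'I_m}) (d : 'cV[R]_s) :
  I \subset A -> J \subset I ->
  (forall i, i \in I -> dot (a i) d = 0) ->
  (forall i, i \in A -> i \notin I -> dot (a i) d < 0) ->
  minkowski_diff (cone_face a A J) (cone_face a A I) = cone_face a I J.
Proof.
move=> IA JI dI dA; apply/seteqP; split=> v.
  move=> [v1 [H1 J1]] [v2 [H2 I2]] <-; split=> [i iI|j jJ]; rewrite dotBr.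
    by rewrite I2 // subr0 H1 // (fintype.subsetP IA).
  by rewrite I2 ?J1 ?subr0 // (fintype.subsetP JI).
move=> [Hv vJ].
have dF r : 0 <= r -> cone_face a A I (r *: d).
  move=> r0; split=> [i iA|i iI]; rewrite dotZr; last by rewrite dI ?mulr0.
  have [iI|iI] := boolP (i \in I); first by rewrite dI ?mulr0.
  by have := dA i iA iI; nra.
pose h i := if (i \in A) && (i \notin I) then
  (if dot (a i) v <= 0 then 1 else - dot (a i) d / dot (a i) v) else 1.
have [i|e e0 He] := @finite_pos_lb _ _ h.
  rewrite /h; case: ifP => // /andP[iA iI]; case: ifP => // /negbT.
  by rewrite -ltNge => vi; rewrite divr_gt0 // oppr_gt0 dA.
exists (v + e^-1 *: d); last first.
  exists (e^-1 *: d); last by rewrite addrK.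
  by apply: dF; rewrite invr_ge0 ltW.
split=> [i iA|j jJ]; last first.
  by rewrite dotDr dotZr vJ // dI ?mulr0 ?addr0 // (fintype.subsetP JI).
rewrite dotDr dotZr.
have [iI|iI] := boolP (i \in I); first by rewrite dI // mulr0 addr0 Hv.
have di := dA i iA iI; have := He i; rewrite /h iA iI /=.
have ei : 0 < e^-1 by rewrite invr_gt0.
case: ifP => [vi _|/negbT]; first by nra.
rewrite -ltNge => vi; rewrite ler_pdivlMr // => H.
have : dot (a i) v <= e^-1 * - dot (a i) d by rewrite ler_pdivlMl.
by rewrite mulrN; lra.
Qed.

(** * Approximate solutions converging in a direction *)

(** The pairs (y_, lam_) lie exactly on the graph of the normal cone map; the
    two equations of the system hold up to o(t_). *)
Record kkt_seq (T : Type) (F : set_system T) (R : realType) (l n s m : nat)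
    (f : 'cV[R]_l * 'cV[R]_n -> 'cV[R]_n)
    (g : 'cV[R]_l * 'cV[R]_n * 'cV[R]_n -> 'cV[R]_s)
    (a : 'I_m -> 'cV[R]_s) (c : 'I_m -> R) (px d : 'cV[R]_l * 'cV[R]_n)
    (t_ : T -> R) (px_ : T -> 'cV[R]_l * 'cV[R]_n) (y_ lam_ : T -> 'cV[R]_s)
    : Prop := KktSeq {
  kkt_pos : \forall k \near F, 0 < t_ k;
  kkt_time : t_ @ F --> (0 : R);
  kkt_dir : (t_ k)^-1 *: (px_ k - px) @[k --> F] --> d;
  kkt_normal : \forall k \near F, normal_cone (polyhedron a c) (y_ k) (lam_ k);
  kkt_bounded : exists M : R, \forall k \near F, `|lam_ k| <= M;
  kkt_stationary :
    (t_ k)^-1 *: (f (px_ k) + (bmap g (px_ k))^T *m lam_ k) @[k --> F] --> (0 : 'cV[R]_n);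
  kkt_feasible :
    (t_ k)^-1 *: (gtilde g (px_ k) - y_ k) @[k --> F] --> (0 : 'cV[R]_s) }.

(** The data to which the assumption on the direction d applies. I is the
    common active set of the points y_ and J the common support of the
    multipliers lam_ as combinations of the a i. *)
Record kkt_limit (T : Type) (U : set_system T) (R : realType) (l n s m : nat)
    (f : 'cV[R]_l * 'cV[R]_n -> 'cV[R]_n)
    (g : 'cV[R]_l * 'cV[R]_n * 'cV[R]_n -> 'cV[R]_s)
    (a : 'I_m -> 'cV[R]_s) (c : 'I_m -> R) (px d : 'cV[R]_l * 'cV[R]_n)
    (y_ lam_ : T -> 'cV[R]_s) (lam eta : 'cV[R]_s) (I J : {set 'I_m})
    : Prop := KktLimit {
  lim_lam : lam_ @ U --> lam;
  lim_Xi : Xi g (polyhedron a c) px (- f px) d lam;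
  lim_eta : normal_cone (critical_cone (polyhedron a c) (gtilde g px) lam)
                        ('d (gtilde g) px d) eta;
  lim_eq : 0 = 'd (Lag f g lam) px d + (bmap g px)^T *m eta;
  lim_active : \forall k \near U, active a c (y_ k) = I;
  lim_support : \forall k \near U, exists al : 'I_m -> R,
    (forall j, j \in J -> 0 < al j) /\ lam_ k = \sum_(j in J) al j *: a j;
  lim_JI : J \subset I;
  lim_IA : I \subset active a c (gtilde g px);
  lim_lam_cone : fgcone J a lam;
  (* In particular the face of J is orthogonal to eta, and lam + t eta is a
     combination of the a j, j in J, for small t >= 0. *)
  lim_eta_cone : exists2 ell, fgcone J a ell & exists2 r, 0 <= r & eta = ell - r *: lam;
  lim_dir : cone_face a (active a c (gtilde g px)) I ('d (gtilde g) px d) }.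

Lemma kkt_seq_y (T : Type) (U : set_system T) {UU : ProperFilter U}
    (R : realType) (l n s m : nat)
    (f : 'cV[R]_l * 'cV[R]_n -> 'cV[R]_n)
    (g : 'cV[R]_l * 'cV[R]_n * 'cV[R]_n -> 'cV[R]_s)
    (a : 'I_m -> 'cV[R]_s) (c : 'I_m -> R) (px d : 'cV[R]_l * 'cV[R]_n)
    (t_ : T -> R) (px_ : T -> 'cV[R]_l * 'cV[R]_n) (y_ lam_ : T -> 'cV[R]_s) :
  C1 g -> kkt_seq U f g a c px d t_ px_ y_ lam_ ->
  (t_ k)^-1 *: (y_ k - gtilde g px) @[k --> U] --> 'd (gtilde g) px d.
Proof.
move=> g1 [t0 tt dd _ _ _ fe].
have [[Gd _] _] := gtilde_C1 g1.
pose proof (diff_seq (Gd px) t0 tt dd) as H.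
have H2 : (t_ k)^-1 *: (gtilde g (px_ k) - gtilde g px) -
    (t_ k)^-1 *: (gtilde g (px_ k) - y_ k) @[k --> U] --> 'd (gtilde g) px d - 0.
  apply: cvgB; [exact: H | exact: fe].
rewrite subr0 in H2; apply: cvg_trans H2.
apply: near_eq_cvg; apply: nearW => k.
by rewrite -scalerBr; congr (_ *: _); apply/matrixP => i j; rewrite !mxE; ring.
Qed.

Lemma residual_split (R : realType) (s n : nat) (t : R) (F F0 : 'cV[R]_n)
    (B B0 : 'M[R]_(s, n)) (L L0 : 'cV[R]_s) : F0 + B0^T *m L0 = 0 ->
  t *: (F + B^T *m L) - (t *: (F - F0) + (t *: (B - B0))^T *m L) =
  B0^T *m (t *: (L - L0)).
Proof.
move=> /eqP; rewrite addr_eq0 => /eqP ->.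
rewrite linearZ /= -scalemxAl -scalemxAr -scalerDr -scalerBr; congr (_ *: _).
rewrite linearB /= mulmxBl mulmxBr.
by apply/matrixP => i j; rewrite !mxE; ring.
Qed.

Lemma psi_residual_split (R : realType) (s n : nat) (t : R)
    (F F0 z : 'cV[R]_n) (B B' B0 : 'M[R]_(s, n)) (L : 'cV[R]_s) :
  B'^T *m L = z ->
  t *: (F - F0) + t *: (z + F0) + (t *: (B - B0) - t *: (B' - B0))^T *m L =
  t *: (F + B^T *m L).
Proof.
move=> <-; rewrite -scalerBr linearZ /= -scalemxAl -!scalerDr; congr (_ *: _).
rewrite [B - B0 - _](_ : _ = B - B'); last first.
  by apply/matrixP => i j; rewrite !mxE; ring.
rewrite linearB /= mulmxBl.
by apply/matrixP => i j; rewrite !mxE; ring.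
Qed.

Lemma lag_step_split (R : realType) (s n : nat) (t : R) (F F0 : 'cV[R]_n)
    (B : 'M[R]_(s, n)) (L eta : 'cV[R]_s) : 0 < t -> F0 = 0 ->
  t^-1 *: (F + B^T *m L - F0) + B^T *m eta =
  t^-1 *: (F + B^T *m (L + t *: eta)).
Proof.
move=> t0 ->; rewrite subr0 mulmxDr addrA [RHS]scalerDr -scalemxAr.
by rewrite [X in _ = _ + X]scalerA mulVf ?scale1r // gt_eqF.
Qed.

Lemma residual_shift (R : realType) (s n : nat) (F F0 : 'cV[R]_n)
    (B B0 : 'M[R]_(s, n)) (L : 'cV[R]_s) : F0 + B0^T *m L = 0 ->
  F + B^T *m L = (F - F0) + (B - B0)^T *m L.
Proof.
move=> /eqP; rewrite addr_eq0 => /eqP ->.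
rewrite linearB /= mulmxBl.
by apply/matrixP => i j; rewrite !mxE; ring.
Qed.

(** Constancy of I and J follows from finiteness. The scaled increments of the
    multipliers may be unbounded, but their images under b^T converge, by the
    first equation of the system, and belong to the image of the cone generated
    by the a j, j in J, and - lam. This image is closed, so the limit is
    attained at some eta of the cone. *)
Lemma kkt_seq_limit (T : Type) (U : set_system T) {UU : UltraFilter U}
    (R : realType) (l n s m : nat)
    (f : 'cV[R]_l * 'cV[R]_n -> 'cV[R]_n)
    (g : 'cV[R]_l * 'cV[R]_n * 'cV[R]_n -> 'cV[R]_s)
    (a : 'I_m -> 'cV[R]_s) (c : 'I_m -> R) (px d : 'cV[R]_l * 'cV[R]_n)
    (t_ : T -> R) (px_ : T -> 'cV[R]_l * 'cV[R]_n) (y_ lam_ : T -> 'cV[R]_s) :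
  C1 f -> C2 g -> kkt_seq U f g a c px d t_ px_ y_ lam_ ->
  exists lam eta I J, kkt_limit U f g a c px d y_ lam_ lam eta I J.
Proof.
move=> f1 g2 kkt; have [t0 tt dd N_ [M HM] st fe] := kkt.
have g1 := g2.1.
have [b1 _] := bmap_C1 g2.
have [G1 _] := gtilde_C1 g1.
pose proof (kkt_seq_y g1 kkt) as yd.
set yb := gtilde g px in yd *; set y' := 'd (gtilde g) px d in yd *.
have yy : y_ @ U --> yb by exact: (@scaled_cvg0 _ U _ _ _ t_ y_ yb y' t0 tt yd).
have pxx : px_ @ U --> px by exact: (@scaled_cvg0 _ U _ _ _ t_ px_ px d t0 tt dd).
have [lam ll] := ultra_bounded_mx_cvg HM.
have Nl : normal_cone (polyhedron a c) yb lam by exact: normal_polyhedron_cvg N_ yy ll.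
have Dy : polyhedron a c yb by case: Nl.
have [I HI] := @ultra_fin _ U _ _ (fun k => active a c (y_ k)).
have Dy_ : \forall k \near U, polyhedron a c (y_ k) by apply: filterS N_ => k [].
have cdot i : dot (a i) (y_ k) @[k --> U] --> dot (a i) yb.
  by apply: cvg_dot => //; exact: cvg_cst.
have cdot' i : dot (a i) ((t_ k)^-1 *: (y_ k - yb)) @[k --> U] --> dot (a i) y'.
  by apply: cvg_dot => //; exact: cvg_cst.
have IA : I \subset active a c yb.
  apply/fintype.subsetP => i iI; rewrite inE; apply/eqP.
  apply: (cvg_unique _ (cdot i)); first exact: Rhausdorff.
  apply: cvg_trans (@cvg_cst _ (c i) _ U _); apply: near_eq_cvg.
  by apply: filterS HI => k Hk; move: iI; rewrite -Hk inE => /eqP.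
have : \forall k \near U, exists al : 'I_m -> R,
    (forall i, 0 <= al i) /\ lam_ k = \sum_(i in I) al i *: a i.
  near=> k.
  have <- : active a c (y_ k) = I by near: k.
  have /normal_polyhedronP[_ [al Hal]] : normal_cone (polyhedron a c) (y_ k) (lam_ k) by near: k.
  by exists al.
move=> /(near_choice (fun=> 0))[al Hal].
have [J HJ] := @ultra_fin _ U _ _ (fun k => [set i in I | 0 < al k i]%SET).
have JI : J \subset I.
  have [k <-] := filter_ex HJ.
  by apply/fintype.subsetP => i; rewrite inE => /andP[].
have supp : \forall k \near U, exists al : 'I_m -> R,
    (forall j, j \in J -> 0 < al j) /\ lam_ k = \sum_(j in J) al j *: a j.
  near=> k.
  have [al0 ->] : (forall i, 0 <= al k i) /\ lam_ k = \sum_(i in I) al k i *: a i by near: k.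
  have <- : [set i in I | 0 < al k i]%SET = J by near: k.
  exists (al k); split=> [j|]; first by rewrite inE => /andP[].
  rewrite (big_setID [set i in I | 0 < al k i]%SET) /= [X in _ + X]big1 ?addr0.
    by apply: eq_bigl => i; rewrite !inE; case: (i \in I).
  move=> i; rewrite !inE => /andP[+ iI]; rewrite iI /= -leNgt => ai.
  have -> : al k i = 0 by apply/eqP; rewrite eq_le ai al0.
  by rewrite scale0r.
have lamJ : fgcone J a lam.
  apply: (@fgcone_ultra _ _ _ _ U _ J a lam_) => //.
  apply: filterS supp => k [be [be0 ->]].
  exists (fun j => if j \in J then be j else 0); split=> [j|].
    by case: ifP => // jJ; apply/ltW/be0.
  by apply: eq_bigr => j ->.
have dirP : cone_face a (active a c yb) I y'.
  split=> i Hi.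
    apply: (cvgr_to_le (cdot' i)); near=> k.
    have tk : 0 < t_ k by near: k.
    have Dk : polyhedron a c (y_ k) by near: k.
    move: Hi; rewrite inE dotZr dotBr => /eqP ->.
    by rewrite pmulr_rle0 ?invr_gt0 // subr_le0.
  apply: (cvg_unique _ (cdot' i)); first exact: Rhausdorff.
  apply: cvg_trans (@cvg_cst _ (0 : R) _ U _); apply: near_eq_cvg.
  apply: filterS HI => k Hk; rewrite dotZr dotBr.
  have : i \in active a c (y_ k) by rewrite Hk.
  rewrite inE => /eqP ->.
  have /(fintype.subsetP IA) := Hi; rewrite inE => /eqP ->.
  by rewrite subrr mulr0.
have y'J j : j \in J -> dot (a j) y' = 0.
  by move=> jJ; apply: dirP.2; exact: (fintype.subsetP JI).
have ly' : dot lam y' = 0 by exact: fgcone_dot_eq0 lamJ y'J.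
have fx : f (px_ k) @[k --> U] --> f px.
  exact: (cvg_comp _ _ pxx (C1_continuous f1 (x := px))).
have bx : bmap g (px_ k) @[k --> U] --> bmap g px.
  exact: (cvg_comp _ _ pxx (C1_continuous b1 (x := px))).
have eq0 : f px + (bmap g px)^T *m lam = 0.
  apply: (@cvg_unique _ _ (f (px_ k) + (bmap g (px_ k))^T *m lam_ k @[k --> U])).
  - exact: norm_hausdorff.
  - by apply: cvgD; [exact: fx | apply: cvg_mulmx; [exact: cvg_trmx | exact: ll]].
  - apply: (@scaled_cvg0 _ U _ _ _ t_ _ 0 0) => //.
    by under eq_cvg do rewrite subr0.
have XiP : Xi g (polyhedron a c) px (- f px) d lam.
  split=> //; first by apply/eqP; rewrite -addr_eq0 addrC eq0.
  by apply/critical_polyhedronP => //; split=> //; exact: dirP.1.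
pose b := bmap g px.
pose xi := - ('d f px d + ('d (bmap g) px d)^T *m lam).
have etac : b^T *m ((t_ k)^-1 *: (lam_ k - lam)) @[k --> U] --> xi.
  pose proof (diff_seq (f1.1 px) t0 tt dd) as H1.
  pose proof (diff_seq (b1.1 px) t0 tt dd) as H2.
  pose proof (cvg_mulmx (cvg_trmx H2) ll) as H3.
  have H4 : (t_ k)^-1 *: (f (px_ k) + (bmap g (px_ k))^T *m lam_ k) -
    ((t_ k)^-1 *: (f (px_ k) - f px) +
     ((t_ k)^-1 *: (bmap g (px_ k) - bmap g px))^T *m lam_ k) @[k --> U] --> 0 + xi.
    by apply: cvgB; [exact: st | apply: cvgD; [exact: H1 | exact: H3]].
  rewrite add0r in H4; apply: cvg_trans H4.
  apply: near_eq_cvg; apply: nearW => k.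
  exact: residual_split.
have [ga [r [ga0 r0 gaE]]] : exists (ga : 'I_m -> R) (r : R),
    [/\ forall j, 0 <= ga j, 0 <= r &
     b^T *m (\sum_(j in J) ga j *: a j - r *: lam) = xi].
  (* The images of the generators, with inr for - lam. *)
  pose p (i : 'I_m + unit) : 'cV[R]_n := match i with
    | inl j => if j \in J then b^T *m a j else 0
    | inr _ => - (b^T *m lam) end.
  have pE (q : 'I_m + unit -> R) : \sum_(i in [set: 'I_m + unit]%SET) q i *: p i =
      b^T *m (\sum_(j in J) q (inl j) *: a j - q (inr Datatypes.tt) *: lam).
    rewrite (eq_bigl xpredT); last by move=> i; rewrite inE.
    rewrite big_sumType /= [X in _ + X](big_pred1 Datatypes.tt); last by case.
    rewrite /p mulmxBr -scalemxAr scalerN; congr (_ - _).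
    rewrite mulmx_sumr [RHS]big_mkcond /=; apply: eq_bigr => j _.
    by case: ifP => _; rewrite ?scaler0 // scalemxAr.
  have [q [q0 qE]] : fgcone [set: 'I_m + unit]%SET p xi.
    apply: (@fgcone_ultra _ _ _ _ U _ _ p _ xi _ etac); near=> k.
    have [be [be0 ->]] : exists be : 'I_m -> R,
      (forall j, j \in J -> 0 < be j) /\ lam_ k = \sum_(j in J) be j *: a j by near: k.
    have tk : 0 < t_ k by near: k.
    exists (fun i => match i with
      | inl j => if j \in J then (t_ k)^-1 * be j else 0
      | inr _ => (t_ k)^-1 end); split=> [[j|_]|].
    - by case: ifP => // jJ; rewrite mulr_ge0 ?invr_ge0 ?ltW // be0.
    - by rewrite invr_ge0 ltW.
    - rewrite pE scalerBr scaler_sumr; congr (_ *m (_ - _)).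
      by apply: eq_bigr => j jJ; rewrite jJ scalerA.
  exists (fun j => q (inl j)), (q (inr Datatypes.tt)); split; [by move=> j | by [] |].
  by rewrite qE pE.
pose ell := \sum_(j in J) ga j *: a j.
have ellJ : fgcone J a ell by exists ga.
pose eta := ell - r *: lam.
have JA j : j \in J -> j \in active a c yb.
  by move=> jJ; apply: (fintype.subsetP IA); exact: (fintype.subsetP JI).
have eta_le0 v : critical_cone (polyhedron a c) yb lam v -> dot eta v <= 0.
  move=> /(critical_polyhedronP _ _ Dy)[Hv lv].
  rewrite dotBl dotZl lv mulr0 subr0.
  by apply: (fgcone_dot_le0 ellJ) => j /JA; exact: Hv.
have eta_y' : dot eta y' = 0.
  by rewrite dotBl dotZl ly' mulr0 subr0; exact: fgcone_dot_eq0 ellJ y'J.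
exists lam, eta, I, J; split=> //.
- split; first by case: XiP.
  move=> v [_ [u_ [s_ [uv _ s0 Hu]]]].
  have /cvgr_to_le : dot eta (u_ k) @[k --> \oo] --> dot eta v.
    by apply: cvg_dot; [exact: cvg_cst | exact: uv].
  apply; apply: nearW => k; have := eta_le0 _ (Hu k).
  by rewrite dotDr eta_y' add0r dotZr pmulr_rle0.
- rewrite (Lag_C1 lam f1 g2).2 gaE /xi subrr //.
- by exists ell => //; exists r.
Unshelve. all: by end_near. Qed.

(** * A variational principle for the residual *)

Lemma dot_self_seq (T : Type) (F : set_system T) {FF : ProperFilter F}
    (R : realType) (n : nat) (t_ : T -> R) (r_ : T -> 'cV[R]_n) (r r' : 'cV[R]_n) :
  (\forall k \near F, 0 < t_ k) -> t_ @ F --> (0 : R) ->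
  (t_ k)^-1 *: (r_ k - r) @[k --> F] --> r' ->
  (t_ k)^-1 * (dot (r_ k) (r_ k) - dot r r) @[k --> F] --> 2 * dot r r'.
Proof.
move=> t0 tt H.
have rr : r_ @ F --> r by exact: scaled_cvg0 t0 tt H.
have H2 : dot ((t_ k)^-1 *: (r_ k - r)) (r_ k + r) @[k --> F] --> dot r' (r + r).
  by apply: cvg_dot => //; apply: cvgD => //; exact: cvg_cst.
have -> : 2 * dot r r' = dot r' (r + r) by rewrite dotDr [dot r' r]dotC; ring.
apply: cvg_trans H2; apply: near_eq_cvg; apply: nearW => k.
by rewrite dotZl dotDr !dotBl [dot r (r_ k)]dotC; congr (_ * _); ring.
Qed.

(** If the norm e of a pair of vectors decreases at rate at most de along a curve, this
    bounds the derivative of half its square. No derivative of the norm is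
    needed, so it applies without separating the case e = 0. *)
Lemma sqrt_first_order (T : Type) (F : set_system T) {FF : ProperFilter F}
    (R : realType) (n s : nat) (t_ : T -> R) (r1_ : T -> 'cV[R]_n)
    (r2_ : T -> 'cV[R]_s) (r1 r1' : 'cV[R]_n) (r2 r2' : 'cV[R]_s) (de : R) :
  let e := Num.sqrt (dot r1 r1 + dot r2 r2) in
  (\forall k \near F, 0 < t_ k) -> t_ @ F --> (0 : R) ->
  (t_ k)^-1 *: (r1_ k - r1) @[k --> F] --> r1' ->
  (t_ k)^-1 *: (r2_ k - r2) @[k --> F] --> r2' ->
  (\forall k \near F,
     e <= Num.sqrt (dot (r1_ k) (r1_ k) + dot (r2_ k) (r2_ k)) + t_ k * de) ->
  - de * e <= dot r1 r1' + dot r2 r2'.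
Proof.
move=> e t0 tt H1 H2 He.
pose proof (dot_self_seq t0 tt H1) as D1.
pose proof (dot_self_seq t0 tt H2) as D2.
pose ek k := Num.sqrt (dot (r1_ k) (r1_ k) + dot (r2_ k) (r2_ k)).
have eke : ek @ F --> e.
  have rr1 : r1_ @ F --> r1 by exact: scaled_cvg0 t0 tt H1.
  have rr2 : r2_ @ F --> r2 by exact: scaled_cvg0 t0 tt H2.
  have c0 : dot (r1_ k) (r1_ k) + dot (r2_ k) (r2_ k) @[k --> F] -->
      dot r1 r1 + dot r2 r2.
    by apply: cvgD; [exact: (cvg_dot rr1 rr1) | exact: (cvg_dot rr2 rr2)].
  apply: (@cvg_comp _ _ _ _ Num.sqrt _ _ _ c0).
  exact: sqrt_continuous.
have c1 : (t_ k)^-1 * (dot (r1_ k) (r1_ k) - dot r1 r1) +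
    (t_ k)^-1 * (dot (r2_ k) (r2_ k) - dot r2 r2) @[k --> F] -->
    2 * dot r1 r1' + 2 * dot r2 r2' by exact: cvgD.
have c2 : - de * (e + ek k) @[k --> F] --> - de * (e + e).
  by apply: cvgM; [exact: (@cvg_cst _ (- de) _ F _) | apply: cvgD; [exact: (@cvg_cst _ e _ F _) | exact: eke]].
have : - de * (e + e) <= 2 * dot r1 r1' + 2 * dot r2 r2'.
  have Hn : \forall k \near F, - de * (e + ek k) <=
      (t_ k)^-1 * (dot (r1_ k) (r1_ k) - dot r1 r1) +
      (t_ k)^-1 * (dot (r2_ k) (r2_ k) - dot r2 r2); last first.
    exact: (ler_lim_near c2 c1 Hn).
  near=> k.
  have tk : 0 < t_ k by near: k.
  rewrite -mulrDr ler_pdivlMl //.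
  have : e <= ek k + t_ k * de by near: k.
  have E : e ^+ 2 = dot r1 r1 + dot r2 r2 by rewrite sqr_sqrtr // addr_ge0 ?dot_ge0.
  have Ek : ek k ^+ 2 = dot (r1_ k) (r1_ k) + dot (r2_ k) (r2_ k).
    by rewrite sqr_sqrtr // addr_ge0 ?dot_ge0.
  have -> : dot (r1_ k) (r1_ k) - dot r1 r1 + (dot (r2_ k) (r2_ k) - dot r2 r2) =
    ek k ^+ 2 - e ^+ 2 by rewrite E Ek; ring.
  have : 0 <= e by exact: sqrtr_ge0.
  have : 0 <= ek k by exact: sqrtr_ge0.
  set x := ek k; move=> x0 e0 H.
  have : (e - x) * (e + x) <= t_ k * de * (e + x).
    by apply: ler_wpM2r; [rewrite addr_ge0 | rewrite lerBlDl].
  by rewrite !expr2; lra.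
by lra.
Unshelve. all: by end_near. Qed.

Lemma triple_compact (R : realType) (n1 n2 n3 : nat)
    (A : set ('cV[R]_n1 * 'cV[R]_n2 * 'cV[R]_n3)) (M : R) :
  (forall (U : set_system ('cV[R]_n1 * 'cV[R]_n2 * 'cV[R]_n3)),
    UltraFilter U -> (\forall z \near U, A z) -> forall x y z,
    z'.1.1 @[z' --> U] --> x -> z'.1.2 @[z' --> U] --> y ->
    z'.2 @[z' --> U] --> z -> A (x, y, z)) ->
  (forall z, A z -> `|z| <= M) -> compact A.
Proof.
move=> cA bA; rewrite compact_ultra => U UU UA.
have [x Ux] : exists x : 'cV[R]_n1, z'.1.1 @[z' --> U] --> x.
  apply: (@ultra_bounded_mx_cvg _ U _ _ _ _ _ M); apply: filterS UA => z /bA.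
  by apply: le_trans; rewrite [leRHS]prod_normE le_max [X in X || _]le_max lexx.
have [y Uy] : exists y : 'cV[R]_n2, z'.1.2 @[z' --> U] --> y.
  apply: (@ultra_bounded_mx_cvg _ U _ _ _ _ _ M); apply: filterS UA => z /bA.
  by apply: le_trans; rewrite [leRHS]prod_normE le_max [X in X || _]le_max lexx orbT.
have [z Uz] : exists z : 'cV[R]_n3, z'.2 @[z' --> U] --> z.
  apply: (@ultra_bounded_mx_cvg _ U _ _ _ _ _ M); apply: filterS UA => z /bA.
  by apply: le_trans; rewrite [leRHS]prod_normE le_max lexx orbT.
exists (x, y, z); split; first exact: (cA U).
pose proof (cvg_npair (cvg_npair Ux Uy) Uz) as H; move: H.
apply: cvg_trans; rewrite (_ : (fun k => _) = id) //.
by apply/funext => -[[]].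
Qed.

Definition residual (R : realType) (l n s : nat)
    (f : 'cV[R]_l * 'cV[R]_n -> 'cV[R]_n)
    (g : 'cV[R]_l * 'cV[R]_n * 'cV[R]_n -> 'cV[R]_s)
    (px : 'cV[R]_l * 'cV[R]_n) (lam y : 'cV[R]_s) : R :=
  Num.sqrt (dot (f px + (bmap g px)^T *m lam) (f px + (bmap g px)^T *m lam) +
            dot (gtilde g px - y) (gtilde g px - y)).

Lemma norm_le_residual (R : realType) (l n s : nat)
    (f : 'cV[R]_l * 'cV[R]_n -> 'cV[R]_n)
    (g : 'cV[R]_l * 'cV[R]_n * 'cV[R]_n -> 'cV[R]_s) px lam y :
  `|f px + (bmap g px)^T *m lam| <= residual f g px lam y /\
  `|gtilde g px - y| <= residual f g px lam y.
Proof.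
split; apply: (le_trans (norm_le_enorm _)); apply: ler_wsqrtr.
  by rewrite lerDl dot_ge0.
by rewrite lerDr dot_ge0.
Qed.

Lemma residual_le (R : realType) (l n s : nat)
    (f : 'cV[R]_l * 'cV[R]_n -> 'cV[R]_n)
    (g : 'cV[R]_l * 'cV[R]_n * 'cV[R]_n -> 'cV[R]_s) px lam y :
  residual f g px lam y <= n%:R * `|f px + (bmap g px)^T *m lam| +
                           s%:R * `|gtilde g px - y|.
Proof.
set r1 := f px + _; set r2 := _ - y.
apply: (@le_trans _ _ (enorm r1 + enorm r2)); last first.
  by apply: lerD; exact: enorm_le_norm.
rewrite -(@ler_pXn2r _ 2) ?nnegrE ?addr_ge0 ?enorm_ge0 ?sqrtr_ge0 //.
rewrite sqr_sqrtr ?addr_ge0 ?dot_ge0 // -!sqr_enorm.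
have := enorm_ge0 r1; have := enorm_ge0 r2; nra.
Qed.

Lemma residual_continuous (R : realType) (l n s : nat)
    (f : 'cV[R]_l * 'cV[R]_n -> 'cV[R]_n)
    (g : 'cV[R]_l * 'cV[R]_n * 'cV[R]_n -> 'cV[R]_s) (p : 'cV[R]_l) :
  C1 f -> C2 g ->
  continuous (fun z : 'cV[R]_n * 'cV[R]_s * 'cV[R]_s =>
    residual f g (p, z.1.1) z.1.2 z.2).
Proof.
move=> f1 g2 z.
have [b1 _] := bmap_C1 g2; have [G1 _] := gtilde_C1 g2.1.
have c12 : z'.1 @[z' --> z] --> z.1 by exact: cvg_fst.
have c1 : z'.1.1 @[z' --> z] --> z.1.1 by apply: (cvg_comp _ _ c12); exact: cvg_fst.
have c2 : z'.1.2 @[z' --> z] --> z.1.2 by apply: (cvg_comp _ _ c12); exact: cvg_snd.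
have c3 : z'.2 @[z' --> z] --> z.2 by exact: cvg_snd.
have cp : (p, z'.1.1) @[z' --> z] --> (p, z.1.1).
  by apply: cvg_npair; [exact: cvg_cst | exact: c1].
have cf : f (p, z'.1.1) @[z' --> z] --> f (p, z.1.1).
  exact: (cvg_comp _ _ cp (C1_continuous f1 (x := _))).
have cb : bmap g (p, z'.1.1) @[z' --> z] --> bmap g (p, z.1.1).
  exact: (cvg_comp _ _ cp (C1_continuous b1 (x := _))).
have cG : gtilde g (p, z'.1.1) @[z' --> z] --> gtilde g (p, z.1.1).
  exact: (cvg_comp _ _ cp (C1_continuous G1 (x := _))).
have r1 : f (p, z'.1.1) + (bmap g (p, z'.1.1))^T *m z'.1.2 @[z' --> z] -->
    f (p, z.1.1) + (bmap g (p, z.1.1))^T *m z.1.2.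
  by apply: cvgD; [exact: cf | exact: (cvg_mulmx (cvg_trmx cb) c2)].
have r2 : gtilde g (p, z'.1.1) - z'.2 @[z' --> z] --> gtilde g (p, z.1.1) - z.2.
  exact: cvgB.
have rr : dot (f (p, z'.1.1) + (bmap g (p, z'.1.1))^T *m z'.1.2)
              (f (p, z'.1.1) + (bmap g (p, z'.1.1))^T *m z'.1.2) +
          dot (gtilde g (p, z'.1.1) - z'.2) (gtilde g (p, z'.1.1) - z'.2)
    @[z' --> z] -->
    dot (f (p, z.1.1) + (bmap g (p, z.1.1))^T *m z.1.2)
        (f (p, z.1.1) + (bmap g (p, z.1.1))^T *m z.1.2) +
    dot (gtilde g (p, z.1.1) - z.2) (gtilde g (p, z.1.1) - z.2).
  by apply: cvgD; [exact: (cvg_dot r1 r1) | exact: (cvg_dot r2 r2)].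
apply: (@cvg_comp _ _ _ _ Num.sqrt _ _ _ rr).
exact: sqrt_continuous.
Qed.

(** Minimise residual + ep |z - z0| over the graph of the normal cone map in
    a ball of radius 2 r. The bound on the residual at z0 keeps the minimiser z
    within r of z0, hence off the boundary of the ball. If the residual of z does not
    vanish, the vector (w, mu) is the normalised residual, and the three
    inequalities are the first-order conditions for changing x, lam or y
    alone: these separate moves stay on the graph and are all that is
    needed. *)
Lemma kkt_ekeland (R : realType) (l n s m : nat)
    (f : 'cV[R]_l * 'cV[R]_n -> 'cV[R]_n)
    (g : 'cV[R]_l * 'cV[R]_n * 'cV[R]_n -> 'cV[R]_s)
    (a : 'I_m -> 'cV[R]_s) (c : 'I_m -> R) (p : 'cV[R]_l) (x0 : 'cV[R]_n)
    (lam0 y0 : 'cV[R]_s) (ep r : R) :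
  C1 f -> C2 g -> 0 < ep -> 0 < r ->
  normal_cone (polyhedron a c) y0 lam0 ->
  residual f g (p, x0) lam0 y0 <= ep * r ->
  exists x lam y, [/\ normal_cone (polyhedron a c) y lam,
      `|x - x0| <= r, `|lam - lam0| <= r, `|y - y0| <= r &
      residual f g (p, x) lam y <= ep * r] /\
    (f (p, x) + (bmap g (p, x))^T *m lam = 0 /\ gtilde g (p, x) = y \/
     exists w mu, [/\ dot w w + dot mu mu = 1,
       forall dx, - (ep * `|dx|) <=
         dot w ('d f (p, x) (0, dx) + ('d (bmap g) (p, x) (0, dx))^T *m lam) +
         dot mu ('d (gtilde g) (p, x) (0, dx)),
       forall dl t0, 0 < t0 -> (forall t, 0 < t -> t <= t0 ->
           normal_cone (polyhedron a c) y (lam + t *: dl)) ->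
         - (ep * `|dl|) <= dot w ((bmap g (p, x))^T *m dl) &
       forall dy t0, 0 < t0 -> (forall t, 0 < t -> t <= t0 ->
           normal_cone (polyhedron a c) (y + t *: dy) lam) ->
         - (ep * `|dy|) <= - dot mu dy]).
Proof.
move=> f1 g2 ep0 r0 N0 res0.
have [b1 _] := bmap_C1 g2; have [G1 _] := gtilde_C1 g2.1.
pose Z : normedModType R := ('cV[R]_n * 'cV[R]_s * 'cV[R]_s)%type.
pose z0 : Z := (x0, lam0, y0).
pose res (z : Z) := residual f g (p, z.1.1) z.1.2 z.2.
pose A : set Z := [set z | normal_cone (polyhedron a c) z.2 z.1.2 /\ `|z - z0| <= 2 * r].
have cA : compact A.
  apply: (@triple_compact _ _ _ _ _ (2 * r + `|z0|)).
    move=> U UU HU x lam y Ux Ul Uy; split=> /=.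
      by apply: (normal_polyhedron_cvg _ Uy Ul); apply: filterS HU => z [].
    have Uz : z' - z0 @[z' --> U] --> ((x, lam, y) : Z) - z0.
      apply: cvgB; last exact: cvg_cst.
      pose proof (cvg_npair (cvg_npair Ux Ul) Uy) as H.
      apply: cvg_trans H; apply: near_eq_cvg; apply: nearW => -[[]] //.
    pose proof (cvg_norm Uz) as Un.
    by apply: (cvgr_to_le Un); apply: filterS HU => z [].
  move=> z [_ Hz]; rewrite -[z](subrK z0).
  by rewrite (le_trans (ler_normD _ _)) // lerD2r.
have A0 : A z0 by split; rewrite // subrr normr0 mulr_ge0 // ltW.
have cres : continuous res by move=> z'; exact: (@residual_continuous R l n s f g p f1 g2 z').
have cphi : {within A, continuous (fun z : Z => res z + ep * `|z - z0|)}.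
  apply: continuous_subspaceT => z; apply: cvgD.
    exact: (cres z).
  apply: cvgM; first exact: cvg_cst.
  by apply: cvg_norm; apply: cvgB; [exact: cvg_id | exact: cvg_cst].
have [z + Hmin] := compact_EVT_min (ex_intro _ z0 A0) cA cphi.
rewrite inE => -[Nz Hz].
have rz0 : res z0 <= ep * r by [].
have res_ge0 z' : 0 <= res z' by exact: sqrtr_ge0.
have H0 : res z + ep * `|z - z0| <= ep * r.
  have : res z + ep * `|z - z0| <= res z0 + ep * `|z0 - z0|.
    by apply: Hmin; rewrite inE.
  by rewrite subrr normr0 mulr0 addr0 => /le_trans; apply.
have zr : `|z - z0| <= r.
  by rewrite -(ler_pM2l ep0) (le_trans _ H0) // lerDr.
have rzr : res z <= ep * r by rewrite (le_trans _ H0) // lerDl mulr_ge0 // ltW.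
case: z Nz Hz H0 zr rzr Hmin => -[x lam] y /= Nz Hz H0 zr rzr Hmin.
exists x, lam, y; split.
  move: zr; rewrite [X in X <= _]prod_normE /= ge_max => /andP[+ zy].
  rewrite [X in X <= _]prod_normE /= ge_max => /andP[zx zl].
  by split.
set r1 := f (p, x) + (bmap g (p, x))^T *m lam.
set r2 := gtilde g (p, x) - y.
pose e := res (x, lam, y).
have eE : e = Num.sqrt (dot r1 r1 + dot r2 r2) by [].
have e2 : e ^+ 2 = dot r1 r1 + dot r2 r2 by rewrite sqr_sqrtr // addr_ge0 ?dot_ge0.
have [e0|/eqP e_neq0] := pselect (e = 0).
  left; move: e2; rewrite e0 expr0n /= => /esym/eqP.
  rewrite paddr_eq0 ?dot_ge0 // => /andP[/eqP/dot_eq0 H1 /eqP/dot_eq0/eqP].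
  by rewrite subr_eq0 => /eqP H2.
have e_gt0 : 0 < e by rewrite lt_def e_neq0 res_ge0.
have lin (q1 q2 q3 q4 q5 : R) : q1 + q2 <= q3 + q4 -> q4 <= q2 + q5 ->
    q1 <= q3 + q5 by move=> ? ?; lra.
have step (d : Z) (t0 : R) (r1' : 'cV[R]_n) (r2' : 'cV[R]_s) : 0 < t0 ->
    (forall t, 0 < t -> t <= t0 ->
       normal_cone (polyhedron a c) (y + t *: d.2) (lam + t *: d.1.2)) ->
    (forall t_ : nat -> R, (forall k, 0 < t_ k) -> t_ @ \oo --> (0 : R) ->
       (t_ k)^-1 *: (f (p, x + t_ k *: d.1.1) +
          (bmap g (p, x + t_ k *: d.1.1))^T *m (lam + t_ k *: d.1.2) - r1)
         @[k --> \oo] --> r1' /\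
       (t_ k)^-1 *: (gtilde g (p, x + t_ k *: d.1.1) - (y + t_ k *: d.2) - r2)
         @[k --> \oo] --> r2') ->
    - (ep * `|d|) <= dot (e^-1 *: r1) r1' + dot (e^-1 *: r2) r2'.
  move=> t00 Hd Hr.
  (* The second bound keeps the moved point in the ball. *)
  pose tau := Num.min t0 (r / (`|d| + 1)).
  have d1 : 0 < `|d| + 1 by rewrite ltr_wpDl.
  have tau0 : 0 < tau by rewrite lt_min t00 divr_gt0.
  pose t_ k := tau / k.+1%:R : R.
  have tpos k : 0 < t_ k by rewrite divr_gt0.
  have ttau k : t_ k <= tau.
    by rewrite ler_pdivrMr // ler_peMr ?ler1n // ltW.
  have tcvg : t_ @ \oo --> (0 : R) by exact: harmonic_pos_cvg.
  have [C1 C2] := Hr _ tpos tcvg.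
  have : - (ep * `|d|) * e <= dot r1 r1' + dot r2 r2'.
    apply: (@sqrt_first_order _ \oo _ _ _ _ t_ _ _ _ _ _ _ _ _ tcvg C1 C2).
      exact: nearW.
    apply: nearW => k.
    pose zk : Z := (x, lam, y) + t_ k *: d.
    have Azk : A zk.
      split.
        by apply: Hd => //; rewrite (le_trans (ttau k)) // ge_min lexx.
      rewrite /zk addrAC (le_trans (ler_normD _ _)) //.
      have -> : 2 * r = r + r by ring.
      apply: lerD => //; rewrite normrZ gtr0_norm //.
      apply: (@le_trans _ _ (r / (`|d| + 1) * `|d|)).
        by apply: ler_wpM2r => //; rewrite (le_trans (ttau k)) // ge_min lexx orbT.
      by rewrite mulrAC ler_pdivrMr //; apply: ler_wpM2l; [exact: ltW | rewrite lerDl].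
    have := Hmin zk; rewrite inE => /(_ Azk) H.
    have H' : ep * `|zk - z0| <= ep * `|(x, lam, y) - z0| + t_ k * (ep * `|d|).
      rewrite mulrCA -mulrDr; apply: ler_wpM2l; first exact: ltW.
      rewrite /zk addrAC (le_trans (ler_normD _ _)) // lerD2l normrZ gtr0_norm //.
    have Hle : e <= res zk + t_ k * (ep * `|d|).
      have H2 : e + ep * `|(x, lam, y) - z0| <= res zk + ep * `|zk - z0| by [].
      exact: (lin _ _ _ _ _ H2 H').
    exact: Hle.
  rewrite !dotZl -mulrDr => H.
  by rewrite ler_pdivlMl // mulrC.
right; exists (e^-1 *: r1), (e^-1 *: r2).
split.
- rewrite !dotZl !dotZr -!mulrDr -e2 expr2; field; exact: e_neq0.
- move=> dx.
  have -> : `|dx| = `|((dx, 0, 0) : Z)|.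
    rewrite [RHS]prod_normE /= [X in Num.max X _]prod_normE /= !normr0.
    by rewrite !(max_l (normr_ge0 dx)).
  apply: (step (dx, 0, 0) 1) => //.
    by move=> t _ _; rewrite /= !scaler0 !addr0.
  move=> t_ tp tc /=.
  have pxk k : (p, x + t_ k *: dx) = (p, x) + t_ k *: (0, dx).
    by congr pair => /=; rewrite scaler0 addr0.
  have [[Ld _] LE] := Lag_C1 lam f1 g2.
  have tpn : \forall k \near \oo, 0 < t_ k by exact: nearW.
  pose proof (directional_seq (d := (0, dx)) (Ld (p, x)) tpn tc) as H1.
  pose proof (directional_seq (d := (0, dx)) (G1.1 (p, x)) tpn tc) as H2.
  split; last first.
    apply: cvg_trans H2; apply: near_eq_cvg; apply: nearW => k.
    by rewrite scaler0 addr0 pxk /r2 opprB addrA subrK.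
  rewrite -(LE (p, x) (0, dx)).
  apply: cvg_trans H1; apply: near_eq_cvg; apply: nearW => k.
  by rewrite scaler0 addr0 pxk.
- move=> dl t0 t00 Hdl.
  have -> : `|dl| = `|((0, dl, 0) : Z)|.
    rewrite [RHS]prod_normE /= [X in Num.max X _]prod_normE /= !normr0.
    by rewrite (max_r (normr_ge0 dl)) (max_l (normr_ge0 dl)).
  rewrite -[X in _ <= X]addr0 -(dot0r (e^-1 *: r2)).
  apply: (step (0, dl, 0) t0) => //.
    by move=> t t1 t2; rewrite /= scaler0 addr0; exact: Hdl.
  move=> t_ tp tc /=; split.
    apply: cvg_trans (@cvg_cst _ ((bmap g (p, x))^T *m dl) _ \oo _).
    apply: near_eq_cvg; apply: nearW => k.
    have aux (v1 v2 v3 : 'cV[R]_n) : v1 + (v2 + v3) - (v1 + v2) = v3.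
      by rewrite addrA [_ + v3]addrC addrK.
    rewrite scaler0 addr0 /r1 mulmxDr -scalemxAr aux.
    by rewrite scalerA mulVf ?scale1r // gt_eqF.
  apply: cvg_trans (@cvg_cst _ (0 : 'cV[R]_s) _ \oo _).
  apply: near_eq_cvg; apply: nearW => k.
  by rewrite !scaler0 !addr0 subrr scaler0.
- move=> dy t0 t00 Hdy.
  have -> : `|dy| = `|((0, 0, dy) : Z)|.
    rewrite [RHS]prod_normE /= [X in Num.max X _]prod_normE /= !normr0.
    by rewrite maxxx (max_r (normr_ge0 dy)).
  rewrite -dotNr -[X in _ <= X]add0r -{1}(dot0r (e^-1 *: r1)).
  apply: (step (0, 0, dy) t0) => //.
    by move=> t t1 t2; rewrite /= scaler0 addr0; exact: Hdy.
  move=> t_ tp tc /=; split.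
    apply: cvg_trans (@cvg_cst _ (0 : 'cV[R]_n) _ \oo _).
    apply: near_eq_cvg; apply: nearW => k.
    by rewrite !scaler0 !addr0 subrr scaler0.
  apply: cvg_trans (@cvg_cst _ (- dy) _ \oo _).
  apply: near_eq_cvg; apply: nearW => k.
  have aux (v1 v2 v3 : 'cV[R]_s) : v1 - (v2 + v3) - (v1 - v2) = - v3.
    by apply/matrixP => i j; rewrite !mxE; ring.
  rewrite scaler0 addr0 /r2 aux scalerN.
  by rewrite scalerA mulVf ?scale1r // gt_eqF.
Qed.

(** * Correction of approximate solutions *)

(** What is assumed of the nonzero directions d = (q, u) that solve the linearized
    equation. *)
Definition dir_regular (R : realType) (l n s : nat)
    (f : 'cV[R]_l * 'cV[R]_n -> 'cV[R]_n)
    (g : 'cV[R]_l * 'cV[R]_n * 'cV[R]_n -> 'cV[R]_s) (D : set 'cV[R]_s)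
    (px d : 'cV[R]_l * 'cV[R]_n) : Prop :=
  (forall mu : 'cV[R]_s, (Jac2 (gtilde g) px)^T *m mu = 0 ->
     linear_hull (normal_cone (tangent_cone D (gtilde g px))
                              ('d (gtilde g) px d)) mu -> mu = 0) /\
  (forall lam : 'cV[R]_s, Xi g D px (- f px) d lam ->
   forall eta : 'cV[R]_s,
     normal_cone (critical_cone D (gtilde g px) lam) ('d (gtilde g) px d) eta ->
     0 = 'd (Lag f g lam) px d + (bmap g px)^T *m eta ->
   forall F1 F2 : set 'cV[R]_s,
     is_face (critical_cone D (gtilde g px) lam) F1 ->
     is_face (critical_cone D (gtilde g px) lam) F2 ->
     F2 ('d (gtilde g) px d) -> F2 `<=` F1 -> F1 `<=` perp eta ->
   forall w : 'cV[R]_n, w <> 0 -> minkowski_diff F1 F2 (bmap g px *m w) ->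
   exists2 wt : 'cV[R]_n, minkowski_diff F1 F2 (Jac2 (gtilde g) px *m wt) &
     0 < (w^T *m Jac2 (Lag f g lam) px *m wt) 0 0).

(** The hypotheses on (w, mu) express the adjoint system for the faces attached
    to I and J. If w is nonzero, the positivity condition for - w yields a
    direction wt along which the first equation of the system would be negative.
    So w = 0, mu is annihilated by the transposed Jacobian of the constraint
    and is orthogonal to all v with dot (a i) v = 0 on I, hence in the span of the
    a i, i in I, and nondegeneracy applies. *)
Lemma dir_regular_trivial (T : Type) (U : set_system T) {UU : UltraFilter U}
    (R : realType) (l n s m : nat)
    (f : 'cV[R]_l * 'cV[R]_n -> 'cV[R]_n)
    (g : 'cV[R]_l * 'cV[R]_n * 'cV[R]_n -> 'cV[R]_s)
    (a : 'I_m -> 'cV[R]_s) (c : 'I_m -> R) (px d : 'cV[R]_l * 'cV[R]_n)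
    (y_ lam_ : T -> 'cV[R]_s) (lam eta : 'cV[R]_s) (I J : {set 'I_m})
    (w : 'cV[R]_n) (mu : 'cV[R]_s) :
  C1 f -> C2 g -> dir_regular f g (polyhedron a c) px d ->
  (\forall k \near U, polyhedron a c (y_ k)) ->
  kkt_limit U f g a c px d y_ lam_ lam eta I J ->
  (forall dx, 0 <= dot w ('d (Lag f g lam) px (0, dx)) +
                   dot mu ('d (gtilde g) px (0, dx))) ->
  (forall i, i \in I -> 0 <= dot w ((bmap g px)^T *m a i)) ->
  (forall j, j \in J -> dot w ((bmap g px)^T *m a j) = 0) ->
  (forall v, cone_face a I J v -> dot mu v <= 0) ->
  w = 0 /\ mu = 0.
Proof.
move=> f1 g2 [ndg reg] Dy_ [ll XiP etaP eq0 act supp JI IA lamJ [ell ellJ [r r0 etaE]] dirP].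
move=> Hx HI HJ Hmu.
have [G1 _] := gtilde_C1 g2.1.
have [L1 _] := Lag_C1 lam f1 g2.
set yb := gtilde g px in XiP etaP IA dirP ndg reg *.
set y' := 'd (gtilde g) px d in etaP dirP ndg reg *.
pose A := active a c yb.
have Dyb : polyhedron a c yb by case: XiP => -[].
(* The increment y_k - yb keeps exactly the constraints in I active. *)
have [dd dI dA] : exists2 dd, forall i, i \in I -> dot (a i) dd = 0 &
    forall i, i \in A -> i \notin I -> dot (a i) dd < 0.
  have /filter_ex[k [Dk Ak]] : \forall k \near U, polyhedron a c (y_ k) /\ active a c (y_ k) = I.
    by apply: filterI.
  exists (y_ k - yb) => [i iI|i iA iI]; rewrite dotBr.
    have := fintype.subsetP IA i iI; rewrite inE => /eqP ->.
    by move: iI; rewrite -Ak inE => /eqP ->; rewrite subrr.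
  move: iA; rewrite inE => /eqP ->; rewrite subr_lt0 lt_neqAle Dk andbT.
  by move: iI; rewrite -Ak inE.
have KE : minkowski_diff (cone_face a A J) (cone_face a A I) = cone_face a I J.
  exact: cone_face_diff IA JI dI dA.
have fJ : is_face (critical_cone (polyhedron a c) yb lam) (cone_face a A J).
  by apply: cone_face_is_face Dyb lamJ _ _ => //; exact: fintype.subset_trans JI IA.
have fI : is_face (critical_cone (polyhedron a c) yb lam) (cone_face a A I).
  exact: cone_face_is_face Dyb lamJ JI IA.
have fIJ : cone_face a A I `<=` cone_face a A J.
  by move=> v [vA vI]; split=> // j /(fintype.subsetP JI); exact: vI.
have feta : cone_face a A J `<=` perp eta.
  move=> v [_ vJ]; apply/perpP; rewrite etaE dotBl dotZl.
  by rewrite (fgcone_dot_eq0 ellJ vJ) (fgcone_dot_eq0 lamJ vJ) mulr0 subr0.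
have w0 : w = 0.
  apply: contrapT => w0.
  have nw0 : - w <> 0 by move/eqP; rewrite oppr_eq0 => /eqP.
  have bw : minkowski_diff (cone_face a A J) (cone_face a A I) (bmap g px *m (- w)).
    rewrite KE mulmxN; split=> [i iI|j jJ]; rewrite dotNr dot_mulmx dotC.
      by rewrite oppr_le0 HI.
    by rewrite HJ // oppr0.
  have [wt] := reg lam XiP eta etaP eq0 _ _ fJ fI dirP fIJ feta _ nw0 bw.
  rewrite KE Jac2_mulmx // => /Hmu Hwt.
  rewrite -mulmxA Jac2_mulmx // -/(dot _ _) dotNl oppr_gt0 => H.
  by have := Hx wt; lra.
split=> //; apply: ndg.
  apply: dot_eq0; set v := _ *m mu.
  have H dx : dot mu (Jac2 (gtilde g) px *m dx) >= 0.
    by have := Hx dx; rewrite w0 dot0l add0r Jac2_mulmx.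
  have := H (- v); have := H v; rewrite mulmxN dotNr dot_mulmx -/v.
  by move=> H1 H2; lra.
have [co muE] : exists co : 'I_m -> R, mu = \sum_(i in I) co i *: a i.
  apply: farkas_span => v Hv; apply: Hmu; split=> [i iI|j jJ].
    by rewrite Hv.
  by rewrite Hv // (fintype.subsetP JI).
exists m, co, (fun i => if i \in I then a i else 0); split; last first.
  rewrite muE [LHS]big_mkcond /=; apply: eq_bigr => i _.
  by case: ifP => _; rewrite ?scaler0.
move=> i; split.
  by apply/tangent_polyhedron => //; exact: dirP.1.
case: ifP => [iI|_]; last by move=> v _; rewrite dot0l.
move=> v [_ [u_ [t_ [uv _ t0 Hu]]]].
have /cvgr_to_le : dot (a i) (u_ k) @[k --> \oo] --> dot (a i) v.
  by apply: cvg_dot; [exact: cvg_cst | exact: uv].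
apply; apply: nearW => k.
have /(tangent_polyhedron _ Dyb)/(_ i (fintype.subsetP IA i iI)) := Hu k.
by rewrite dotDr dirP.2 // add0r dotZr pmulr_rle0.
Qed.

(** Otherwise the minimisers of kkt_ekeland all have nonzero residual. They form
    again an approximate solution in the direction d, as they are within
    r_ = o(t_) of the given points, and the limit of their adjoint vectors
    contradicts dir_regular_trivial. *)
Lemma kkt_correction (T : Type) (U : set_system T) {UU : UltraFilter U}
    (R : realType) (l n s m : nat)
    (f : 'cV[R]_l * 'cV[R]_n -> 'cV[R]_n)
    (g : 'cV[R]_l * 'cV[R]_n * 'cV[R]_n -> 'cV[R]_s)
    (a : 'I_m -> 'cV[R]_s) (c : 'I_m -> R) (px d : 'cV[R]_l * 'cV[R]_n)
    (t_ : T -> R) (px_ : T -> 'cV[R]_l * 'cV[R]_n) (y_ lam_ : T -> 'cV[R]_s)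
    (ep_ r_ : T -> R) :
  C1 f -> C2 g -> dir_regular f g (polyhedron a c) px d ->
  kkt_seq U f g a c px d t_ px_ y_ lam_ ->
  (\forall k \near U, 0 < ep_ k) -> ep_ @ U --> (0 : R) ->
  (\forall k \near U, 0 < r_ k) -> (t_ k)^-1 * r_ k @[k --> U] --> (0 : R) ->
  (\forall k \near U, residual f g (px_ k) (lam_ k) (y_ k) <= ep_ k * r_ k) ->
  \forall k \near U, exists2 x, `|x - (px_ k).2| <= r_ k &
    exists2 lam, normal_cone (polyhedron a c) (gtilde g ((px_ k).1, x)) lam &
      f ((px_ k).1, x) + (bmap g ((px_ k).1, x))^T *m lam = 0.
Proof.
move=> f1 g2 reg kkt ep0 epc r0 rc res.
apply: contrapT => /ultra_contra nH.
have [b1 _] := bmap_C1 g2; have [G1 _] := gtilde_C1 g2.1.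
have [t0 tt dd N_ [M HM] st fe] := kkt.
pose Q k (z : 'cV[R]_n * 'cV[R]_s * 'cV[R]_s * 'cV[R]_n * 'cV[R]_s) : Prop :=
  let p := (px_ k).1 in
  let: (x, lam, y, w, mu) := z in
  [/\ normal_cone (polyhedron a c) y lam,
      `|x - (px_ k).2| <= r_ k, `|lam - lam_ k| <= r_ k &
      residual f g (p, x) lam y <= ep_ k * r_ k] /\
  [/\ dot w w + dot mu mu = 1,
       forall dx, - (ep_ k * `|dx|) <=
         dot w ('d f (p, x) (0, dx) + ('d (bmap g) (p, x) (0, dx))^T *m lam) +
         dot mu ('d (gtilde g) (p, x) (0, dx)),
       forall dl t0, 0 < t0 -> (forall t, 0 < t -> t <= t0 ->
           normal_cone (polyhedron a c) y (lam + t *: dl)) ->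
         - (ep_ k * `|dl|) <= dot w ((bmap g (p, x))^T *m dl) &
       forall dy t0, 0 < t0 -> (forall t, 0 < t -> t <= t0 ->
           normal_cone (polyhedron a c) (y + t *: dy) lam) ->
         - (ep_ k * `|dy|) <= - dot mu dy].
have : \forall k \near U, exists z, Q k z.
  near=> k.
  have ek : 0 < ep_ k by near: k.
  have rk : 0 < r_ k by near: k.
  have Nk : normal_cone (polyhedron a c) (y_ k) (lam_ k) by near: k.
  have Rk : residual f g ((px_ k).1, (px_ k).2) (lam_ k) (y_ k) <= ep_ k * r_ k.
    by rewrite -surjective_pairing; near: k.
  have nHk : ~ (exists2 x, `|x - (px_ k).2| <= r_ k &
    exists2 lam, normal_cone (polyhedron a c) (gtilde g ((px_ k).1, x)) lam &
      f ((px_ k).1, x) + (bmap g ((px_ k).1, x))^T *m lam = 0) by near: k.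
  have [x [lam [y [[Ny xr lr yr rr] [[E1 E2]|[w [mu Hw]]]]]]] :=
    kkt_ekeland f1 g2 ek rk Nk Rk.
    by exfalso; apply: nHk; exists x => //; exists lam => //; rewrite E2.
  by exists (x, lam, y, w, mu).
move=> /(near_choice (0, 0, 0, 0, 0))[z_ Hz].
pose x_ k := (z_ k).1.1.1.1; pose la_ k := (z_ k).1.1.1.2.
pose ya_ k := (z_ k).1.1.2; pose w_ k := (z_ k).1.2; pose mu_ k := (z_ k).2.
pose pa_ k := ((px_ k).1, x_ k).
have HQ : \forall k \near U, Q k (x_ k, la_ k, ya_ k, w_ k, mu_ k).
  by apply: filterS Hz => k; rewrite /x_ /la_ /ya_ /w_ /mu_; case: (z_ k) => -[[[]]].
have rc0 : r_ @ U --> (0 : R).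
  have H : t_ k * ((t_ k)^-1 * r_ k) @[k --> U] --> (0 * 0 : R) by exact: cvgM.
  rewrite mul0r in H; apply: cvg_trans H; apply: near_eq_cvg.
  by apply: filterS t0 => k tk; rewrite mulrA divff ?mul1r // gt_eqF.
have rt0 : ep_ k * ((t_ k)^-1 * r_ k) @[k --> U] --> (0 : R).
  by rewrite -(mul0r 0); exact: cvgM.
have kkt' : kkt_seq U f g a c px d t_ pa_ ya_ la_.
  split=> //.
  - have H : (t_ k)^-1 *: (pa_ k - px_ k) @[k --> U] --> (0 : 'cV[R]_l * 'cV[R]_n).
      apply: norm_squeeze0 rc; near=> k.
      have tk : 0 < t_ k by near: k.
      have [[_ xr _ _] _] : Q k (x_ k, la_ k, ya_ k, w_ k, mu_ k) by near: k.
      rewrite normrZ gtr0_norm ?invr_gt0 //; apply: ler_wpM2l.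
        by rewrite invr_ge0 ltW.
      by rewrite prod_normE /= subrr normr0 max_r.
    have H2 : (t_ k)^-1 *: (pa_ k - px_ k) + (t_ k)^-1 *: (px_ k - px)
        @[k --> U] --> 0 + d by exact: cvgD.
    rewrite add0r in H2; apply: cvg_trans H2; apply: near_eq_cvg.
    by apply: nearW => k; rewrite -scalerDr addrA subrK.
  - by apply: filterS HQ => k [[]].
  - exists (1 + M); near=> k.
    have [[_ _ lr _] _] : Q k (x_ k, la_ k, ya_ k, w_ k, mu_ k) by near: k.
    rewrite -[la_ k](subrK (lam_ k)) (le_trans (ler_normD _ _)) // lerD //.
      by rewrite (le_trans lr) //; near: k; exact: (cvgr_le 0 rc0 1 ltr01).
    by near: k.
  - apply: norm_squeeze0 rt0; near=> k.
    have tk : 0 < t_ k by near: k.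
    have [[_ _ _ rr] _] : Q k (x_ k, la_ k, ya_ k, w_ k, mu_ k) by near: k.
    rewrite normrZ gtr0_norm ?invr_gt0 // mulrCA; apply: ler_wpM2l.
      by rewrite invr_ge0 ltW.
    by apply: (le_trans _ rr); have [] := norm_le_residual f g (pa_ k) (la_ k) (ya_ k).
  - apply: norm_squeeze0 rt0; near=> k.
    have tk : 0 < t_ k by near: k.
    have [[_ _ _ rr] _] : Q k (x_ k, la_ k, ya_ k, w_ k, mu_ k) by near: k.
    rewrite normrZ gtr0_norm ?invr_gt0 // mulrCA; apply: ler_wpM2l.
      by rewrite invr_ge0 ltW.
    by apply: (le_trans _ rr); have [] := norm_le_residual f g (pa_ k) (la_ k) (ya_ k).
have [lam [eta [I [J lim]]]] := kkt_seq_limit f1 g2 kkt'.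
have ll := lim_lam lim.
have pac : pa_ @ U --> px by exact: scaled_cvg0 t0 tt (kkt_dir kkt').
have wmu : \forall k \near U, dot (w_ k) (w_ k) + dot (mu_ k) (mu_ k) = 1.
  by apply: filterS HQ => k [_ []].
have unit_le (n1 n2 : nat) (v : 'cV[R]_n1) (v' : 'cV[R]_n2) :
    dot v v + dot v' v' = 1 -> `|v| <= 1.
  move=> H; apply: (le_trans (norm_le_enorm _)).
  rewrite -(@ler_pXn2r _ 2) ?nnegrE ?enorm_ge0 // sqr_enorm expr1n -H.
  by rewrite lerDl dot_ge0.
have [w wc] : exists w : 'cV[R]_n, w_ @ U --> w.
  by apply: (@ultra_bounded_mx_cvg _ U _ _ _ _ _ 1); apply: filterS wmu => k /unit_le.
have [mu muc] : exists mu : 'cV[R]_s, mu_ @ U --> mu.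
  apply: (@ultra_bounded_mx_cvg _ U _ _ _ _ _ 1); apply: filterS wmu => k.
  by rewrite addrC => /unit_le.
have norm1 : dot w w + dot mu mu = 1.
  apply: (@cvg_unique _ _ (dot (w_ k) (w_ k) + dot (mu_ k) (mu_ k) @[k --> U])).
  - exact: Rhausdorff.
  - by apply: cvgD; [exact: (cvg_dot wc wc) | exact: (cvg_dot muc muc)].
  - apply: cvg_trans (@cvg_cst _ (1 : R) _ U _); apply: near_eq_cvg.
    by apply: filterS wmu => k ->.
have epv (q : R) : - (ep_ k * q) @[k --> U] --> (0 : R).
  rewrite -(oppr0) -(mul0r q); apply: cvgN; apply: cvgM => //; exact: cvg_cst.
have bc : bmap g (pa_ k) @[k --> U] --> bmap g px.
  exact: (cvg_comp _ _ pac (C1_continuous b1 (x := px))).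
have Ny : \forall k \near U, normal_cone (polyhedron a c) (ya_ k) (la_ k).
  exact: kkt_normal kkt'.
have [w0 mu0] : w = 0 /\ mu = 0; last first.
  by move: norm1; rewrite w0 mu0 !dot0l addr0 => /esym/eqP; rewrite oner_eq0.
have cb v : dot (w_ k) ((bmap g (pa_ k))^T *m v) @[k --> U] --> dot w ((bmap g px)^T *m v).
  by apply: (cvg_dot wc); apply: cvg_mulmx; [exact: cvg_trmx | exact: cvg_cst].
(* The normal cone at y contains the a i, i in I, as directions of increase;
   the a j in the support of lam can also be decreased. *)
have HI i : i \in I -> 0 <= dot w ((bmap g px)^T *m a i).
  move=> iI; apply: (ler_lim_near (epv `|a i|) (cb (a i))); near=> k.
  have [_ [_ _ Hl _]] : Q k (x_ k, la_ k, ya_ k, w_ k, mu_ k) by near: k.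
  apply: (Hl (a i) 1) => // t t1 _.
  have /normal_polyhedronP[Dk Nk] : normal_cone (polyhedron a c) (ya_ k) (la_ k) by near: k.
  apply/normal_polyhedronP; split=> //.
  rewrite -[la_ k]scale1r; apply: fgcone_conv => //; first exact: ltW.
  apply: fgcone_gen.
  by have -> : active a c (ya_ k) = I by near: k; exact: lim_active lim.
apply: (dir_regular_trivial f1 g2 reg _ lim) => //.
- by apply: filterS Ny => k [].
- move=> dx.
  rewrite (Lag_C1 lam f1 g2).2.
  have H : dot (w_ k) ('d f (pa_ k) (0, dx) + ('d (bmap g) (pa_ k) (0, dx))^T *m la_ k) +
      dot (mu_ k) ('d (gtilde g) (pa_ k) (0, dx)) @[k --> U] -->
      dot w ('d f px (0, dx) + ('d (bmap g) px (0, dx))^T *m lam) +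
      dot mu ('d (gtilde g) px (0, dx)).
    apply: cvgD.
      apply: (cvg_dot wc); apply: cvgD.
        exact: (cvg_comp _ _ pac (f1.2 (0, dx) px)).
      apply: cvg_mulmx; last exact: ll.
      apply: cvg_trmx; exact: (cvg_comp _ _ pac (b1.2 (0, dx) px)).
    by apply: (cvg_dot muc); exact: (cvg_comp _ _ pac (G1.2 (0, dx) px)).
  apply: (ler_lim_near (epv `|dx|) H).
  by apply: filterS HQ => k [_ [_ Hx _ _]]; exact: Hx.
- move=> j jJ; apply/eqP; rewrite eq_le HI ?(fintype.subsetP (lim_JI lim)) // andbT.
  rewrite -oppr_ge0 -dotNr -mulmxN.
  apply: (ler_lim_near (epv `|- a j|) (cb (- a j))); near=> k.
  have [_ [_ _ Hl _]] : Q k (x_ k, la_ k, ya_ k, w_ k, mu_ k) by near: k.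
  have Dk : polyhedron a c (ya_ k).
    by near: k; apply: filterS Ny => k [].
  have Ak : active a c (ya_ k) = I by near: k; exact: lim_active lim.
  have [al [al0 alE]] : exists al : 'I_m -> R,
      (forall j, j \in J -> 0 < al j) /\ la_ k = \sum_(j in J) al j *: a j.
    by near: k; exact: lim_support lim.
  apply: (Hl (- a j) (al j)) => [|t tp tal]; first exact: al0.
  apply/normal_polyhedronP; split=> //; rewrite Ak.
  apply: (fgcone_sub (lim_JI lim)).
  exists (fun i => if i \in J then al i - (if i == j then t else 0) else 0).
  split=> [i|].
    case: ifP => // iJ; case: eqP => [->|_]; first by rewrite subr_ge0.
    by rewrite subr0; apply/ltW/al0.
  rewrite alE (bigD1 j) //= [RHS](bigD1 j) //= jJ eqxx scalerN scalerBl addrAC.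
  congr (_ + _); apply: eq_bigr => i /andP[iJ /negPf ->].
  by rewrite iJ subr0.
- move=> v Hv; rewrite -oppr_ge0.
  have cm : - dot (mu_ k) v @[k --> U] --> - dot mu v.
    by apply: cvgN; apply: (cvg_dot muc); exact: cvg_cst.
  apply: (ler_lim_near (epv `|v|) cm); near=> k.
  have [_ [_ _ _ Hy]] : Q k (x_ k, la_ k, ya_ k, w_ k, mu_ k) by near: k.
  have Dk : polyhedron a c (ya_ k).
    by near: k; apply: filterS Ny => k [].
  have Ak : active a c (ya_ k) = I by near: k; exact: lim_active lim.
  have [al [al0 alE]] : exists al : 'I_m -> R,
      (forall j, j \in J -> 0 < al j) /\ la_ k = \sum_(j in J) al j *: a j.
    by near: k; exact: lim_support lim.
  have [|t1 t10 Ht1] := @polyhedron_step _ _ _ a c (ya_ k) v Dk.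
    by rewrite Ak; exact: Hv.1.
  apply: (Hy v t1) => // t tp tt1.
  apply/normal_polyhedronP; split; first by apply: Ht1 => //; exact: ltW.
  rewrite alE; apply: (@fgcone_sub _ _ _ J).
    apply/fintype.subsetP => j jJ; rewrite inE dotDr dotZr Hv.2 // mulr0 addr0.
    have : j \in active a c (ya_ k) by rewrite Ak (fintype.subsetP (lim_JI lim)).
    by rewrite inE.
  exists (fun j => if j \in J then al j else 0); split=> [j|].
    by case: ifP => // jJ; apply/ltW/al0.
  by apply: eq_bigr => j ->.
Unshelve. all: by end_near. Qed.

(** * Solutions, linearized solutions and approximate solutions *)

Lemma sol_mapP (R : realType) (l n s : nat)
    (f : 'cV[R]_l * 'cV[R]_n -> 'cV[R]_n)
    (g : 'cV[R]_l * 'cV[R]_n * 'cV[R]_n -> 'cV[R]_s) (D : set 'cV[R]_s) p x :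
  sol_map f g D p x <-> Psi g D (p, x, x) (- f (p, x)).
Proof.
split=> [[v Nv /eqP]|H]; last by exists (- f (p, x)); rewrite ?subrr.
by rewrite addrC addr_eq0 => /eqP <-.
Qed.

Lemma sol_map_of_multiplier (R : realType) (l n s : nat)
    (f : 'cV[R]_l * 'cV[R]_n -> 'cV[R]_n)
    (g : 'cV[R]_l * 'cV[R]_n * 'cV[R]_n -> 'cV[R]_s) (D : set 'cV[R]_s) p x lam :
  C1 g -> normal_cone D (gtilde g (p, x)) lam ->
  f (p, x) + (bmap g (p, x))^T *m lam = 0 -> sol_map f g D p x.
Proof.
move=> g1 Nl /eqP; rewrite addrC addr_eq0 => /eqP E; apply/sol_mapP.
by rewrite -E; exact: (@Psi_of_multiplier _ _ _ _ g D (p, x, x) lam g1 Nl).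
Qed.

Lemma linearized_of_solutions (T : Type) (F : set_system T) {FF : ProperFilter F}
    (R : realType) (l n s : nat) (f : 'cV[R]_l * 'cV[R]_n -> 'cV[R]_n)
    (g : 'cV[R]_l * 'cV[R]_n * 'cV[R]_n -> 'cV[R]_s) (D : set 'cV[R]_s)
    (px d : 'cV[R]_l * 'cV[R]_n) (t_ : T -> R) (px_ : T -> 'cV[R]_l * 'cV[R]_n) :
  C1 f -> sol_map f g D px.1 px.2 ->
  (\forall k \near F, 0 < t_ k) -> t_ @ F --> (0 : R) ->
  (t_ k)^-1 *: (px_ k - px) @[k --> F] --> d ->
  (\forall k \near F, sol_map f g D (px_ k).1 (px_ k).2) ->
  linearized_ge f g D px d.1 d.2.
Proof.
move=> f1 S0 t0 tt dd S_.
rewrite /linearized_ge -surjective_pairing.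
exists (- 'd f px d); last by rewrite subrr.
move: S0 => /sol_mapP; rewrite -surjective_pairing => S0.
apply: (@tangent_cone_filter _ F _ _ _ _ _ _ (fun k => ((px_ k, (px_ k).2), - f (px_ k))) t_) => //.
  by apply: filterS S_ => k /sol_mapP; rewrite -surjective_pairing.
pose proof (diff_seq (f1.1 px) t0 tt dd) as H.
have c2 : (t_ k)^-1 *: ((px_ k).2 - px.2) @[k --> F] --> d.2.
  exact: (cvg_snd_comp dd).
pose proof (cvg_npair (cvg_npair dd c2) (cvgN H)) as H2.
apply: cvg_trans H2; apply: near_eq_cvg; apply: nearW => k.
congr pair => /=.
by apply/matrixP => i j; rewrite !mxE; ring.
Qed.

(** A tangent vector of the graph of Psi in the direction (q, u, u) comes from points
    (p_k, x_k, z_k) with x_k - z_k = o(t_k). Their multipliers satisfy the system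
    at (p_k, x_k) up to o(t_k), with y_k = g (p_k, x_k, z_k). *)
Lemma linearized_kkt_seq (U : set_system nat) {UU : UltraFilter U}
    (R : realType) (l n s m : nat) (f : 'cV[R]_l * 'cV[R]_n -> 'cV[R]_n)
    (g : 'cV[R]_l * 'cV[R]_n * 'cV[R]_n -> 'cV[R]_s) (a : 'I_m -> 'cV[R]_s)
    (c : 'I_m -> R) (kappa : R) (px : 'cV[R]_l * 'cV[R]_n) q u :
  C1 f -> C2 g -> 0 <= kappa ->
  (\forall e \near (px, px.2), (edist_set e.2 (Gamma g (polyhedron a c) e.1)
      <= kappa%:E * edist_set (g e) (polyhedron a c))%E) ->
  \oo `<=` U -> linearized_ge f g (polyhedron a c) px q u ->
  exists t_ px_ y_ lam_, kkt_seq U f g a c px (q, u) t_ px_ y_ lam_.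
Proof.
move=> f1 g2 k0 Hk oU [v [_ [u_ [t_ [uv tt' t0' Hu]]]] vE].
have [b1 bE] := bmap_C1 g2; have [G1 GE] := gtilde_C1 g2.1.
have J1 := Jac3_C1 g2.
have tt : t_ @ U --> (0 : R) by apply: cvg_trans tt'; exact: cvg_fmap2.
have uu : u_ @ U --> ((q, u, u), v) by apply: cvg_trans uv; exact: cvg_fmap2.
have t0 : \forall k \near U, 0 < t_ k by exact: nearW.
pose e := (px, px.2).
pose e_ k := e + t_ k *: (u_ k).1; pose zs_ k := - f px + t_ k *: (u_ k).2.
have Pz k : Psi g (polyhedron a c) (e_ k) (zs_ k) by exact: Hu.
have de : (t_ k)^-1 *: (e_ k - e) @[k --> U] --> (q, u, u).
  have H : (u_ k).1 @[k --> U] --> (q, u, u) by exact: (cvg_fst_comp uu).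
  apply: cvg_trans H; apply: near_eq_cvg; apply: nearW => k.
  by rewrite addrC addKr scalerA mulVf ?scale1r // gt_eqF.
have dz : (t_ k)^-1 *: (zs_ k - - f px) @[k --> U] --> v.
  have H : (u_ k).2 @[k --> U] --> v by exact: (cvg_snd_comp uu).
  apply: cvg_trans H; apply: near_eq_cvg; apply: nearW => k.
  by rewrite addrC addKr scalerA mulVf ?scale1r // gt_eqF.
have ec : e_ @ U --> e by exact: scaled_cvg0 t0 tt de.
have zc : zs_ @ U --> - f px by exact: scaled_cvg0 t0 tt dz.
have Hl : \forall k \near U, exists lam, [/\ normal_cone (polyhedron a c) (g (e_ k)) lam,
    (Jac3 g (e_ k))^T *m lam = zs_ k & enorm lam <= kappa * enorm (zs_ k)].
  have Hm : \forall k \near U, forall zs, Psi g (polyhedron a c) (e_ k) zs ->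
    exists lam, [/\ normal_cone (polyhedron a c) (g (e_ k)) lam,
    (Jac3 g (e_ k))^T *m lam = zs & enorm lam <= kappa * enorm zs].
    exact: (ec _ (multiplier_near g2.1 k0 Hk)).
  by apply: filterS Hm => k Hm; exact: (Hm _ (Pz k)).
have [lam_ Hlam] := near_choice 0 Hl.
pose px_ k := (e_ k).1.
have dd : (t_ k)^-1 *: (px_ k - px) @[k --> U] --> (q, u).
  exact: (cvg_fst_comp de).
have bnd : \forall k \near U, `|lam_ k| <= kappa * enorm (- f px) + 1.
  have H : kappa * enorm (zs_ k) @[k --> U] --> kappa * enorm (- f px).
    by apply: cvgM; [exact: cvg_cst | exact: cvg_enorm].
  near=> k.
  have [_ _ H1] : [/\ normal_cone (polyhedron a c) (g (e_ k)) (lam_ k),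
    (Jac3 g (e_ k))^T *m lam_ k = zs_ k & enorm (lam_ k) <= kappa * enorm (zs_ k)].
    by near: k.
  apply: (le_trans (norm_le_enorm _)); apply: (le_trans H1).
  by near: k; apply: (cvgr_le _ H); rewrite ltrDl.
have [lam ll] := ultra_bounded_mx_cvg bnd.
have ddiag : (t_ k)^-1 *: ((px_ k, (px_ k).2) - e) @[k --> U] --> (q, u, u).
  have H : (t_ k)^-1 *: ((px_ k).2 - px.2) @[k --> U] --> u.
    exact: (cvg_snd_comp dd).
  exact: (cvg_npair dd H).
exists t_, px_, (g \o e_), lam_; split=> //.
- by apply: filterS Hlam => k [].
- by exists (kappa * enorm (- f px) + 1).
- pose proof (diff_seq (f1.1 px) t0 tt dd) as H1.
  pose proof (diff_seq (J1.1 e) t0 tt de) as H2.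
  pose proof (diff_seq (J1.1 e) t0 tt ddiag) as H3.
  have H0 : (t_ k)^-1 *: (Jac3 g (px_ k, (px_ k).2) - Jac3 g e) -
      (t_ k)^-1 *: (Jac3 g (e_ k) - Jac3 g e) @[k --> U] --> (0 : 'M[R]_(s, n)).
    by rewrite -(subrr ('d (Jac3 g) e (q, u, u))); exact: cvgB H3 H2.
  pose proof (cvg_mulmx (cvg_trmx H0) ll) as H4.
  have E0 : (0 : 'M[R]_(s, n))^T *m lam = 0 by rewrite trmx0 mul0mx.
  rewrite E0 in H4.
  have H5 : (t_ k)^-1 *: (f (px_ k) - f px) + (t_ k)^-1 *: (zs_ k - - f px) +
      ((t_ k)^-1 *: (Jac3 g (px_ k, (px_ k).2) - Jac3 g e) -
       (t_ k)^-1 *: (Jac3 g (e_ k) - Jac3 g e))^T *m lam_ k @[k --> U] -->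
      'd f px (q, u) + v + 0.
    by apply: cvgD; [exact: cvgD H1 dz | exact: H4].
  rewrite vE addr0 in H5.
  apply: cvg_trans H5; apply: near_eq_cvg; apply: filterS Hlam => k [_ E _].
  by rewrite opprK; apply: psi_residual_split; exact: E.
- pose proof (diff_seq (g2.1.1 e) t0 tt de) as H2.
  pose proof (diff_seq (g2.1.1 e) t0 tt ddiag) as H3.
  have H4 : (t_ k)^-1 *: (g (px_ k, (px_ k).2) - g e) -
      (t_ k)^-1 *: (g (e_ k) - g e) @[k --> U] --> (0 : 'cV[R]_s).
    by rewrite -(subrr ('d g e (q, u, u))); exact: cvgB H3 H2.
  apply: cvg_trans H4; apply: near_eq_cvg; apply: nearW => k.
  by rewrite -scalerBr; congr (_ *: _); rewrite opprB addrA subrK.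
Unshelve. all: by end_near. Qed.

(** The radius r_ = t_ (sqrt s_ + t_), where t_ s_ is the residual, is o(t_)
    but much larger than the residual; the term t_ keeps it positive. *)
Lemma kkt_solution (T : Type) (U : set_system T) {UU : UltraFilter U}
    (R : realType) (l n s m : nat)
    (f : 'cV[R]_l * 'cV[R]_n -> 'cV[R]_n)
    (g : 'cV[R]_l * 'cV[R]_n * 'cV[R]_n -> 'cV[R]_s)
    (a : 'I_m -> 'cV[R]_s) (c : 'I_m -> R) (px d : 'cV[R]_l * 'cV[R]_n)
    (t_ : T -> R) (px_ : T -> 'cV[R]_l * 'cV[R]_n) (y_ lam_ : T -> 'cV[R]_s) :
  C1 f -> C2 g -> dir_regular f g (polyhedron a c) px d ->
  kkt_seq U f g a c px d t_ px_ y_ lam_ ->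
  exists x_, (\forall k \near U, sol_map f g (polyhedron a c) (px_ k).1 (x_ k)) /\
    (t_ k)^-1 *: (x_ k - (px_ k).2) @[k --> U] --> (0 : 'cV[R]_n).
Proof.
move=> f1 g2 reg kkt; have [t0 tt dd N_ bd st fe] := kkt.
pose s_ k := (t_ k)^-1 * residual f g (px_ k) (lam_ k) (y_ k).
have s0 : \forall k \near U, 0 <= s_ k.
  apply: filterS t0 => k tk; apply: mulr_ge0; first by rewrite invr_ge0 ltW.
  exact: sqrtr_ge0.
have sc : s_ @ U --> (0 : R).
  have H : n%:R * `|(t_ k)^-1 *: (f (px_ k) + (bmap g (px_ k))^T *m lam_ k)| +
      s%:R * `|(t_ k)^-1 *: (gtilde g (px_ k) - y_ k)| @[k --> U] -->
      n%:R * `|0 : 'cV[R]_n| + s%:R * `|0 : 'cV[R]_s|.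
    apply: cvgD; apply: cvgM; [exact: cvg_cst | exact: cvg_norm st |
                               exact: cvg_cst | exact: cvg_norm fe].
  rewrite !normr0 !mulr0 addr0 in H.
  apply: norm_squeeze0 H; near=> k.
  have tk : 0 < t_ k by near: k.
  have sk : 0 <= s_ k by near: k.
  rewrite ger0_norm // !normrZ gtr0_norm ?invr_gt0 // !(mulrCA _ (t_ k)^-1) -mulrDr.
  apply: ler_wpM2l; first by rewrite invr_ge0 ltW.
  exact: residual_le.
pose ep_ k := Num.sqrt (s_ k) + t_ k.
have epc : ep_ @ U --> (0 : R).
  rewrite -(addr0 0) -{1}sqrtr0; apply: cvgD => //.
  apply: (@cvg_comp _ _ _ _ Num.sqrt _ _ _ sc); exact: sqrt_continuous.
pose r_ k := t_ k * ep_ k.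
have ep0 : \forall k \near U, 0 < ep_ k.
  by apply: filterS t0 => k tk; rewrite ltr_wpDl // sqrtr_ge0.
have r0 : \forall k \near U, 0 < r_ k.
  by near=> k; apply: mulr_gt0; near: k.
have rc : (t_ k)^-1 * r_ k @[k --> U] --> (0 : R).
  apply: cvg_trans epc; apply: near_eq_cvg; apply: filterS t0 => k tk.
  by rewrite mulKf // gt_eqF.
have rr : \forall k \near U, residual f g (px_ k) (lam_ k) (y_ k) <= ep_ k * r_ k.
  near=> k.
  have tk : 0 < t_ k by near: k.
  have sk : 0 <= s_ k by near: k.
  rewrite /r_ mulrCA -ler_pdivrMl //; change (s_ k <= ep_ k * ep_ k).
  rewrite /ep_ -{1}(sqr_sqrtr sk); have := sqrtr_ge0 (s_ k).
  by set q := Num.sqrt _; nra.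
pose proof (kkt_correction f1 g2 reg kkt ep0 epc r0 rc rr) as H.
have H' : \forall k \near U, exists x, `|x - (px_ k).2| <= r_ k /\
    exists2 lam, normal_cone (polyhedron a c) (gtilde g ((px_ k).1, x)) lam &
      f ((px_ k).1, x) + (bmap g ((px_ k).1, x))^T *m lam = 0.
  by apply: filterS H => k [x h1 h2]; exists x.
have [x_ Hx] := near_choice 0 H'.
exists x_; split.
  apply: filterS Hx => k [_ [lam Nl E]].
  exact: sol_map_of_multiplier g2.1 Nl E.
apply: norm_squeeze0 rc; near=> k.
have tk : 0 < t_ k by near: k.
rewrite normrZ gtr0_norm ?invr_gt0 //; apply: ler_wpM2l.
  by rewrite invr_ge0 ltW.
by near: k; apply: filterS Hx => k [].
Unshelve. all: by end_near. Qed.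

(** The limit data determine approximate solutions for any step lengths t_ and any
    parameters p_ with the given direction. So the first assumption of the theorem,
    which concerns one sequence of steps, yields all of them. *)
Lemma kkt_limit_seq (S T : Type) (U0 : set_system S) (U : set_system T) {UU : ProperFilter U}
    (R : realType) (l n s m : nat)
    (f : 'cV[R]_l * 'cV[R]_n -> 'cV[R]_n)
    (g : 'cV[R]_l * 'cV[R]_n * 'cV[R]_n -> 'cV[R]_s)
    (a : 'I_m -> 'cV[R]_s) (c : 'I_m -> R) (px d : 'cV[R]_l * 'cV[R]_n)
    (y_ lam_ : S -> 'cV[R]_s) lam eta I J (t_ : T -> R) (p_ : T -> 'cV[R]_l) :
  C1 f -> C2 g -> kkt_limit U0 f g a c px d y_ lam_ lam eta I J ->
  (\forall k \near U, 0 < t_ k) -> t_ @ U --> (0 : R) ->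
  (t_ k)^-1 *: (p_ k - px.1) @[k --> U] --> d.1 ->
  kkt_seq U f g a c px d t_ (fun k => (p_ k, px.2 + t_ k *: d.2))
    (fun k => gtilde g px + t_ k *: 'd (gtilde g) px d)
    (fun k => lam + t_ k *: eta).
Proof.
move=> f1 g2 [_ XiP _ eq0 _ _ JI IA lamJ [ell ellJ [r r0 etaE]] dirP] t0 tt dp.
have [b1 bE] := bmap_C1 g2; have [G1 GE] := gtilde_C1 g2.1.
have [L1 LE] := Lag_C1 lam f1 g2.
have Dy : polyhedron a c (gtilde g px) by case: XiP => -[].
have [t1 t10 Ht1] := polyhedron_step Dy dirP.1.
set y' := 'd (gtilde g) px d in dirP Ht1 *.
pose px_ k := (p_ k, px.2 + t_ k *: d.2).
have dd : (t_ k)^-1 *: (px_ k - px) @[k --> U] --> d.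
  have H : (t_ k)^-1 *: (px.2 + t_ k *: d.2 - px.2) @[k --> U] --> d.2.
    apply: cvg_trans (@cvg_cst _ d.2 _ U _); apply: near_eq_cvg.
    apply: filterS t0 => k tk.
    by rewrite [px.2 + _]addrC addrK scalerA mulVf ?scale1r // gt_eqF.
  rewrite [d in _ --> d]surjective_pairing; exact: (cvg_npair dp H).
have lc : lam + t_ k *: eta @[k --> U] --> lam.
  rewrite -[X in _ --> X]addr0 -(scale0r eta); apply: cvgD; first exact: cvg_cst.
  exact: cvgZl.
have trc : t_ k * r @[k --> U] --> 0 * r by apply: cvgM => //; exact: cvg_cst.
split=> //.
- near=> k.
  have tk : 0 < t_ k by near: k.
  have tk1 : t_ k <= t1 by near: k; exact: (cvgr_le 0 tt t1 t10).
  have tr : t_ k * r <= 1.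
    by near: k; apply: (cvgr_le _ trc); rewrite mul0r ltr01.
  apply/normal_polyhedronP; split; first by apply: Ht1 => //; exact: ltW.
  apply: (@fgcone_sub _ _ _ J).
    apply/fintype.subsetP => j /(fintype.subsetP JI) jI.
    rewrite inE dotDr dotZr dirP.2 // mulr0 addr0.
    by have := fintype.subsetP IA j jI; rewrite inE.
  have -> : lam + t_ k *: eta = (1 - t_ k * r) *: lam + t_ k *: ell.
    by rewrite etaE; apply/matrixP => i j; rewrite !mxE; ring.
  by apply: fgcone_conv => //; [rewrite subr_ge0 | exact: ltW].
- exists (`|lam| + 1); near=> k.
  by near: k; apply: (cvgr_norm_le _ lc); rewrite ltrDl.
- have E0 : f px + (bmap g px)^T *m lam = 0.
    by case: XiP => _ -> _; rewrite subrr.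
  pose proof (diff_seq (L1.1 px) t0 tt dd) as H1.
  have bc : bmap g (px_ k) @[k --> U] --> bmap g px.
    have pc : px_ @ U --> px by exact: scaled_cvg0 t0 tt dd.
    exact: (cvg_comp _ _ pc (C1_continuous b1 (x := px))).
  have H2 : (bmap g (px_ k))^T *m eta @[k --> U] --> (bmap g px)^T *m eta.
    by apply: cvg_mulmx; [exact: cvg_trmx | exact: cvg_cst].
  pose proof (cvgD H1 H2) as H3.
  rewrite -eq0 in H3; apply: cvg_trans H3; apply: near_eq_cvg.
  apply: filterS t0 => k tk.
  exact: (lag_step_split _ _ _ _ tk E0).
- pose proof (diff_seq (G1.1 px) t0 tt dd) as H1.
  have H2 : (t_ k)^-1 *: (gtilde g (px_ k) - gtilde g px) - y' @[k --> U] --> (0 : 'cV[R]_s).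
    by rewrite -(subrr y'); apply: cvgB; [exact: H1 | exact: cvg_cst].
  apply: cvg_trans H2; apply: near_eq_cvg.
  apply: filterS t0 => k tk.
  rewrite opprD addrA [RHS]scalerBr scalerA mulVf ?scale1r // gt_eqF //.
Unshelve. all: by end_near. Qed.

(** * The Aubin property and the graphical derivative *)

Definition subregular_at (R : realType) (l n s : nat)
    (g : 'cV[R]_l * 'cV[R]_n * 'cV[R]_n -> 'cV[R]_s) (D : set 'cV[R]_s)
    (kappa : R) (px : 'cV[R]_l * 'cV[R]_n) : Prop :=
  \forall e \near (px, px.2), (edist_set e.2 (Gamma g D e.1)
      <= kappa%:E * edist_set (g e) D)%E.

(** By the tangency of the limit direction q of the parameters there is u such that
    (q, u) solves the linearized equation; kkt_limit_seq and the correction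
    step follow (q, u). *)
Lemma solution_near_base (T : Type) (U : set_system T) {UU : UltraFilter U}
    (R : realType) (l n s m : nat) (f : 'cV[R]_l * 'cV[R]_n -> 'cV[R]_n)
    (g : 'cV[R]_l * 'cV[R]_n * 'cV[R]_n -> 'cV[R]_s) (a : 'I_m -> 'cV[R]_s)
    (c : 'I_m -> R) (kappa : R) (P : set 'cV[R]_l) (px : 'cV[R]_l * 'cV[R]_n)
    (p_ : T -> 'cV[R]_l) :
  C1 f -> C2 g -> 0 <= kappa -> subregular_at g (polyhedron a c) kappa px ->
  P px.1 ->
  (forall q, tangent_cone P px.1 q ->
     exists u, linearized_ge f g (polyhedron a c) px q u) ->
  (forall d, d <> 0 -> linearized_ge f g (polyhedron a c) px d.1 d.2 ->
     dir_regular f g (polyhedron a c) px d) ->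
  (\forall k \near U, P (p_ k)) -> (\forall k \near U, 0 < `|p_ k - px.1|) ->
  `|p_ k - px.1| @[k --> U] --> (0 : R) ->
  exists (K : R) (x_ : T -> 'cV[R]_n), 0 <= K /\ \forall k \near U,
    sol_map f g (polyhedron a c) (p_ k) (x_ k) /\ `|x_ k - px.2| <= K * `|p_ k - px.1|.
Proof.
move=> f1 g2 k0 Hk Ppx Hi Hii Pp s0 sc.
pose s_ k := `|p_ k - px.1|.
have [q qc] : exists q : 'cV[R]_l, (s_ k)^-1 *: (p_ k - px.1) @[k --> U] --> q.
  apply: (@ultra_bounded_mx_cvg _ U _ _ _ _ _ 1); apply: filterS s0 => k sk.
  by rewrite normrZ gtr0_norm ?invr_gt0 // mulVf // gt_eqF.
have q1 : `|q| = 1.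
  apply: (@cvg_unique _ _ (`|(s_ k)^-1 *: (p_ k - px.1)| @[k --> U])).
  - exact: Rhausdorff.
  - exact: cvg_norm.
  - apply: cvg_trans (@cvg_cst _ (1 : R) _ U _); apply: near_eq_cvg.
    apply: filterS s0 => k sk.
    by rewrite normrZ gtr0_norm ?invr_gt0 // mulVf // gt_eqF.
have [u Lqu] : exists u, linearized_ge f g (polyhedron a c) px q u.
  by apply: Hi; exact: (tangent_cone_filter Ppx s0 sc Pp qc).
have qu0 : (q, u) <> 0.
  by move=> [q0 _]; move/eqP: q1; rewrite q0 normr0 eq_sym oner_eq0.
have reg := Hii (q, u) qu0 Lqu.
have [U0 [UU0 oU0]] := ultraFilterLemma (F := \oo) _.
have [t_ [px_ [y_ [lam_ kkt]]]] := linearized_kkt_seq f1 g2 k0 Hk oU0 Lqu.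
have [lam [eta [I [J lim]]]] := kkt_seq_limit f1 g2 kkt.
have qc' : (s_ k)^-1 *: (p_ k - px.1) @[k --> U] --> (q, u).1 by exact: qc.
pose proof (kkt_limit_seq f1 g2 lim s0 sc qc') as kkt'.
have [x_ [Sx xc]] := kkt_solution f1 g2 reg kkt'.
exists (`|u| + 1), x_; split; first by rewrite addr_ge0.
near=> k; split; first by near: k.
have sk : 0 < s_ k by near: k.
have : `|(s_ k)^-1 *: (x_ k - (px.2 + s_ k *: u))| <= 1.
  near: k; have := cvgr_norm_le _ xc; apply; by rewrite normr0 ltr01.
rewrite normrZ gtr0_norm ?invr_gt0 // ler_pdivrMl // mulr1 => H.
have -> : x_ k - px.2 = x_ k - (px.2 + s_ k *: u) + s_ k *: u.
  by rewrite opprD addrA subrK.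
apply: (le_trans (ler_normD _ _)).
have -> : (`|u| + 1) * `|p_ k - px.1| = s_ k + s_ k * `|u| by rewrite /s_; ring.
by apply: lerD => //; rewrite normrZ gtr0_norm.
Unshelve. all: by end_near. Qed.

(** The solutions x_ at p_, with their multipliers and with y = g (p_, x_, x_),
    are approximate solutions at p'_ with residual O(|p_ - p'_|), which is o of
    their distance to the reference point. The factor h_, which diverges arbitrarily
    slowly, leaves room for the correction step. *)
Lemma solution_stability (T : Type) (U : set_system T) {UU : UltraFilter U}
    (R : realType) (l n s m : nat) (f : 'cV[R]_l * 'cV[R]_n -> 'cV[R]_n)
    (g : 'cV[R]_l * 'cV[R]_n * 'cV[R]_n -> 'cV[R]_s) (a : 'I_m -> 'cV[R]_s)
    (c : 'I_m -> R) (kappa : R) (px : 'cV[R]_l * 'cV[R]_n)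
    (p_ p'_ : T -> 'cV[R]_l) (x_ : T -> 'cV[R]_n) (h_ : T -> R) :
  C1 f -> C2 g -> 0 <= kappa -> subregular_at g (polyhedron a c) kappa px ->
  sol_map f g (polyhedron a c) px.1 px.2 ->
  (forall d, d <> 0 -> linearized_ge f g (polyhedron a c) px d.1 d.2 ->
     dir_regular f g (polyhedron a c) px d) ->
  (\forall k \near U, sol_map f g (polyhedron a c) (p_ k) (x_ k)) ->
  (\forall k \near U, 0 < `|p_ k - p'_ k|) ->
  `|(p_ k, x_ k) - px| @[k --> U] --> (0 : R) ->
  (forall e, 0 < e -> \forall k \near U, `|p_ k - p'_ k| < e * `|(p_ k, x_ k) - px|) ->
  (\forall k \near U, 0 < h_ k) -> (h_ k)^-1 @[k --> U] --> (0 : R) ->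
  exists2 K, 0 <= K & \forall k \near U, exists2 y,
    sol_map f g (polyhedron a c) (p'_ k) y &
    `|y - x_ k| <= K * h_ k * `|p_ k - p'_ k|.
Proof.
move=> f1 g2 k0 Hk S0 Hii S_ d0 tc dt h0 hc.
have [b1 bE] := bmap_C1 g2; have [G1 GE] := gtilde_C1 g2.1.
pose px_ k := (p_ k, x_ k); pose px'_ k := (p'_ k, x_ k).
pose t_ k := `|px_ k - px|; pose de k := `|p_ k - p'_ k|.
have de_ge0 k : 0 <= de k by exact: normr_ge0.
have t_ge0 k : 0 <= t_ k by exact: normr_ge0.
have t0 : \forall k \near U, 0 < t_ k.
  near=> k.
  have H1 : 0 < de k by near: k.
  have H2 : de k < 1 * t_ k by near: k; exact: dt.
  by rewrite mul1r in H2; exact: lt_trans H2.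
have [d dd] : exists d : 'cV[R]_l * 'cV[R]_n, (t_ k)^-1 *: (px_ k - px) @[k --> U] --> d.
  apply: (@ultra_bounded_pair_cvg _ U _ _ _ _ _ 1); apply: filterS t0 => k tk.
  by rewrite normrZ gtr0_norm ?invr_gt0 // mulVf // gt_eqF.
have dn1 : `|d| = 1.
  apply: (@cvg_unique _ _ (`|(t_ k)^-1 *: (px_ k - px)| @[k --> U])).
  - exact: Rhausdorff.
  - exact: cvg_norm.
  - apply: cvg_trans (@cvg_cst _ (1 : R) _ U _); apply: near_eq_cvg.
    apply: filterS t0 => k tk.
    by rewrite normrZ gtr0_norm ?invr_gt0 // mulVf // gt_eqF.
have dne0 : d <> 0 by move=> E; move/eqP: dn1; rewrite E normr0 eq_sym oner_eq0.
have reg : dir_regular f g (polyhedron a c) px d.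
  by apply: Hii => //; exact: (linearized_of_solutions f1 S0 t0 tc dd S_).
have pxc : px_ @ U --> px by exact: scaled_cvg0 t0 tc dd.
have rat : (t_ k)^-1 * de k @[k --> U] --> (0 : R).
  apply/cvgr0Pnorm_lt => e e0; near=> k.
  have tk : 0 < t_ k by near: k.
  rewrite ger0_norm; last by rewrite mulr_ge0 ?invr_ge0 ?t_ge0 ?de_ge0.
  rewrite ltr_pdivrMl // mulrC.
  by near: k; exact: dt.
have [L1 [r1 [L10 r10 lipf]]] := C1_lipschitz_fst px f1.
have [L2 [r2 [L20 r20 lipb]]] := C1_lipschitz_fst px b1.
have [L3 [r3 [L30 r30 lipG]]] := C1_lipschitz_fst px G1.
have de0 : de @ U --> (0 : R).
  have H : t_ k * ((t_ k)^-1 * de k) @[k --> U] --> (0 * 0 : R) by exact: cvgM.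
  rewrite mul0r in H; apply: cvg_trans H; apply: near_eq_cvg.
  by apply: filterS t0 => k tk; rewrite mulVKf // gt_eqF.
have px'c0 : px'_ k - px_ k @[k --> U] --> (0 : 'cV[R]_l * 'cV[R]_n).
  apply: norm_squeeze0 de0; apply: nearW => k.
  by rewrite prod_normE /= subrr normr0 max_l // distrC.
have px'c : px'_ @ U --> px.
  have H : px'_ k - px_ k + px_ k @[k --> U] --> 0 + px by exact: cvgD.
  rewrite add0r in H; apply: cvg_trans H; apply: near_eq_cvg; apply: nearW => k.
  by rewrite subrK.
have near_px r : 0 < r -> \forall k \near U, `|px_ k - px| < r /\ `|px'_ k - px| < r.
  move=> r0; apply: filterI.
    by move/cvgrPdist_lt : pxc => /(_ r r0); apply: filterS => k; rewrite distrC.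
  by move/cvgrPdist_lt : px'c => /(_ r r0); apply: filterS => k; rewrite distrC.
have ec : (px_ k, x_ k) @[k --> U] --> (px, px.2).
  by apply: cvg_npair => //; exact: (cvg_snd_comp pxc).
have Hl : \forall k \near U, exists lam,
    [/\ normal_cone (polyhedron a c) (gtilde g (px_ k)) lam,
        f (px_ k) + (bmap g (px_ k))^T *m lam = 0 & `|lam| <= kappa * enorm (- f (px_ k))].
  have Hm : \forall k \near U, forall zs, Psi g (polyhedron a c) (px_ k, x_ k) zs ->
    exists lam, [/\ normal_cone (polyhedron a c) (g (px_ k, x_ k)) lam,
      (Jac3 g (px_ k, x_ k))^T *m lam = zs & enorm lam <= kappa * enorm zs].
    exact: (ec _ (multiplier_near g2.1 k0 Hk)).
  near=> k.
  have Sk : sol_map f g (polyhedron a c) (p_ k) (x_ k) by near: k.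
  have Hmk : forall zs, Psi g (polyhedron a c) (px_ k, x_ k) zs ->
    exists lam, [/\ normal_cone (polyhedron a c) (g (px_ k, x_ k)) lam,
      (Jac3 g (px_ k, x_ k))^T *m lam = zs & enorm lam <= kappa * enorm zs] by near: k.
  have [lam [Nl El Bl]] := Hmk _ ((sol_mapP _ _ _ _ _).1 Sk).
  exists lam; split=> //; last exact: le_trans (norm_le_enorm _) Bl.
  have {}El : (bmap g (px_ k))^T *m lam = - f (px_ k) by [].
  by rewrite El subrr.
have [lam_ Hlam] := near_choice 0 Hl.
pose M := kappa * enorm (- f px) + 1.
have M0 : 0 <= M by rewrite addr_ge0 // mulr_ge0 // enorm_ge0.
have bnd : \forall k \near U, `|lam_ k| <= M.
  have fc : f (px_ k) @[k --> U] --> f px.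
    exact: (cvg_comp _ _ pxc (C1_continuous f1 (x := px))).
  have H : kappa * enorm (- f (px_ k)) @[k --> U] --> kappa * enorm (- f px).
    by apply: cvgM; [exact: cvg_cst | apply: cvg_enorm; exact: cvgN].
  near=> k.
  have [_ _ H1] : [/\ normal_cone (polyhedron a c) (gtilde g (px_ k)) (lam_ k),
        f (px_ k) + (bmap g (px_ k))^T *m lam_ k = 0 &
        `|lam_ k| <= kappa * enorm (- f (px_ k))] by near: k.
  by apply: (le_trans H1); near: k; apply: (cvgr_le _ H); rewrite ltrDl.
pose K1 := L1 + s%:R * (L2 * M).
have K10 : 0 <= K1 by rewrite addr_ge0 // mulr_ge0 // mulr_ge0.
have res1 : \forall k \near U, `|f (px'_ k) + (bmap g (px'_ k))^T *m lam_ k| <= K1 * de k.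
  near=> k.
  have [_ E _] : [/\ normal_cone (polyhedron a c) (gtilde g (px_ k)) (lam_ k),
        f (px_ k) + (bmap g (px_ k))^T *m lam_ k = 0 &
        `|lam_ k| <= kappa * enorm (- f (px_ k))] by near: k.
  have lM : `|lam_ k| <= M by near: k.
  have [n1 n1'] : `|px_ k - px| < r1 /\ `|px'_ k - px| < r1 by near: k; exact: near_px.
  have [n2 n2'] : `|px_ k - px| < r2 /\ `|px'_ k - px| < r2 by near: k; exact: near_px.
  have Hf := lipf _ _ _ n1' n1; have Hb := lipb _ _ _ n2' n2.
  have -> : f (px'_ k) + (bmap g (px'_ k))^T *m lam_ k =
      (f (px'_ k) - f (px_ k)) + (bmap g (px'_ k) - bmap g (px_ k))^T *m lam_ k.
    exact: residual_shift.
  apply: (le_trans (ler_normD _ _)); rewrite /K1 mulrDl; apply: lerD.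
    by rewrite /de [`|p_ k - _|]distrC.
  apply: (le_trans (norm_mulmx_le _ _)); rewrite -mulrA; apply: ler_wpM2l => //.
  apply: (@le_trans _ _ ((L2 * de k) * M)); last by rewrite mulrAC.
  apply: ler_pM => //; apply: (le_trans (norm_trmx _)).
  by rewrite /de [`|p_ k - _|]distrC.
have res2 : \forall k \near U, `|gtilde g (px'_ k) - gtilde g (px_ k)| <= L3 * de k.
  near=> k.
  have [n3 n3'] : `|px_ k - px| < r3 /\ `|px'_ k - px| < r3 by near: k; exact: near_px.
  by have := lipG _ _ _ n3' n3; rewrite /de [`|p_ k - _|]distrC.
have kkt : kkt_seq U f g a c px d t_ px'_ (gtilde g \o px_) lam_.
  have ratK K : (t_ k)^-1 * (K * de k) @[k --> U] --> (0 : R).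
    have H : K * ((t_ k)^-1 * de k) @[k --> U] --> K * 0.
      by apply: cvgM => //; exact: cvg_cst.
    rewrite mulr0 in H; apply: cvg_trans H; apply: near_eq_cvg; apply: nearW => k.
    by rewrite mulrCA.
  split=> //.
  - have H : (t_ k)^-1 *: (px'_ k - px_ k) @[k --> U] --> (0 : 'cV[R]_l * 'cV[R]_n).
      apply: norm_squeeze0 rat; apply: filterS t0 => k tk.
      rewrite normrZ gtr0_norm ?invr_gt0 //; apply: ler_wpM2l.
        by rewrite invr_ge0 ltW.
      by rewrite prod_normE /= subrr normr0 max_l // distrC.
    have H2 : (t_ k)^-1 *: (px'_ k - px_ k) + (t_ k)^-1 *: (px_ k - px)
        @[k --> U] --> 0 + d by exact: cvgD.
    rewrite add0r in H2; apply: cvg_trans H2; apply: near_eq_cvg.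
    by apply: nearW => k; rewrite -scalerDr addrA subrK.
  - by apply: filterS Hlam => k [].
  - by exists M.
  - apply: norm_squeeze0 (ratK K1); near=> k.
    have tk : 0 < t_ k by near: k.
    rewrite normrZ gtr0_norm ?invr_gt0 //; apply: ler_wpM2l.
      by rewrite invr_ge0 ltW.
    by near: k.
  - apply: norm_squeeze0 (ratK L3); near=> k.
    have tk : 0 < t_ k by near: k.
    rewrite normrZ gtr0_norm ?invr_gt0 //; apply: ler_wpM2l.
      by rewrite invr_ge0 ltW.
    by near: k.
pose K := n%:R * K1 + s%:R * L3 + 1.
have K0 : 0 < K by rewrite ltr_wpDl // addr_ge0 // mulr_ge0.
have res : \forall k \near U, residual f g (px'_ k) (lam_ k) (gtilde g (px_ k)) <= K * de k.
  near=> k.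
  have H1 : `|f (px'_ k) + (bmap g (px'_ k))^T *m lam_ k| <= K1 * de k by near: k.
  have H2 : `|gtilde g (px'_ k) - gtilde g (px_ k)| <= L3 * de k by near: k.
  apply: (le_trans (residual_le _ _ _ _ _)).
  apply: (@le_trans _ _ (n%:R * (K1 * de k) + s%:R * (L3 * de k))).
    by apply: lerD; apply: ler_wpM2l.
  have : 0 <= de k by [].
  by rewrite /K; lra.
(* The radius r_ = K de / ep is o(t), as ep is at least sqrt (de / t), and at most
   K h de, as ep is at least 1 / h. *)
pose ep_ k := Num.sqrt ((t_ k)^-1 * de k) + (h_ k)^-1.
have epc : ep_ @ U --> (0 : R).
  rewrite -(addr0 0) -{1}sqrtr0; apply: cvgD => //.
  apply: (@cvg_comp _ _ _ _ Num.sqrt _ _ _ rat); exact: sqrt_continuous.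
have ep0 : \forall k \near U, 0 < ep_ k.
  by apply: filterS h0 => k hk; rewrite ltr_wpDl ?sqrtr_ge0 // invr_gt0.
pose r_ k := K * de k / ep_ k.
have r0 : \forall k \near U, 0 < r_ k.
  near=> k; have ek : 0 < ep_ k by near: k.
  have dk : 0 < de k by near: k.
  by rewrite divr_gt0 // mulr_gt0.
have sqc : K * Num.sqrt ((t_ k)^-1 * de k) @[k --> U] --> (0 : R).
  rewrite -(mulr0 K) -sqrtr0; apply: cvgM; first exact: cvg_cst.
  apply: (@cvg_comp _ _ _ _ Num.sqrt _ _ _ rat); exact: sqrt_continuous.
have rc : (t_ k)^-1 * r_ k @[k --> U] --> (0 : R).
  apply: norm_squeeze0 sqc; near=> k.
  have tk : 0 < t_ k by near: k.
  have ek : 0 < ep_ k by near: k.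
  have rk : 0 < r_ k by near: k.
  have hk : 0 < h_ k by near: k.
  rewrite ger0_norm; last by rewrite mulr_ge0 ?invr_ge0 ?t_ge0 // ltW.
  rewrite /r_ mulrA ler_pdivrMr // mulrCA -!mulrA; apply: ler_wpM2l; first exact: ltW.
  have z0 : 0 <= (t_ k)^-1 * de k by rewrite mulr_ge0 // invr_ge0 ltW.
  rewrite -{1}(sqr_sqrtr z0) /ep_ mulrDr expr2 lerDl mulr_ge0 ?sqrtr_ge0 //.
  by rewrite invr_ge0 ltW.
have rr : \forall k \near U, residual f g (px'_ k) (lam_ k) (gtilde g (px_ k)) <= ep_ k * r_ k.
  near=> k; have ek : 0 < ep_ k by near: k.
  rewrite /r_ mulrCA divff ?gt_eqF // mulr1; by near: k.
pose proof (kkt_correction f1 g2 reg kkt ep0 epc r0 rc rr) as H.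
exists K; first exact: ltW.
near=> k.
have ek : 0 < ep_ k by near: k.
have hk : 0 < h_ k by near: k.
have [y Hy [lam Nl E]] : exists2 x, `|x - (px'_ k).2| <= r_ k &
    exists2 lam, normal_cone (polyhedron a c) (gtilde g ((px'_ k).1, x)) lam &
      f ((px'_ k).1, x) + (bmap g ((px'_ k).1, x))^T *m lam = 0 by near: k.
exists y; first exact: sol_map_of_multiplier g2.1 Nl E.
apply: (le_trans Hy); rewrite /r_ ler_pdivrMr // -[X in _ <= X * _]mulrA -[X in _ <= X]mulrA.
apply: ler_wpM2l; first exact: ltW.
have : 1 <= h_ k * ep_ k.
  by rewrite /ep_ mulrDr divff ?gt_eqF // lerDr mulr_ge0 ?sqrtr_ge0 // ltW.
have : 0 <= de k by [].
by rewrite -/(de k); nra.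
Unshelve. all: by end_near. Qed.

Lemma aubin_of_max_norm (R : realType) (l n : nat) (S : 'cV[R]_l -> set 'cV[R]_n)
    (P : set 'cV[R]_l) (pbar : 'cV[R]_l) (xbar : 'cV[R]_n) (r L : R) :
  0 < r -> 0 <= L ->
  (forall p p' x, P p -> P p' -> `|p - pbar| < r -> `|p' - pbar| < r ->
     `|x - xbar| < r -> S p x -> exists2 y, S p' y & `|y - x| <= L * `|p - p'|) ->
  aubin_property_rel S P pbar xbar.
Proof.
move=> r0 L0 H.
exists (ball pbar r), (ball xbar r), (n%:R * L); split.
- exact: nbhsx_ballx.
- exact: nbhsx_ballx.
- exact: mulr_ge0.
move=> p p' [Pp Bp] [Pp' Bp'] x [Sx Bx].
have [y Sy Hy] : exists2 y, S p' y & `|y - x| <= L * `|p - p'|.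
  apply: H => //.
  - by move: Bp; rewrite -ball_normE /= distrC.
  - by move: Bp'; rewrite -ball_normE /= distrC.
  - by move: Bx; rewrite -ball_normE /= distrC.
have xy : enorm (x - y) <= n%:R * L * enorm (p - p').
  rewrite (le_trans (enorm_le_norm _)) // -mulrA; apply: ler_wpM2l => //.
  rewrite distrC (le_trans Hy) //; apply: ler_wpM2l => //; exact: norm_le_enorm.
exists y => //; set M := n%:R * L * enorm (p - p') in xy *.
have [M0|M0] := pselect (M = 0).
  exists 0; first by rewrite /= enorm0.
  have : enorm (x - y) = 0 by apply/eqP; rewrite eq_le enorm_ge0 -M0 xy.
  by move=> /enorm_eq0/eqP; rewrite subr_eq0 => /eqP ->; rewrite scaler0 addr0.
have Mp : 0 < M by rewrite lt_def (introN eqP M0) /= (le_trans (enorm_ge0 _) xy).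
exists (M^-1 *: (x - y)).
  by rewrite /= enormZ gtr0_norm ?invr_gt0 // ler_pdivrMl // mulr1.
by rewrite scalerA divff ?gt_eqF // scale1r addrC subrK.
Qed.

Lemma polyhedron_of_convex_polyhedral (R : realType) (s : nat) (D : set 'cV[R]_s) :
  convex_polyhedral D ->
  exists (m : nat) (a : 'I_m -> 'cV[R]_s) (c : 'I_m -> R), D = polyhedron a c.
Proof.
move=> [m [A [c ->]]].
exists m, (fun i => (row i A)^T), (fun i => c i 0).
apply/funext => x; apply/propext.
have E i : dot (row i A)^T x = (A *m x) i 0.
  by rewrite /dot trmxK -row_mul mxE.
by split=> H i; have := H i; rewrite E.
Qed.

(** If the property fails there are, for each k, parameters and a solution within
    1/(k+1) of the reference point that violate the estimate with constant
    (k+1)^2. The two cases for |p_ - p'_| against the distance of (p_, x_) to the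
    reference point contradict this, by solution_stability with factor
    h_ k = k + 1, and by solution_near_base. *)
Lemma sol_map_aubin (R : realType) (l n s m : nat)
    (f : 'cV[R]_l * 'cV[R]_n -> 'cV[R]_n)
    (g : 'cV[R]_l * 'cV[R]_n * 'cV[R]_n -> 'cV[R]_s) (a : 'I_m -> 'cV[R]_s)
    (c : 'I_m -> R) (kappa : R) (P : set 'cV[R]_l) (px : 'cV[R]_l * 'cV[R]_n) :
  C1 f -> C2 g -> 0 <= kappa -> subregular_at g (polyhedron a c) kappa px ->
  sol_map f g (polyhedron a c) px.1 px.2 -> P px.1 ->
  (forall q, tangent_cone P px.1 q ->
     exists u, linearized_ge f g (polyhedron a c) px q u) ->
  (forall d, d <> 0 -> linearized_ge f g (polyhedron a c) px d.1 d.2 ->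
     dir_regular f g (polyhedron a c) px d) ->
  aubin_property_rel (sol_map f g (polyhedron a c)) P px.1 px.2.
Proof.
move=> f1 g2 k0 Hk S0 Ppx Hi Hii.
set S := sol_map f g (polyhedron a c).
apply: contrapT => nA.
pose h_ (k : nat) : R := k.+1%:R.
have bad (k : nat) : exists z : 'cV[R]_l * 'cV[R]_l * 'cV[R]_n,
    [/\ P z.1.1 /\ P z.1.2,
        [/\ `|z.1.1 - px.1| < (h_ k)^-1, `|z.1.2 - px.1| < (h_ k)^-1 &
            `|z.2 - px.2| < (h_ k)^-1],
        S z.1.1 z.2 &
        forall y, S z.1.2 y -> h_ k * h_ k * `|z.1.1 - z.1.2| < `|y - z.2|].
  apply: contrapT => nz; apply: nA.
  have hk : 0 < h_ k by rewrite ltr0n.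
  apply: (@aubin_of_max_norm _ _ _ _ _ _ _ (h_ k)^-1 (h_ k * h_ k)).
  - by rewrite invr_gt0.
  - by rewrite mulr_ge0 // ltW.
  - move=> p p' x Pp Pp' Bp Bp' Bx Sx; apply: contrapT => ny.
    apply: nz; exists (p, p', x); split=> // y Sy.
    by rewrite ltNge; apply/negP => Hy; apply: ny; exists y.
have [z_ Hz] := choice bad.
pose p_ k := (z_ k).1.1; pose p'_ k := (z_ k).1.2; pose x_ k := (z_ k).2.
have [U [UU oU]] := ultraFilterLemma (F := \oo) _.
have hc : (h_ k)^-1 @[k --> U] --> (0 : R).
  by apply: cvg_trans (@cvg_harmonic R); exact: cvg_fmap2.
have h0 k : 0 < h_ k by rewrite ltr0n.
have hbig (K : R) : \forall k \near U, K <= h_ k.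
  have K1 : 0 < (`|K| + 1)^-1 by rewrite invr_gt0 ltr_wpDl.
  pose proof (cvgr_le 0 hc _ K1) as H.
  apply: filterS H => k; rewrite lef_pV2 ?posrE // ?ltr_wpDl // => H.
  by rewrite (le_trans (ler_norm K)) // (le_trans _ H) // lerDl.
have H1 k : `|p_ k - px.1| < (h_ k)^-1 by case: (Hz k) => _ [].
have H2 k : `|p'_ k - px.1| < (h_ k)^-1 by case: (Hz k) => _ [].
have H3 k : `|x_ k - px.2| < (h_ k)^-1 by case: (Hz k) => _ [].
have HP k : P (p_ k) /\ P (p'_ k) by case: (Hz k).
have HS k : S (p_ k) (x_ k) by case: (Hz k).
have Hbad k y : S (p'_ k) y -> h_ k * h_ k * `|p_ k - p'_ k| < `|y - x_ k|.
  by case: (Hz k) => _ _ _; apply.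
pose de k := `|p_ k - p'_ k|; pose t_ k := `|(p_ k, x_ k) - px|.
have d0 k : 0 < de k.
  rewrite normr_gt0 subr_eq0; apply/negP => /eqP E.
  have := Hbad k (x_ k); rewrite -E => /(_ (HS k)).
  by rewrite !subrr !normr0 mulr0 ltxx.
have tc : t_ @ U --> (0 : R).
  apply: norm_squeeze0 hc; apply: nearW => k.
  rewrite ger0_norm; last exact: normr_ge0.
  by rewrite /t_ prod_normE ge_max /= !ltW // ?H1 ?H3.
have [small|] := pselect (forall e, 0 < e -> \forall k \near U, de k < e * t_ k).
  have Sn : \forall k \near U, S (p_ k) (x_ k) by exact: nearW.
  have dn : \forall k \near U, 0 < `|p_ k - p'_ k| by exact: nearW.
  have hn : \forall k \near U, 0 < h_ k by exact: nearW.
  have [K K0 HK] := @solution_stability _ U UU _ _ _ _ _ f g a c kappa px p_ p'_ x_ h_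
    f1 g2 k0 Hk S0 Hii Sn dn tc small hn hc.
  have /filter_ex[k [[y Sy Hy] Kk]] : \forall k \near U,
      (exists2 y, S (p'_ k) y & `|y - x_ k| <= K * h_ k * `|p_ k - p'_ k|) /\ K <= h_ k.
    by apply: filterI; [exact: HK | exact: hbig].
  have := Hbad k y Sy; rewrite ltNge => /negP; apply.
  by apply: (le_trans Hy); apply: ler_wpM2r => //; apply: ler_wpM2r => //; exact: ltW.
move=> /existsNP[e /not_implyP[e0 nd]].
have big : \forall k \near U, e * t_ k <= de k.
  pose proof (ultra_contra nd) as nd'.
  by apply: filterS nd' => k /negP; rewrite -leNgt.
pose s_ k := `|p'_ k - px.1|.
have sc : s_ @ U --> (0 : R).
  apply: norm_squeeze0 hc; apply: nearW => k.
  by rewrite ger0_norm; [exact/ltW/H2 | exact: normr_ge0].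
have xt k : `|x_ k - px.2| <= t_ k by rewrite /t_ prod_normE le_max lexx orbT.
have pt k : `|p_ k - px.1| <= t_ k by rewrite /t_ prod_normE le_max lexx.
have spt k : s_ k <= de k + t_ k.
  rewrite /s_ -(subrK (p_ k) (p'_ k)) -addrA (le_trans (ler_normD _ _)) //.
  by apply: lerD => //; rewrite /de distrC.
have [K [y_ [K0 HK]]] : exists (K : R) (y_ : nat -> 'cV[R]_n), 0 <= K /\
    \forall k \near U, S (p'_ k) (y_ k) /\ `|y_ k - px.2| <= K * s_ k.
  have [s0|ns0] := pselect (\forall k \near U, 0 < s_ k).
    have Pp' : \forall k \near U, P (p'_ k) by apply: nearW => k; case: (HP k).
    exact: (@solution_near_base _ U _ _ _ _ _ _ f g a c kappa P px p'_).
  exists 0, (fun=> px.2); split=> //.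
  pose proof (ultra_contra ns0) as ns0'.
  apply: filterS ns0' => k /negP.
  rewrite -leNgt normr_le0 subr_eq0 => /eqP ->.
  by rewrite subrr normr0 mul0r; split.
pose L := K * (1 + e^-1) + e^-1.
have /filter_ex[k [[[Sy Hy] dk] Lk]] : \forall k \near U,
    ((S (p'_ k) (y_ k) /\ `|y_ k - px.2| <= K * s_ k) /\ e * t_ k <= de k) /\
    Num.max 1 L <= h_ k.
  by apply: filterI; [apply: filterI | exact: hbig].
have := Hbad k _ Sy; rewrite ltNge => /negP; apply.
move: Lk; rewrite ge_max => /andP[h1 hL].
have te : t_ k <= e^-1 * de k by rewrite ler_pdivlMl.
have hh : L * de k <= h_ k * h_ k * de k.
  apply: ler_wpM2r; first exact: ltW.
  by rewrite (le_trans hL) // ler_peMr // ltW.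
apply: (le_trans _ hh).
have -> : y_ k - x_ k = (y_ k - px.2) - (x_ k - px.2).
  by apply/matrixP => i j; rewrite !mxE; ring.
rewrite (le_trans (ler_normB _ _)) //.
have E1 := xt k; have E2 := spt k.
apply: (@le_trans _ _ (K * (de k + e^-1 * de k) + e^-1 * de k)); last by rewrite /L; lra.
apply: lerD; last exact: le_trans E1 te.
apply: (le_trans Hy); apply: ler_wpM2l => //.
by apply: (le_trans E2); rewrite lerD2l.
Qed.

Lemma sol_map_derivative (R : realType) (l n s m : nat)
    (f : 'cV[R]_l * 'cV[R]_n -> 'cV[R]_n)
    (g : 'cV[R]_l * 'cV[R]_n * 'cV[R]_n -> 'cV[R]_s) (a : 'I_m -> 'cV[R]_s)
    (c : 'I_m -> R) (kappa : R) (px : 'cV[R]_l * 'cV[R]_n) q u :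
  C1 f -> C2 g -> 0 <= kappa -> subregular_at g (polyhedron a c) kappa px ->
  sol_map f g (polyhedron a c) px.1 px.2 ->
  (forall d, d <> 0 -> linearized_ge f g (polyhedron a c) px d.1 d.2 ->
     dir_regular f g (polyhedron a c) px d) ->
  graphical_derivative (sol_map f g (polyhedron a c)) px.1 px.2 q u <->
  linearized_ge f g (polyhedron a c) px q u.
Proof.
move=> f1 g2 k0 Hk S0 Hii; split.
  rewrite /graphical_derivative /= -surjective_pairing.
  move=> [_ [u_ [t_ [uu tt t0 Hu]]]].
  apply: (@linearized_of_solutions _ \oo _ _ _ _ _ f g _ px (q, u) t_
    (fun k => px + t_ k *: u_ k)) => //.
  - exact: nearW.
  - apply: cvg_trans uu; apply: near_eq_cvg; apply: nearW => k.
    by rewrite addrC addKr scalerA mulVf ?scale1r // gt_eqF.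
  - by apply: nearW => k; exact: Hu.
move=> Lqu; rewrite /graphical_derivative /= -surjective_pairing.
have Sg : graph (sol_map f g (polyhedron a c)) px by exact: S0.
have [U [UU oU]] := ultraFilterLemma (F := \oo) _.
have [t_ [px_ [y_ [lam_ kkt]]]] := linearized_kkt_seq f1 g2 k0 Hk oU Lqu.
have t0 := kkt_pos kkt; have tt := kkt_time kkt; have dd := kkt_dir kkt.
have [[-> ->]|qu0] := pselect ((q, u) = 0).
  apply: (@tangent_cone_filter _ U _ _ _ _ _ _ (fun=> px) t_) => //.
    exact: nearW.
  apply: cvg_trans (@cvg_cst _ (0 : 'cV[R]_l * 'cV[R]_n) _ U _).
  by apply: near_eq_cvg; apply: nearW => k; rewrite subrr scaler0.
have [x_ [Sx xc]] := kkt_solution f1 g2 (Hii (q, u) qu0 Lqu) kkt.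
apply: (@tangent_cone_filter _ U _ _ _ _ _ _ (fun k => ((px_ k).1, x_ k)) t_) => //.
pose proof (cvg_fst_comp dd) as d1.
pose proof (cvgD xc (cvg_snd_comp dd)) as d2.
rewrite add0r in d2.
pose proof (cvg_npair d1 d2) as d3.
apply: cvg_trans d3; apply: near_eq_cvg; apply: nearW => k.
have E : (t_ k)^-1 *: (x_ k - (px_ k).2) + (t_ k)^-1 *: ((px_ k).2 - px.2) =
    (t_ k)^-1 *: (x_ k - px.2) by rewrite -scalerDr addrA subrK.
exact: (congr2 pair erefl E).
Qed.

Unset Implicit Arguments.
Theorem theorem6p1 (R : realType) (l n s : nat)
    (f : 'cV[R]_l * 'cV[R]_n -> 'cV[R]_n)
    (g : 'cV[R]_l * 'cV[R]_n * 'cV[R]_n -> 'cV[R]_s)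
    (D : set 'cV[R]_s) (P : set 'cV[R]_l)
    (pbar : 'cV[R]_l) (xbar : 'cV[R]_n) :
  C1 f -> C2 g -> convex_polyhedral D ->
  sol_map f g D pbar xbar ->
  (exists2 kappa : R, 0 < kappa &
     \forall pxz \near (pbar, xbar, xbar),
       (edist_set pxz.2 (Gamma g D pxz.1)
          <= kappa%:E * edist_set (g pxz) D)%E) ->
  closed P -> P pbar ->
  (* (i) *)
  (forall q, tangent_cone P pbar q ->
     exists u, linearized_ge f g D (pbar, xbar) q u) ->
  (* (ii) *)
  (forall (q : 'cV[R]_l) (u : 'cV[R]_n), (q, u) <> (0, 0) ->
     linearized_ge f g D (pbar, xbar) q u ->
     (forall mu : 'cV[R]_s,
        (Jac2 (gtilde g) (pbar, xbar))^T *m mu = 0 ->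
        linear_hull
          (normal_cone (tangent_cone D (gtilde g (pbar, xbar)))
                       ('d (gtilde g) (pbar, xbar) (q, u))) mu ->
        mu = 0) /\
     (forall lambda : 'cV[R]_s,
        Xi g D (pbar, xbar) (- f (pbar, xbar)) (q, u) lambda ->
      forall eta : 'cV[R]_s,
        normal_cone (critical_cone D (gtilde g (pbar, xbar)) lambda)
                    ('d (gtilde g) (pbar, xbar) (q, u)) eta ->
        0 = 'd (Lag f g lambda) (pbar, xbar) (q, u)
            + (bmap g (pbar, xbar))^T *m eta ->
      forall F1 F2 : set 'cV[R]_s,
        is_face (critical_cone D (gtilde g (pbar, xbar)) lambda) F1 ->
        is_face (critical_cone D (gtilde g (pbar, xbar)) lambda) F2 ->
        F2 ('d (gtilde g) (pbar, xbar) (q, u)) ->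
        F2 `<=` F1 -> F1 `<=` perp eta ->
      forall w : 'cV[R]_n, w <> 0 ->
        minkowski_diff F1 F2 (bmap g (pbar, xbar) *m w) ->
      exists2 wt : 'cV[R]_n,
        minkowski_diff F1 F2 (Jac2 (gtilde g) (pbar, xbar) *m wt) &
        0 < (w^T *m Jac2 (Lag f g lambda) (pbar, xbar) *m wt) 0 0)) ->
  aubin_property_rel (sol_map f g D) P pbar xbar /\
  (forall q, tangent_cone P pbar q ->
     graphical_derivative (sol_map f g D) pbar xbar q =
     [set u | linearized_ge f g D (pbar, xbar) q u]).

Proof.
move=> f1 g2 /polyhedron_of_convex_polyhedral[m [a [c ->]]] S0 [kappa k0 Hk] _ Pp Hi Hii.
have k0' := ltW k0.
have Hk' : subregular_at g (polyhedron a c) kappa (pbar, xbar) by exact: Hk.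
have reg d : d <> 0 -> linearized_ge f g (polyhedron a c) (pbar, xbar) d.1 d.2 ->
    dir_regular f g (polyhedron a c) (pbar, xbar) d.
  by case: d => q u; exact: Hii.
split; first exact: (@sol_map_aubin R l n s m f g a c kappa P (pbar, xbar)).
move=> q _; apply/seteqP; split=> u.
  exact: (@sol_map_derivative R l n s m f g a c kappa (pbar, xbar) q u f1 g2 k0' Hk' S0 reg).1.
exact: (@sol_map_derivative R l n s m f g a c kappa (pbar, xbar) q u f1 g2 k0' Hk' S0 reg).2.
Qed.
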